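(* Let $p\ge 1$ and $m\in\mathbb{Z}_{\ge0}$. Let $\mathbf{c}=(c_1,\dots,c_{p+1})\in(\mathbb{C}\setminus\mathbb{Z})^{p+1}$ and $\mathbf{d}=(d_1,\dots,d_{p-1})\in(\mathbb{C}\setminus\mathbb{Z})^{p-1}$, with $d_j-d_k\notin\mathbb{Z}$ for $j\ne k$, and suppose $\Re\big(\sum_{j=1}^{p-1}d_j-\sum_{j=1}^{p+1}c_j\big)>-m-1$. Then \begin{multline*} \sum_{k=0}^{\infty}\frac{(\mathbf{c})_{k}}{(\mathbf{d})_{k}(m+k)!\,k!}\Big\{\sum_{d\in\mathbf{d}}\psi(d+k)+\psi(k+1)+\psi(1+m+k)-\sum_{c\in\mathbf{c}}\psi(c+k)\Big\}\\ =\frac{\pi}{m!}\Big\{\sum_{c\in\mathbf{c}}\cot(\pi c)-\sum_{d\in\mathbf{d}}\cot(\pi d)\Big\}\,{}_{p+1}F_{p}\!\left(\begin{matrix}\mathbf{c}\\1+m,\mathbf{d}\end{matrix}\right) +\frac{(1-\mathbf{d})_{1}}{(1-\mathbf{c})_{1}(m-1)!}\,{}_{p+2}F_{p+1}\!\left(\begin{matrix}1-m,2-\mathbf{d},1,1\\2-\mathbf{c}\end{matrix}\right)\\ -\frac{\Gamma(1-\mathbf{c})}{\Gamma(1-\mathbf{d})}\sum_{k=1}^{p-1}\frac{(-1)^m\Gamma(d_k-m)\Gamma(d_k)\Gamma(d_k-\mathbf{d}_{[k]})}{(d_k-m-1)(d_k-1)\Gamma(d_k-\mathbf{c})}\,{}_{p+1}F_{p}\!\left(\begin{matrix}1+\mathbf{c}-d_k\\2-d_k,\,2-d_k+m,\,1+\mathbf{d}_{[k]}-d_k\end{matrix}\right).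 \end{multline*}
   Context: $\psi=\Gamma'/\Gamma$ is the digamma function and $(x)_k=\Gamma(x+k)/\Gamma(x)$ the Pochhammer symbol. For a vector $\mathbf{a}=(a_1,\dots,a_q)$ and scalar $\beta$: $\Gamma(\mathbf{a})=\prod_i\Gamma(a_i)$, $(\mathbf{a})_k=\prod_i(a_i)_k$, $\mathbf{a}+\beta=(a_1+\beta,\dots,a_q+\beta)$, $\beta-\mathbf{a}=(\beta-a_1,\dots,\beta-a_q)$, $\mathbf{a}_{[k]}$ is $\mathbf{a}$ with the $k$-th component removed, and $\sum_{a\in\mathbf{a}}$ runs over the components of $\mathbf{a}$ (with multiplicity). ${}_pF_q(\mathbf{a};\mathbf{b};z)=\sum_{k\ge0}\frac{(\mathbf{a})_k}{(\mathbf{b})_k}\frac{z^k}{k!}$ is the generalized hypergeometric function; when the argument is omitted it is $z=1$. Listing several vectors/scalars separated by commas in a parameter row means concatenation. The term $\frac{1}{(m-1)!}{}_{p+2}F_{p+1}(1-m,2-\mathbf{d},1,1;2-\mathbf{c};1)$ is understood as the finite sum $\sum_{j=0}^{m-1}\frac{(-1)^j(2-\mathbf{d})_j\, j!}{(2-\mathbf{c})_j\,(m-1-j)!}$, which is $0$ for $m=0$. *)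

(* Defs.v *)
From Stdlib Require Import Reals List Factorial.
From Coquelicot Require Export Coquelicot.
Export ListNotations.
Open Scope C_scope.

Fixpoint csum (n : nat) (f : nat -> C) : C :=
  match n with O => 0 | S n' => csum n' f + f n' end.
Fixpoint cprod (n : nat) (f : nat -> C) : C :=
  match n with O => 1 | S n' => cprod n' f * f n' end.

Definition lsum (f : C -> C) (l : list C) : C := fold_right (fun x acc => f x + acc) 0 l.
Definition lprod (f : C -> C) (l : list C) : C := fold_right (fun x acc => f x * acc) 1 l.

Definition remove_nth (k : nat) (l : list C) : list C := firstn k l ++ skipn (S k) l.

Definition poch (x : C) (k : nat) : C := cprod k (fun j => x + INR j).

Definition Cexp (z : C) : C := (exp (Re z) * cos (Im z), exp (Re z) * sin (Im z))%R.
Definition Ccos (z : C) : C := (Cexp (Ci * z) + Cexp (- (Ci * z))) / 2.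
Definition Csin (z : C) : C := (Cexp (Ci * z) - Cexp (- (Ci * z))) / (2 * Ci).
Definition Ccot (z : C) : C := Ccos z / Csin z.
Definition Rcpow (x : R) (z : C) : C := Cexp (z * RtoC (ln x)).

Definition Clim (u : nat -> C) : C :=
  (real (Lim_seq (fun n => Re (u n))), real (Lim_seq (fun n => Im (u n))))%R.
Definition CSeries (a : nat -> C) : C := Clim (fun n => csum (S n) a).

(** Gamma function (Gauss limit formula) and its reciprocal 1/Gamma (entire;
    vanishes at the poles of Gamma). *)
Definition Gamma (z : C) : C :=
  Clim (fun n => INR (fact n) * Rcpow (INR n) z / cprod (S n) (fun j => z + INR j)).
Definition rGamma (z : C) : C :=
  Clim (fun n => cprod (S n) (fun j => z + INR j) / (INR (fact n) * Rcpow (INR n) z)).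

Definition digamma (z : C) : C := C_derive Gamma z / Gamma z.

Definition hyp1 (a b : list C) : C :=
  CSeries (fun n => lprod (fun x => poch x n) a / (lprod (fun x => poch x n) b * INR (fact n))).

Definition notZ (z : C) : Prop := forall k : Z, z <> RtoC (IZR k).

(* Main.v *)
Require Import Defs.
From Stdlib Require Import Reals List Factorial ZArith Lra Lia.
From Coquelicot Require Import Coquelicot.
Open Scope C_scope.

(** Apply Gauss' product to
    [Gamma(1-d-s) Gamma(-m-s) Gamma(-s) / Gamma(1-c-s)]: the powers of [N] no longer depend on [s],
    and what is left is a rational function [R_N] of [s] with [R_N -> 1] at infinity.  By partial fractions its
    residues add up to (sum of poles) - (sum of zeros) = O(N), which after normalization is
    [O(N^(1-b))] with [b = m + 2 + Re (sum d - sum c) > 1].  So the normalized residues have sum tending to 0, and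
    by Tannery's theorem (domination by [(k+1)^(-b)]) the limit can be taken termwise:
    the double poles [s = k >= 0] produce the digamma series (the cotangents come from the
    reflection formula of digamma), the simple poles [s = -1, ..., -m] the finite sum, and the simple poles
    [s = 1 - d_l + k] the hypergeometric series attached to [d_l]. *)

(** * Limits of complex sequences *)

(** Finite products replace a contour integral of the Gamma quotient by algebra. The price is
    uniformity: Tannery's theorem needs a bound for all k <= N, also for k close to N. There the
    factors with about N - k terms are small, which is recorded by a power of [tau N k], roughly (N
    - k)/N; the exponents of k + 1 and of [tau] come out as -b and b, so the second power never
    exceeds 1. At a double pole the residue is a derivative, so first-order expansions with an
    O(h^2) remainder suffice. Written through logarithmic derivatives they turn products into sums
    of 1/(x + j); these become digamma values once logarithms are subtracted, and the logarithms
    cancel because [c] has two more entries than [d]. The double poles yield psi(1 - x), while the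
    series asks for psi(x + k); hence the reflection formula, obtained from Euler's partial
    fractions of the cotangent. [Gamma], [rGamma], [C_derive] and [hyp1] are total limits with
    default values, so each of them is evaluated only after a convergence proof. *)

Fixpoint rsum (n : nat) (f : nat -> R) : R :=
  match n with O => 0%R | S n' => (rsum n' f + f n')%R end.

(** [Clim] returns a value for every sequence, so convergence is carried by this relation, and
    [Ccvg_Clim] leads back. Measuring the distance by a real sequence makes squeezing available. *)
Definition Ccvg (u : nat -> C) (l : C) : Prop :=
  is_lim_seq (fun n => Cmod (u n - l)) 0.

Lemma Cmod_minus_sym (x y : C) : Cmod (x - y) = Cmod (y - x).
Proof. rewrite <- Cmod_opp. f_equal. ring. Qed.

Lemma Cmod_triangle3 (x y z : C) : (Cmod (x - z) <= Cmod (x - y) + Cmod (y - z))%R.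
Proof. replace (x - z) with ((x - y) + (y - z)) by ring. apply Cmod_triangle. Qed.

Lemma Cmod_minus_le (x y : C) : (Cmod (x - y) <= Cmod x + Cmod y)%R.
Proof. unfold Cminus. rewrite <- (Cmod_opp y). apply Cmod_triangle. Qed.

Lemma Cmod_le_add (x y : C) : (Cmod x <= Cmod y + Cmod (x - y))%R.
Proof. replace x with (y + (x - y)) at 1 by ring. apply Cmod_triangle. Qed.

Lemma lim0_le (u v : nat -> R) :
  (forall n, 0 <= u n <= v n)%R -> is_lim_seq v 0 -> is_lim_seq u 0.
Proof.
  intros H Hv. apply (is_lim_seq_le_le (fun _ => 0%R) u v); auto. apply is_lim_seq_const.
Qed.

Lemma lim0_le_loc (u v : nat -> R) :
  eventually (fun n => 0 <= u n <= v n)%R -> is_lim_seq v 0 -> is_lim_seq u 0.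
Proof.
  intros H Hv. apply (is_lim_seq_le_le_loc (fun _ => 0%R) u v); auto. apply is_lim_seq_const.
Qed.

Lemma lim0_eps (u : nat -> R) : is_lim_seq u 0 ->
  forall eps, (0 < eps)%R -> eventually (fun n => Rabs (u n) < eps)%R.
Proof.
  intros H eps He. apply is_lim_seq_spec in H. destruct (H (mkposreal eps He)) as [N HN].
  exists N. intros n Hn. specialize (HN n Hn). simpl in HN. rewrite Rminus_0_r in HN. exact HN.
Qed.

Lemma Ccvg_eps (u : nat -> C) (l : C) : Ccvg u l ->
  forall eps, (0 < eps)%R -> eventually (fun n => Cmod (u n - l) < eps)%R.
Proof.
  intros H eps He. destruct (lim0_eps _ H eps He) as [N HN]. exists N. intros n Hn.
  specialize (HN n Hn). rewrite Rabs_pos_eq in HN; auto. apply Cmod_ge_0.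
Qed.

Lemma Ccvg_intro (u : nat -> C) (l : C) :
  (forall eps, (0 < eps)%R -> eventually (fun n => Cmod (u n - l) < eps)%R) -> Ccvg u l.
Proof.
  intros H. apply is_lim_seq_spec. intros eps. destruct (H eps (cond_pos eps)) as [N HN].
  exists N. intros n Hn. rewrite Rminus_0_r, Rabs_pos_eq; auto. apply Cmod_ge_0.
Qed.

Lemma Ccvg_const (l : C) : Ccvg (fun _ => l) l.
Proof.
  apply is_lim_seq_ext with (fun _ => 0%R); [|apply is_lim_seq_const].
  intros _. replace (l - l) with (RtoC 0) by ring. now rewrite Cmod_0.
Qed.

Lemma Ccvg_ext_loc (u v : nat -> C) (l : C) :
  eventually (fun n => u n = v n) -> Ccvg u l -> Ccvg v l.
Proof.
  intros [N H]. apply is_lim_seq_ext_loc. exists N. intros n Hn. now rewrite H.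
Qed.

Lemma Ccvg_ext (u v : nat -> C) (l : C) : (forall n, u n = v n) -> Ccvg u l -> Ccvg v l.
Proof. intros H. apply Ccvg_ext_loc. exists O. auto. Qed.

Lemma Ccvg_eq (u : nat -> C) (l l' : C) : l = l' -> Ccvg u l -> Ccvg u l'.
Proof. now intros ->. Qed.

Lemma Ccvg_plus (u v : nat -> C) (l m : C) :
  Ccvg u l -> Ccvg v m -> Ccvg (fun n => u n + v n) (l + m).
Proof.
  intros Hu Hv. apply lim0_le with (fun n => Cmod (u n - l) + Cmod (v n - m))%R.
  - intros n. split; [apply Cmod_ge_0|].
    replace (u n + v n - (l + m)) with ((u n - l) + (v n - m)) by ring. apply Cmod_triangle.
  - replace 0%R with (0 + 0)%R by ring. now apply is_lim_seq_plus'.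
Qed.

Lemma Ccvg_mult (u v : nat -> C) (l m : C) :
  Ccvg u l -> Ccvg v m -> Ccvg (fun n => u n * v n) (l * m).
Proof.
  intros Hu Hv. unfold Ccvg.
  apply lim0_le with
    (fun n => Cmod (u n - l) * Cmod (v n - m) + (Cmod l * Cmod (v n - m) + Cmod m * Cmod (u n - l)))%R.
  - intros n. split; [apply Cmod_ge_0|].
    replace (u n * v n - l * m) with
      ((u n - l) * (v n - m) + (l * (v n - m) + m * (u n - l))) by ring.
    rewrite <- !Cmod_mult. eapply Rle_trans; [apply Cmod_triangle|].
    apply Rplus_le_compat_l. apply Cmod_triangle.
  - replace 0%R with (0 * 0 + (Cmod l * 0 + Cmod m * 0))%R by ring.
    apply is_lim_seq_plus'; [now apply is_lim_seq_mult'|].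
    apply is_lim_seq_plus'; (apply is_lim_seq_mult'; [apply is_lim_seq_const|]); assumption.
Qed.

Lemma Ccvg_opp (u : nat -> C) (l : C) : Ccvg u l -> Ccvg (fun n => - u n) (- l).
Proof.
  intros Hu. apply Ccvg_ext with (fun n => (-1) * u n); [intros; ring|].
  apply Ccvg_eq with ((-1) * l); [ring|]. apply Ccvg_mult; auto. apply Ccvg_const.
Qed.

Lemma Ccvg_minus (u v : nat -> C) (l m : C) :
  Ccvg u l -> Ccvg v m -> Ccvg (fun n => u n - v n) (l - m).
Proof. intros. apply Ccvg_plus; auto. now apply Ccvg_opp. Qed.

Lemma Ccvg_away0 (u : nat -> C) (l : C) : Ccvg u l -> l <> 0 ->
  eventually (fun n => Cmod l / 2 <= Cmod (u n))%R.
Proof.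
  intros Hu Hl. assert (Hp : (0 < Cmod l / 2)%R) by (apply Cmod_gt_0 in Hl; lra).
  destruct (Ccvg_eps _ _ Hu _ Hp) as [N HN]. exists N. intros n Hn. specialize (HN n Hn).
  rewrite Cmod_minus_sym in HN. pose proof (Cmod_le_add l (u n)). lra.
Qed.

Lemma Ccvg_inv (u : nat -> C) (l : C) : Ccvg u l -> l <> 0 -> Ccvg (fun n => / u n) (/ l).
Proof.
  intros Hu Hl. assert (Hp : (0 < Cmod l)%R) by now apply Cmod_gt_0.
  apply lim0_le_loc with (fun n => 2 / (Cmod l * Cmod l) * Cmod (u n - l))%R.
  - destruct (Ccvg_away0 _ _ Hu Hl) as [N HN]. exists N. intros n Hn. specialize (HN n Hn).
    assert (Hun : u n <> 0). { intro E. rewrite E, Cmod_0 in HN. lra. }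
    split; [apply Cmod_ge_0|].
    replace (/ u n - / l) with ((l - u n) / (u n * l)) by (field; auto).
    rewrite Cmod_div by (now apply Cmult_neq_0). rewrite Cmod_minus_sym, Cmod_mult.
    unfold Rdiv. rewrite Rmult_comm. apply Rmult_le_compat_r; [apply Cmod_ge_0|].
    replace (2 * / (Cmod l * Cmod l))%R with (/ (Cmod l / 2 * Cmod l))%R by (field; lra).
    apply Rinv_le_contravar; [nra|]. nra.
  - replace 0%R with (2 / (Cmod l * Cmod l) * 0)%R by ring.
    apply is_lim_seq_mult'; [apply is_lim_seq_const|exact Hu].
Qed.

Lemma Ccvg_div (u v : nat -> C) (l m : C) :
  Ccvg u l -> Ccvg v m -> m <> 0 -> Ccvg (fun n => u n / v n) (l / m).
Proof. intros. apply Ccvg_mult; auto. now apply Ccvg_inv. Qed.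

Lemma Ccvg_unique (u : nat -> C) (l m : C) : Ccvg u l -> Ccvg u m -> l = m.
Proof.
  intros Hl Hm. assert (H : Ccvg (fun _ => RtoC 0) (l - m)).
  { apply Ccvg_ext with (fun n => u n - u n + 0); [intros; ring|].
    apply Ccvg_eq with ((l - m) + 0); [ring|]. apply Ccvg_plus; [|apply Ccvg_const].
    now apply Ccvg_minus. }
  assert (H0 : is_lim_seq (fun _ : nat => Cmod (0 - (l - m))) 0) by exact H.
  assert (E : Finite (Cmod (0 - (l - m))) = Finite 0).
  { rewrite <- (is_lim_seq_unique _ _ H0). symmetry. apply Lim_seq_const. }
  injection E as E. apply Cmod_eq_0 in E.
  replace l with (m - (0 - (l - m))) by ring. rewrite E. ring.
Qed.

Lemma Ccvg_subseq (u : nat -> C) (l : C) (phi : nat -> nat) :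
  filterlim phi eventually eventually -> Ccvg u l -> Ccvg (fun n => u (phi n)) l.
Proof. intros Hphi Hu. unfold Ccvg. exact (is_lim_seq_subseq _ _ phi Hphi Hu). Qed.

Lemma Ccvg_incr_n (u : nat -> C) (l : C) (k : nat) : Ccvg u l -> Ccvg (fun n => u (n + k)%nat) l.
Proof.
  intros H. apply (Ccvg_subseq u l (fun n => (n + k)%nat)); auto.
  intros P [N HN]. exists N. intros n Hn. apply HN. lia.
Qed.

Lemma Ccvg_decr_n (u : nat -> C) (l : C) (k : nat) : Ccvg (fun n => u (n + k)%nat) l -> Ccvg u l.
Proof. intros H. unfold Ccvg. exact (proj2 (is_lim_seq_incr_n (fun n => Cmod (u n - l)) k _) H). Qed.

Lemma Ccvg_RtoC (u : nat -> R) (l : R) : is_lim_seq u l -> Ccvg (fun n => RtoC (u n)) (RtoC l).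
Proof.
  intros H. apply is_lim_seq_ext with (fun n => Rabs (u n - l)).
  - intros n. now rewrite <- RtoC_minus, Cmod_R.
  - apply (proj1 (is_lim_seq_abs_0 _)). replace (Finite 0) with (Finite (l - l)%R) by (f_equal; ring).
    apply is_lim_seq_minus'; auto. apply is_lim_seq_const.
Qed.

Lemma Ccvg_Cmod (u : nat -> C) (l : C) : Ccvg u l -> is_lim_seq (fun n => Cmod (u n)) (Cmod l).
Proof.
  intros H. apply (is_lim_seq_le_le (fun n => Cmod l - Cmod (u n - l))%R _
                                   (fun n => Cmod l + Cmod (u n - l))%R).
  - intros n. pose proof (Cmod_le_add (u n) l). pose proof (Cmod_le_add l (u n)).
    rewrite (Cmod_minus_sym l) in H1. lra.
  - replace (Finite (Cmod l)) with (Finite (Cmod l - 0)%R) by (f_equal; ring).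
    apply is_lim_seq_minus'; auto. apply is_lim_seq_const.
  - replace (Finite (Cmod l)) with (Finite (Cmod l + 0)%R) by (f_equal; ring).
    apply is_lim_seq_plus'; auto. apply is_lim_seq_const.
Qed.

Lemma Ccvg_Re (u : nat -> C) (l : C) : Ccvg u l -> is_lim_seq (fun n => Re (u n)) (Re l).
Proof.
  intros H. apply is_lim_seq_spec. intros eps.
  destruct (Ccvg_eps _ _ H eps (cond_pos eps)) as [N HN]. exists N. intros n Hn.
  eapply Rle_lt_trans; [|apply (HN n Hn)]. apply (re_le_Cmod (u n - l)).
Qed.

Lemma im_le_Cmod (z : C) : (Rabs (Im z) <= Cmod z)%R.
Proof. eapply Rle_trans; [apply Rmax_r|apply Rmax_Cmod]. Qed.

Lemma Cmod_le_ReIm (z : C) : (Cmod z <= Rabs (Re z) + Rabs (Im z))%R.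
Proof.
  assert (E : z = RtoC (Re z) + Ci * RtoC (Im z)).
  { destruct z as [x y]. apply injective_projections; unfold Re, Im; simpl; ring. }
  rewrite E at 1.
  eapply Rle_trans; [apply Cmod_triangle|]. rewrite Cmod_mult, !Cmod_R, Cmod_Ci. lra.
Qed.

Lemma Ccvg_Im (u : nat -> C) (l : C) : Ccvg u l -> is_lim_seq (fun n => Im (u n)) (Im l).
Proof.
  intros H. apply is_lim_seq_spec. intros eps.
  destruct (Ccvg_eps _ _ H eps (cond_pos eps)) as [N HN]. exists N. intros n Hn.
  eapply Rle_lt_trans; [|apply (HN n Hn)]. apply (im_le_Cmod (u n - l)).
Qed.

Lemma Ccvg_ReIm (u : nat -> C) (a b : R) :
  is_lim_seq (fun n => Re (u n)) a -> is_lim_seq (fun n => Im (u n)) b -> Ccvg u (a, b).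
Proof.
  intros Ha Hb. apply lim0_le with (fun n => Rabs (Re (u n) - a) + Rabs (Im (u n) - b))%R.
  - intros n. split; [apply Cmod_ge_0|]. apply (Cmod_le_ReIm (u n - (a, b))).
  - replace 0%R with (Rabs (a - a) + Rabs (b - b))%R by (rewrite !Rminus_diag, Rabs_R0; ring).
    apply is_lim_seq_plus'.
    + apply (is_lim_seq_abs _ (a - a)%R). apply is_lim_seq_minus'; auto. apply is_lim_seq_const.
    + apply (is_lim_seq_abs _ (b - b)%R). apply is_lim_seq_minus'; auto. apply is_lim_seq_const.
Qed.

Lemma Ccvg_Clim (u : nat -> C) (l : C) : Ccvg u l -> Clim u = l.
Proof.
  intros H. unfold Clim.
  rewrite (is_lim_seq_unique _ _ (Ccvg_Re _ _ H)), (is_lim_seq_unique _ _ (Ccvg_Im _ _ H)).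
  destruct l; reflexivity.
Qed.

Lemma Ccvg_bounded (u : nat -> C) (l : C) : Ccvg u l -> exists K, (0 < K)%R /\ forall n, (Cmod (u n) <= K)%R.
Proof.
  intros H. pose proof (Ccvg_Cmod _ _ H) as Hm.
  destruct (proj1 (is_lim_seq_Reals _ _) Hm 1%R ltac:(lra)) as [N HN].
  assert (Hfin : forall n, exists K, (0 < K)%R /\ forall k, (k < n)%nat -> (Cmod (u k) <= K)%R).
  { induction n as [|n [K [HK IH]]].
    - exists 1%R. split; [lra|lia].
    - exists (Rmax K (Cmod (u n))). split; [eapply Rlt_le_trans; [exact HK|apply Rmax_l]|].
      intros k Hk. destruct (Nat.eq_dec k n) as [->|Hne]; [apply Rmax_r|].
      eapply Rle_trans; [apply IH; lia|apply Rmax_l]. }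
  destruct (Hfin N) as [K [HK IH]]. exists (Rmax K (Cmod l + 1)).
  split; [eapply Rlt_le_trans; [exact HK|apply Rmax_l]|].
  intros n. destruct (Nat.lt_ge_cases n N) as [Hn|Hn].
  - eapply Rle_trans; [apply IH; lia|apply Rmax_l].
  - eapply Rle_trans; [|apply Rmax_r]. specialize (HN n Hn). unfold R_dist in HN.
    apply Rabs_def2 in HN. lra.
Qed.

(** The reciprocals converge as well, hence are bounded; the nonvanishing of every single term takes
    care of the early indices. *)
Lemma Ccvg_bounded_below (u : nat -> C) (l : C) : Ccvg u l -> l <> 0 -> (forall n, u n <> 0) ->
  exists K, (0 < K)%R /\ forall n, (/ K <= Cmod (u n))%R.
Proof.
  intros H Hl Hn. destruct (Ccvg_bounded _ _ (Ccvg_inv _ _ H Hl)) as [K [HK HB]].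
  exists K. split; auto. intros n. specialize (HB n). specialize (Hn n).
  rewrite Cmod_inv in HB by auto. apply Cmod_gt_0 in Hn.
  rewrite <- (Rinv_inv (Cmod (u n))). apply Rinv_le_contravar; auto. now apply Rinv_0_lt_compat.
Qed.

(** * Finite sums and products, absolute convergence, Tannery's theorem *)

Lemma csum_ext (n : nat) (f g : nat -> C) :
  (forall k, (k < n)%nat -> f k = g k) -> csum n f = csum n g.
Proof. induction n as [|n IH]; intros H; simpl; auto. rewrite IH, H; auto. Qed.

Lemma csum_plus (n : nat) (f g : nat -> C) : csum n (fun k => f k + g k) = csum n f + csum n g.
Proof. induction n as [|n IH]; simpl; [ring|]. rewrite IH. ring. Qed.

Lemma csum_scal (n : nat) (a : C) (f : nat -> C) : csum n (fun k => a * f k) = a * csum n f.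
Proof. induction n as [|n IH]; simpl; [ring|]. rewrite IH. ring. Qed.

Lemma csum_S_l (n : nat) (f : nat -> C) : csum (S n) f = f O + csum n (fun k => f (S k)).
Proof. induction n as [|n IH]; [simpl; ring|]. change (csum (S (S n)) f) with (csum (S n) f + f (S n)). rewrite IH. simpl. ring. Qed.

Lemma csum_app (n k : nat) (f : nat -> C) :
  csum (n + k) f = csum n f + csum k (fun j => f (n + j)%nat).
Proof.
  induction k as [|k IH]; [rewrite Nat.add_0_r; simpl; ring|].
  rewrite Nat.add_succ_r. simpl. rewrite IH. ring.
Qed.

Lemma csum_rev (n : nat) (f : nat -> C) : csum n f = csum n (fun k => f (n - 1 - k)%nat).
Proof.
  revert f. induction n as [|n IH]; intros f; [reflexivity|].
  rewrite csum_S_l. change (csum (S n) (fun k => f (S n - 1 - k)%nat)) with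
    (csum n (fun k => f (S n - 1 - k)%nat) + f (S n - 1 - n)%nat).
  rewrite (IH (fun k => f (S k))). replace (S n - 1 - n)%nat with O by lia. rewrite Cplus_comm.
  f_equal. apply csum_ext. intros k Hk. f_equal. lia.
Qed.

Lemma cprod_ext (n : nat) (f g : nat -> C) :
  (forall k, (k < n)%nat -> f k = g k) -> cprod n f = cprod n g.
Proof. induction n as [|n IH]; intros H; simpl; auto. rewrite IH, H; auto. Qed.

Lemma cprod_mult (n : nat) (f g : nat -> C) : cprod n (fun k => f k * g k) = cprod n f * cprod n g.
Proof. induction n as [|n IH]; simpl; [ring|]. rewrite IH. ring. Qed.

Lemma cprod_S_l (n : nat) (f : nat -> C) : cprod (S n) f = f O * cprod n (fun k => f (S k)).
Proof. induction n as [|n IH]; [simpl; ring|]. change (cprod (S (S n)) f) with (cprod (S n) f * f (S n)). rewrite IH. simpl. ring. Qed.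

Lemma cprod_app (n k : nat) (f : nat -> C) :
  cprod (n + k) f = cprod n f * cprod k (fun j => f (n + j)%nat).
Proof.
  induction k as [|k IH]; [rewrite Nat.add_0_r; simpl; ring|].
  rewrite Nat.add_succ_r. simpl. rewrite IH. ring.
Qed.

Lemma cprod_rev (n : nat) (f : nat -> C) : cprod n f = cprod n (fun k => f (n - 1 - k)%nat).
Proof.
  revert f. induction n as [|n IH]; intros f; [reflexivity|].
  rewrite cprod_S_l. change (cprod (S n) (fun k => f (S n - 1 - k)%nat)) with
    (cprod n (fun k => f (S n - 1 - k)%nat) * f (S n - 1 - n)%nat).
  rewrite (IH (fun k => f (S k))). replace (S n - 1 - n)%nat with O by lia. rewrite Cmult_comm.
  f_equal. apply cprod_ext. intros k Hk. f_equal. lia.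
Qed.

Lemma cprod_neq_0 (n : nat) (f : nat -> C) :
  (forall k, (k < n)%nat -> f k <> 0) -> cprod n f <> 0.
Proof.
  induction n as [|n IH]; intros H; simpl; [apply C1_nz|]. apply Cmult_neq_0; auto.
Qed.

Lemma cprod_const (n : nat) (a : C) : cprod n (fun _ => a) = a ^ n.
Proof. induction n as [|n IH]; simpl; auto. rewrite IH. ring. Qed.

Lemma cprod_inv (n : nat) (f : nat -> C) : (forall k, (k < n)%nat -> f k <> 0) ->
  cprod n (fun k => / f k) = / cprod n f.
Proof.
  induction n as [|n IH]; intros H; simpl; [field; apply C1_nz|].
  rewrite IH by auto. field. split; [apply H; lia|]. apply cprod_neq_0. auto.
Qed.

Lemma Cmod_csum_le (n : nat) (f : nat -> C) (b : nat -> R) :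
  (forall k, (k < n)%nat -> (Cmod (f k) <= b k)%R) -> (Cmod (csum n f) <= rsum n b)%R.
Proof.
  induction n as [|n IH]; intros H; simpl; [rewrite Cmod_0; lra|].
  eapply Rle_trans; [apply Cmod_triangle|]. apply Rplus_le_compat; auto.
Qed.

Lemma csum_minus_le (n k : nat) (f : nat -> C) (b : nat -> R) : (n <= k)%nat ->
  (forall j, (j < k)%nat -> (Cmod (f j) <= b j)%R) ->
  (Cmod (csum k f - csum n f) <= rsum k b - rsum n b)%R.
Proof.
  intros Hnk. induction Hnk as [|k Hk IH]; intros H.
  - replace (csum n f - csum n f) with (RtoC 0) by ring. rewrite Cmod_0. lra.
  - simpl. replace (csum k f + f k - csum n f) with ((csum k f - csum n f) + f k) by ring.
    eapply Rle_trans; [apply Cmod_triangle|].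
    assert (H1 := H k ltac:(lia)). assert (H2 := IH ltac:(intros; apply H; lia)). lra.
Qed.

Lemma rsum_mono (n k : nat) (b : nat -> R) : (n <= k)%nat -> (forall j, 0 <= b j)%R ->
  (rsum n b <= rsum k b)%R.
Proof.
  intros Hnk H. induction Hnk as [|k Hk IH]; [lra|]. simpl. specialize (H k). lra.
Qed.

Lemma rsum_scal (n : nat) (a : R) (f : nat -> R) : (rsum n (fun k => a * f k) = a * rsum n f)%R.
Proof. induction n as [|n IH]; simpl; [ring|]. rewrite IH. ring. Qed.

Lemma rsum_cvg (b : nat -> R) (S : R) : (forall j, 0 <= b j)%R -> (forall n, rsum n b <= S)%R ->
  exists T : R, is_lim_seq (fun n => rsum n b) T /\ forall n, (rsum n b <= T)%R.
Proof.
  intros Hp HS. destruct (ex_finite_lim_seq_incr (fun n => rsum n b) S) as [T HT]; auto.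
  - intros n. simpl. specialize (Hp n). lra.
  - exists T. split; auto. intros n. apply (is_lim_seq_incr_compare (fun n => rsum n b)); auto.
    intros k. simpl. specialize (Hp k). lra.
Qed.

Lemma rsum_tail (b : nat -> R) (S : R) : (forall j, 0 <= b j)%R -> (forall n, rsum n b <= S)%R ->
  forall eps, (0 < eps)%R -> exists N, forall n, (N <= n)%nat -> (rsum n b - rsum N b < eps)%R.
Proof.
  intros Hp HS eps He. destruct (rsum_cvg b S Hp HS) as [T [HT HT']].
  destruct (proj1 (is_lim_seq_Reals _ _) HT eps He) as [N HN]. exists N. intros n Hn.
  specialize (HN N (le_n _)). unfold R_dist in HN. apply Rabs_def2 in HN. specialize (HT' n). lra.
Qed.

Lemma Ccvg_cauchy (u : nat -> C) :
  (forall eps, (0 < eps)%R -> exists N, forall n, (N <= n)%nat -> (Cmod (u n - u N) < eps)%R) ->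
  exists l, Ccvg u l.
Proof.
  intros H.
  (* Every 1-Lipschitz projection gives a real Cauchy sequence; this is applied to [Re] and [Im]. *)
  assert (Hc : forall pr : C -> R, (forall x y, Rabs (pr x - pr y) <= Cmod (x - y))%R ->
            ex_finite_lim_seq (fun n => pr (u n))).
  { intros pr Hpr. apply ex_lim_seq_cauchy_corr. intros eps.
    destruct (H (eps / 2)%R) as [N HN]; [destruct eps; simpl; lra|].
    exists N. intros n k Hn Hk. eapply Rle_lt_trans; [apply Hpr|].
    eapply Rle_lt_trans; [apply (Cmod_triangle3 _ (u N))|].
    rewrite (Cmod_minus_sym (u N)). pose proof (HN n Hn). pose proof (HN k Hk). lra. }
  destruct (Hc Re) as [a Ha]; [intros; apply (re_le_Cmod (x - y))|].
  destruct (Hc Im) as [b Hb]; [intros; apply (im_le_Cmod (x - y))|].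
  exists (a, b). now apply Ccvg_ReIm.
Qed.

Lemma csum_cvg (f : nat -> C) (b : nat -> R) (S : R) :
  (forall k, Cmod (f k) <= b k)%R -> (forall n, rsum n b <= S)%R ->
  exists l, Ccvg (fun n => csum n f) l.
Proof.
  intros Hf HS.
  assert (Hp : forall j, (0 <= b j)%R) by (intros j; eapply Rle_trans; [apply Cmod_ge_0|apply Hf]).
  apply Ccvg_cauchy. intros eps He. destruct (rsum_tail b S Hp HS eps He) as [N HN].
  exists N. intros n Hn. eapply Rle_lt_trans; [apply csum_minus_le with (b := b); auto|auto].
Qed.

Lemma Ccvg_csum (n : nat) (u : nat -> nat -> C) (l : nat -> C) :
  (forall k, (k < n)%nat -> Ccvg (fun t => u t k) (l k)) -> Ccvg (fun t => csum n (u t)) (csum n l).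
Proof.
  induction n as [|n IH]; intros H; simpl; [apply Ccvg_const|]. apply Ccvg_plus; auto.
Qed.

Lemma Ccvg_cprod (n : nat) (u : nat -> nat -> C) (l : nat -> C) :
  (forall k, (k < n)%nat -> Ccvg (fun t => u t k) (l k)) -> Ccvg (fun t => cprod n (u t)) (cprod n l).
Proof.
  induction n as [|n IH]; intros H; simpl; [apply Ccvg_const|]. apply Ccvg_mult; auto.
Qed.

Lemma Ccvg_Cmod_le (u : nat -> C) (l : C) (B : R) : Ccvg u l -> eventually (fun n => Cmod (u n) <= B)%R ->
  (Cmod l <= B)%R.
Proof.
  intros H HB. pose proof (Ccvg_Cmod _ _ H) as Hm.
  exact (is_lim_seq_le_loc _ (fun _ => B) _ _ HB Hm (is_lim_seq_const B)).
Qed.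

(** The bound passes to the limits, so both tails beyond a fixed index are small uniformly in [t],
    while the finitely many terms below it converge. The cut-off [M t] is built in because the
    approximating rows are finite and the bound holds only inside them; summability of [B] is
    expressed by bounded partial sums. *)
Lemma tannery (a : nat -> nat -> C) (b : nat -> C) (B : nat -> R) (M : nat -> nat) (S : R) :
  (forall t r, (r < M t)%nat -> (Cmod (a t r) <= B r)%R) ->
  (forall r, Ccvg (fun t => a t r) (b r)) ->
  (forall r, eventually (fun t => (r < M t)%nat)) ->
  (forall n, (rsum n B <= S)%R) ->
  exists L, Ccvg (fun n => csum n b) L /\ Ccvg (fun t => csum (M t) (a t)) L.
Proof.
  intros Ha Hb HM HS.
  assert (HbB : forall r, (Cmod (b r) <= B r)%R).
  { intros r. apply (Ccvg_Cmod_le _ _ _ (Hb r)). destruct (HM r) as [N HN]. exists N.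
    intros n Hn. auto. }
  assert (Hp : forall j, (0 <= B j)%R) by (intros j; eapply Rle_trans; [apply Cmod_ge_0|apply HbB]).
  destruct (csum_cvg b B S HbB HS) as [L HL]. exists L. split; auto.
  apply Ccvg_intro. intros eps He.
  destruct (rsum_tail B S Hp HS (eps / 4)%R ltac:(lra)) as [N HN].
  assert (HLN : (Cmod (L - csum N b) <= eps / 4)%R).
  { apply (Ccvg_Cmod_le (fun n => csum n b - csum N b)).
    - apply Ccvg_minus; auto. apply Ccvg_const.
    - exists N. intros n Hn. eapply Rle_trans; [apply csum_minus_le with (b := B); auto|].
      left. auto. }
  destruct (Ccvg_eps _ _ (Ccvg_csum N a b (fun k _ => Hb k)) (eps / 4)%R ltac:(lra)) as [T1 HT1].
  destruct (HM N) as [T2 HT2]. exists (T1 + T2)%nat. intros t Ht.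
  specialize (HT1 t ltac:(lia)). specialize (HT2 t ltac:(lia)).
  assert (H1 : (Cmod (csum (M t) (a t) - csum N (a t)) <= eps / 4)%R).
  { eapply Rle_trans; [apply csum_minus_le with (b := B); [lia|auto]|]. left. apply HN. lia. }
  pose proof (Cmod_triangle3 (csum (M t) (a t)) (csum N (a t)) L).
  pose proof (Cmod_triangle3 (csum N (a t)) (csum N b) L).
  rewrite (Cmod_minus_sym (csum N b) L) in H0. lra.
Qed.

(* From [y^(-e) - (y+1)^(-e) >= e (y+1)^(-1-e)] by telescoping. *)
Lemma rsum_Rpower_bounded (b : R) : (1 < b)%R ->
  exists S, forall n, (rsum n (fun k => Rpower (INR k + 1) (- b)) <= S)%R.
Proof.
  intros Hb. set (e := (b - 1)%R).
  assert (Hstep : forall k, (Rpower (INR k + 2) (- b) <=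
            / e * (Rpower (INR k + 1) (- e) - Rpower (INR k + 2) (- e)))%R).
  { intros k. pose proof (pos_INR k) as Hk. set (y := (INR k + 2)%R).
    replace (Rpower y (- b)) with (Rpower y (- e) * / y)%R.
    2:{ replace (- b)%R with (- e + - (1))%R by (unfold e; ring).
        rewrite Rpower_plus, (Rpower_Ropp y 1), Rpower_1; [reflexivity|unfold y; lra]. }
    assert (H1 : (Rpower y (- e) * (1 + e * / y) <= Rpower (INR k + 1) (- e))%R).
    { replace (INR k + 1)%R with (y * (1 - / y))%R by (unfold y; field; lra).
      assert (Hy : (0 < 1 - / y)%R).
      { assert (/ y <= / 2)%R; [apply Rinv_le_contravar; unfold y; lra|lra]. }
      rewrite <- Rpower_mult_distr by (unfold y in *; lra).
      (* Bernoulli's inequality for a negative exponent, from ln(1 - 1/y) <= -1/y and exp t >= 1 +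
         t. *)
      assert (Hq : (1 + e * / y <= Rpower (1 - / y) (- e))%R).
      { unfold Rpower. eapply Rle_trans; [apply exp_ineq1_le|].
        destruct (Req_dec (- e * ln (1 - / y)) (e * / y)) as [->|Hne]; [lra|].
        left. apply exp_increasing.
        assert (Hl : (ln (1 - / y) <= - / y)%R).
        { rewrite <- (ln_exp (- / y)). destruct (Req_dec (1 - / y) (exp (- / y))) as [->|Hn]; [lra|].
          left. apply ln_increasing; auto. pose proof (exp_ineq1_le (- / y)). lra. }
        assert (0 < e)%R by (unfold e; lra). nra. }
      apply Rmult_le_compat_l; auto. left. apply exp_pos. }
    apply Rmult_le_reg_l with e; [unfold e; lra|].
    replace (e * (/ e * (Rpower (INR k + 1) (- e) - Rpower y (- e))))%R
      with (Rpower (INR k + 1) (- e) - Rpower y (- e))%R by (field; unfold e; lra).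
    lra. }
  exists (1 + / e)%R. intros n.
  assert (H : forall n, (rsum (S n) (fun k => Rpower (INR k + 1) (- b)) <=
                1 + / e * (1 - Rpower (INR n + 1) (- e)))%R).
  { clear n. induction n as [|n IH].
    - simpl. rewrite !Rplus_0_l. rewrite !Rpower_Ropp.
      unfold Rpower. rewrite ln_1, !Rmult_0_r, exp_0. lra.
    - change (rsum (S (S n)) (fun k => Rpower (INR k + 1) (- b)))%R with
        (rsum (S n) (fun k => Rpower (INR k + 1) (- b)) + Rpower (INR (S n) + 1) (- b))%R.
      specialize (Hstep n). rewrite S_INR. replace (INR n + 1 + 1)%R with (INR n + 2)%R by ring. lra. }
  assert (He : (0 < / e)%R) by (apply Rinv_0_lt_compat; unfold e; lra).
  destruct n as [|n].
  - simpl. lra.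
  - eapply Rle_trans; [apply H|]. assert (0 < Rpower (INR n + 1) (- e))%R by apply exp_pos. nra.
Qed.

(** * Second-order expansions *)

(* [f h = v + a h + O(h^2)] as [h -> 0]; the value at [h = 0] plays no role, so that [f] may be
   [h^2 R (p + h)] for a function [R] with a pole at [p]. *)
Definition jet (f : C -> C) (v a : C) : Prop :=
  exists M d, (0 <= M)%R /\ (0 < d <= 1)%R /\
    forall h : C, h <> 0 -> (Cmod h < d)%R -> (Cmod (f h - v - a * h) <= M * (Cmod h * Cmod h))%R.

Lemma jet_ext (f g : C -> C) (v a : C) :
  (exists d, (0 < d)%R /\ forall h : C, h <> 0 -> (Cmod h < d)%R -> f h = g h) -> jet f v a -> jet g v a.
Proof.
  intros [d' [Hd' E]] [M [d [HM [Hd H]]]]. exists M, (Rmin d d'). split; auto. split.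
  - split; [apply Rmin_glb_lt; tauto|]. eapply Rle_trans; [apply Rmin_l|tauto].
  - intros h Hh Hlt. pose proof (Rmin_l d d'). pose proof (Rmin_r d d').
    rewrite <- E by (auto; lra). apply H; auto; lra.
Qed.

Lemma jet_eq (f : C -> C) (v a v' a' : C) : v = v' -> a = a' -> jet f v a -> jet f v' a'.
Proof. now intros -> ->. Qed.

Lemma jet_const (v : C) : jet (fun _ => v) v 0.
Proof.
  exists 0%R, 1%R. repeat split; try lra. intros h _ _.
  replace (v - v - 0 * h) with (RtoC 0) by ring. rewrite Cmod_0. lra.
Qed.

Lemma jet_id : jet (fun h => h) 0 1.
Proof.
  exists 0%R, 1%R. repeat split; try lra. intros h _ _.
  replace (h - 0 - 1 * h) with (RtoC 0) by ring. rewrite Cmod_0. lra.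
Qed.

Lemma jet_plus (f g : C -> C) (v a w b : C) :
  jet f v a -> jet g w b -> jet (fun h => f h + g h) (v + w) (a + b).
Proof.
  intros [M [d [HM [Hd H]]]] [M' [d' [HM' [Hd' H']]]].
  exists (M + M')%R, (Rmin d d'). split; [lra|]. split.
  - split; [apply Rmin_glb_lt; tauto|]. eapply Rle_trans; [apply Rmin_l|tauto].
  - intros h Hh Hlt. pose proof (Rmin_l d d'). pose proof (Rmin_r d d').
    specialize (H h Hh ltac:(lra)). specialize (H' h Hh ltac:(lra)).
    replace (f h + g h - (v + w) - (a + b) * h) with
      ((f h - v - a * h) + (g h - w - b * h)) by ring.
    eapply Rle_trans; [apply Cmod_triangle|]. lra.
Qed.

Lemma jet_mult (f g : C -> C) (v a w b : C) :
  jet f v a -> jet g w b -> jet (fun h => f h * g h) (v * w) (v * b + a * w).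
Proof.
  intros [M [d [HM [Hd H]]]] [M' [d' [HM' [Hd' H']]]].
  exists (Cmod a * Cmod b + (Cmod v + Cmod a) * M' + (Cmod w + Cmod b) * M + M * M')%R, (Rmin d d').
  pose proof (Cmod_ge_0 a). pose proof (Cmod_ge_0 b). pose proof (Cmod_ge_0 v). pose proof (Cmod_ge_0 w).
  split.
  { repeat apply Rplus_le_le_0_compat; apply Rmult_le_pos; lra. }
  split.
  - split; [apply Rmin_glb_lt; tauto|]. eapply Rle_trans; [apply Rmin_l|tauto].
  - intros h Hh Hlt. pose proof (Rmin_l d d'). pose proof (Rmin_r d d').
    specialize (H h Hh ltac:(lra)). specialize (H' h Hh ltac:(lra)).
    set (r := f h - v - a * h) in *. set (s := g h - w - b * h) in *.
    (* The four terms of this exact remainder match the four summands of the constant; [d <= 1]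
       bounds [v + a h] and [w + b h]. *)
    replace (f h * g h - v * w - (v * b + a * w) * h) with
      (a * b * (h * h) + (v + a * h) * s + (w + b * h) * r + r * s) by (unfold r, s; ring).
    pose proof (Cmod_ge_0 h) as Hh0. set (t := Cmod h) in *. assert (Ht : (t <= 1)%R) by lra.
    assert (Hva : (Cmod (v + a * h) <= Cmod v + Cmod a)%R).
    { eapply Rle_trans; [apply Cmod_triangle|]. rewrite Cmod_mult. fold t. nra. }
    assert (Hwb : (Cmod (w + b * h) <= Cmod w + Cmod b)%R).
    { eapply Rle_trans; [apply Cmod_triangle|]. rewrite Cmod_mult. fold t. nra. }
    eapply Rle_trans; [apply Cmod_triangle|]. rewrite !Rmult_plus_distr_r.
    apply Rplus_le_compat.
    + eapply Rle_trans; [apply Cmod_triangle|]. apply Rplus_le_compat.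
      * eapply Rle_trans; [apply Cmod_triangle|]. apply Rplus_le_compat.
        { rewrite !Cmod_mult. fold t. lra. }
        { rewrite Cmod_mult. apply Rle_trans with ((Cmod v + Cmod a) * (M' * (t * t)))%R;
            [|apply Req_le; ring]. apply Rmult_le_compat; auto; apply Cmod_ge_0. }
      * rewrite Cmod_mult. apply Rle_trans with ((Cmod w + Cmod b) * (M * (t * t)))%R;
          [|apply Req_le; ring]. apply Rmult_le_compat; auto; apply Cmod_ge_0.
    + rewrite Cmod_mult. pose proof (Cmod_ge_0 r). pose proof (Cmod_ge_0 s).
      apply Rle_trans with ((M * (t * t)) * (M' * (t * t)))%R.
      * apply Rmult_le_compat; auto.
      * assert (0 <= M * M')%R by now apply Rmult_le_pos. assert (0 <= t * t <= 1)%R by nra.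
        replace (M * (t * t) * (M' * (t * t)))%R with (M * M' * ((t * t) * (t * t)))%R by ring.
        apply Rmult_le_compat_l; auto. nra.
Qed.

Lemma jet_scal (k : C) (f : C -> C) (v a : C) : jet f v a -> jet (fun h => k * f h) (k * v) (k * a).
Proof.
  intros H. apply jet_eq with (k * v) (k * a + 0 * v); [reflexivity|ring|].
  apply jet_mult; auto. apply jet_const.
Qed.

(** Needed for reciprocals, and later to know that [rGamma] does not vanish near a point where it is
    nonzero. *)
Lemma jet_near (f : C -> C) (v a : C) : jet f v a -> v <> 0 ->
  exists d, (0 < d)%R /\ forall h : C, h <> 0 -> (Cmod h < d)%R -> (Cmod v / 2 <= Cmod (f h))%R.
Proof.
  intros [M [d [HM [Hd H]]]] Hv. apply Cmod_gt_0 in Hv.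
  pose proof (Cmod_ge_0 a) as Ha0.
  (* For |h| <= 1 the deviation of [f h] from [v] is at most (|a| + M) |h|; the added 1 makes [K]
     positive. *)
  set (K := (Cmod a + M + 1)%R). assert (HK : (0 < K)%R) by (unfold K; lra).
  exists (Rmin d (Cmod v / 2 / K)). split.
  - apply Rmin_glb_lt; [tauto|]. apply Rdiv_lt_0_compat; lra.
  - intros h Hh Hlt. pose proof (Rmin_l d (Cmod v / 2 / K)). pose proof (Rmin_r d (Cmod v / 2 / K)).
    specialize (H h Hh ltac:(lra)). pose proof (Cmod_ge_0 h) as Hh0.
    assert (HKh : (K * Cmod h <= Cmod v / 2)%R).
    { apply Rmult_le_reg_l with (/ K)%R; [now apply Rinv_0_lt_compat|].
      replace (/ K * (K * Cmod h))%R with (Cmod h) by (field; lra).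
      replace (/ K * (Cmod v / 2))%R with (Cmod v / 2 / K)%R by (field; lra). lra. }
    pose proof (Cmod_le_add v (f h)). pose proof (Cmod_le_add (v - f h) (- (a * h))).
    replace (v - f h - - (a * h)) with (- (f h - v - a * h)) in H3 by ring.
    rewrite !Cmod_opp, Cmod_mult in H3.
    assert (Cmod h * Cmod h <= Cmod h)%R by nra. unfold K in HKh. nra.
Qed.

Lemma jet_inv (f : C -> C) (v a : C) : jet f v a -> v <> 0 ->
  jet (fun h => / f h) (/ v) (- (a / (v * v))).
Proof.
  intros Hf Hv. destruct (jet_near f v a Hf Hv) as [d' [Hd' Hn]].
  destruct Hf as [M [d [HM [Hd H]]]].
  assert (Hv0 : (0 < Cmod v)%R) by now apply Cmod_gt_0.
  pose proof (Cmod_ge_0 a) as Ha0.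
  set (K := (Cmod v * M + Cmod a * Cmod a + Cmod a * M)%R).
  assert (HK : (0 <= K)%R) by (unfold K; repeat apply Rplus_le_le_0_compat; apply Rmult_le_pos; lra).
  set (W := (Cmod v / 2 * (Cmod v * Cmod v))%R).
  assert (HW : (0 < W)%R) by (unfold W; repeat apply Rmult_lt_0_compat; lra).
  exists (K * / W)%R, (Rmin d d'). split.
  { apply Rmult_le_pos; auto. left. now apply Rinv_0_lt_compat. }
  split.
  - split; [apply Rmin_glb_lt; tauto|]. eapply Rle_trans; [apply Rmin_l|tauto].
  - intros h Hh Hlt. pose proof (Rmin_l d d'). pose proof (Rmin_r d d').
    specialize (H h Hh ltac:(lra)). specialize (Hn h Hh ltac:(lra)).
    assert (Hf0 : f h <> 0). { intro E. rewrite E, Cmod_0 in Hn. lra. }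
    set (r := f h - v - a * h) in *.
    (* Exact remainder of the reciprocal: the numerator is at most [K] |h|^2, the denominator at
       least [W] because |f h| >= |v|/2. *)
    replace (/ f h - / v - - (a / (v * v)) * h) with
      ((- (v * r) + a * a * (h * h) + a * h * r) * / (f h * (v * v)))
      by (unfold r; field; auto).
    pose proof (Cmod_ge_0 h) as Hh0. set (t := Cmod h) in *. assert (Ht : (t <= 1)%R) by lra.
    rewrite Cmod_mult, Cmod_inv by (repeat apply Cmult_neq_0; auto).
    replace (K * / W * (t * t))%R with ((K * (t * t)) * / W)%R by ring.
    apply Rmult_le_compat.
    + apply Cmod_ge_0.
    + left. apply Rinv_0_lt_compat. apply Cmod_gt_0. repeat apply Cmult_neq_0; auto.
    + unfold K. rewrite !Rmult_plus_distr_r. pose proof (Cmod_ge_0 r).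
      eapply Rle_trans; [apply Cmod_triangle|]. apply Rplus_le_compat.
      * eapply Rle_trans; [apply Cmod_triangle|]. rewrite Cmod_opp, !Cmod_mult. fold t.
        apply Rplus_le_compat; [|lra]. rewrite Rmult_assoc. apply Rmult_le_compat_l; lra.
      * rewrite !Cmod_mult. fold t. rewrite !Rmult_assoc. apply Rmult_le_compat_l; auto. nra.
    + apply Rinv_le_contravar; auto. rewrite !Cmod_mult. unfold W.
      apply Rmult_le_compat_r; auto. nra.
Qed.

Lemma le_0_of_le_small (e K d : R) : (0 < d)%R ->
  (forall t, 0 < t < d -> e <= K * t)%R -> (e <= 0)%R.
Proof.
  intros Hd H. apply Rnot_lt_le. intros He.
  pose proof (Rabs_pos K) as HK. pose proof (Rle_abs K) as HK'.
  set (t := Rmin (d / 2) (e / 2 / (Rabs K + 1))).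
  assert (Hq : (0 < e / 2 / (Rabs K + 1))%R) by (apply Rdiv_lt_0_compat; lra).
  assert (Ht : (0 < t)%R) by (apply Rmin_glb_lt; lra).
  pose proof (Rmin_l (d / 2) (e / 2 / (Rabs K + 1))). pose proof (Rmin_r (d / 2) (e / 2 / (Rabs K + 1))).
  fold t in H0, H1. specialize (H t ltac:(lra)).
  assert ((Rabs K + 1) * t <= e / 2)%R.
  { apply Rmult_le_reg_l with (/ (Rabs K + 1))%R; [apply Rinv_0_lt_compat; lra|].
    replace (/ (Rabs K + 1) * ((Rabs K + 1) * t))%R with t by (field; lra).
    replace (/ (Rabs K + 1) * (e / 2))%R with (e / 2 / (Rabs K + 1))%R by (field; lra). lra. }
  nra.
Qed.

(** This is how residues get identified: two expansions of one function are compared coefficient by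
    coefficient. Real positive [h] already separate the coefficients. *)
Lemma jet_unique (f : C -> C) (v a w b : C) : jet f v a -> jet f w b -> v = w /\ a = b.
Proof.
  intros [M [d [HM [Hd H]]]] [M' [d' [HM' [Hd' H']]]].
  assert (Hk : forall t, (0 < t < Rmin d d')%R ->
      (Cmod ((v - w) + (a - b) * RtoC t) <= (M + M') * (t * t))%R).
  { intros t Ht. pose proof (Rmin_l d d'). pose proof (Rmin_r d d').
    assert (Et : Cmod (RtoC t) = t) by (rewrite Cmod_R, Rabs_pos_eq; lra).
    assert (Ht0 : RtoC t <> 0). { intro E. rewrite E, Cmod_0 in Et. lra. }
    specialize (H t Ht0 ltac:(lra)). specialize (H' t Ht0 ltac:(lra)). rewrite Et in H, H'.
    replace ((v - w) + (a - b) * t) with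
      ((f t - w - b * t) - (f t - v - a * t)) by ring.
    eapply Rle_trans; [apply Cmod_minus_le|]. lra. }
  assert (Hdd : (0 < Rmin d d')%R) by (apply Rmin_glb_lt; tauto).
  assert (Hm : (Rmin d d' <= 1)%R) by (pose proof (Rmin_l d d'); lra).
  assert (Ev : v = w).
  { apply Ceq_minus. apply Cmod_eq_0. apply Rle_antisym; [|apply Cmod_ge_0].
    apply le_0_of_le_small with (Cmod (a - b) + M + M')%R (Rmin d d'); auto.
    intros t Ht. specialize (Hk t Ht).
    pose proof (Cmod_le_add (v - w) (v - w + (a - b) * t)).
    replace (v - w - (v - w + (a - b) * t)) with (- ((a - b) * t)) in H0 by ring.
    rewrite Cmod_opp, Cmod_mult, Cmod_R, (Rabs_pos_eq t) in H0 by lra.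
    assert (t * t <= t)%R by nra. nra. }
  split; auto. subst w.
  apply Ceq_minus. apply Cmod_eq_0. apply Rle_antisym; [|apply Cmod_ge_0].
  apply le_0_of_le_small with (M + M')%R (Rmin d d'); auto.
  intros t Ht. specialize (Hk t Ht).
  replace (v - v + (a - b) * t) with ((a - b) * t) in Hk by ring.
  rewrite Cmod_mult, Cmod_R, (Rabs_pos_eq t) in Hk by lra.
  apply Rmult_le_reg_r with t; lra.
Qed.

(** [l] is the logarithmic derivative f'/f at the point; with this parametrization products and
    quotients of many factors lead to plain sums. *)
Definition log_jet (f : C -> C) (v l : C) : Prop := jet f v (v * l).

Lemma log_jet_mult (f g : C -> C) (v l w m : C) :
  log_jet f v l -> log_jet g w m -> log_jet (fun h => f h * g h) (v * w) (l + m).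
Proof.
  intros Hf Hg. eapply jet_eq; [reflexivity| |exact (jet_mult _ _ _ _ _ _ Hf Hg)]. ring.
Qed.

Lemma log_jet_inv (f : C -> C) (v l : C) : log_jet f v l -> v <> 0 -> log_jet (fun h => / f h) (/ v) (- l).
Proof.
  intros Hf Hv. eapply jet_eq; [reflexivity| |exact (jet_inv _ _ _ Hf Hv)]. field. auto.
Qed.

Lemma log_jet_div (f g : C -> C) (v l w m : C) :
  log_jet f v l -> log_jet g w m -> w <> 0 -> log_jet (fun h => f h / g h) (v / w) (l - m).
Proof. intros. apply log_jet_mult; auto. now apply log_jet_inv. Qed.

Lemma log_jet_const (v : C) : log_jet (fun _ => v) v 0.
Proof. eapply jet_eq; [reflexivity| |apply jet_const]. ring. Qed.

Lemma log_jet_shift (y s : C) : y <> 0 -> log_jet (fun h => y + s * h) y (s / y).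
Proof.
  intros Hy. apply jet_eq with (y + s * 0) (0 + s * 1); [ring|field; auto|].
  apply jet_plus; [apply jet_const|]. apply jet_scal. apply jet_id.
Qed.

Lemma log_jet_cprod (n : nat) (f : nat -> C -> C) (v l : nat -> C) :
  (forall k, (k < n)%nat -> log_jet (f k) (v k) (l k)) ->
  log_jet (fun h => cprod n (fun k => f k h)) (cprod n v) (csum n l).
Proof.
  induction n as [|n IH]; intros H; simpl; [apply log_jet_const|]. apply log_jet_mult; auto.
Qed.

Lemma log_jet_lprod (l : list C) (f : C -> C -> C) (v m : C -> C) :
  (forall x, In x l -> log_jet (f x) (v x) (m x)) ->
  log_jet (fun h => lprod (fun x => f x h) l) (lprod v l) (lsum m l).
Proof.
  induction l as [|x l IH]; intros H; simpl; [apply log_jet_const|].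
  apply log_jet_mult; [apply H|apply IH; intros; apply H]; simpl; auto.
Qed.

(** At a simple pole only the value of the regular part enters the residue, so the slope is
    forgotten. *)
Definition jet_val (f : C -> C) (v : C) : Prop := exists a, jet f v a.

Lemma jet_val_mult (f g : C -> C) (v w : C) : jet_val f v -> jet_val g w -> jet_val (fun h => f h * g h) (v * w).
Proof. intros [a Ha] [b Hb]. eexists. apply jet_mult; eauto. Qed.

Lemma jet_val_inv (f : C -> C) (v : C) : jet_val f v -> v <> 0 -> jet_val (fun h => / f h) (/ v).
Proof. intros [a Ha] H. eexists. apply jet_inv; eauto. Qed.

Lemma jet_val_const (v : C) : jet_val (fun _ => v) v.
Proof. eexists. apply jet_const. Qed.

Lemma jet_val_shift (y s : C) : jet_val (fun h => y + s * h) y.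
Proof.
  exists s. apply jet_eq with (y + s * 0) (0 + s * 1); [ring|ring|].
  apply jet_plus; [apply jet_const|]. apply jet_scal. apply jet_id.
Qed.

Lemma jet_val_cprod (n : nat) (f : nat -> C -> C) (v : nat -> C) :
  (forall k, (k < n)%nat -> jet_val (f k) (v k)) -> jet_val (fun h => cprod n (fun k => f k h)) (cprod n v).
Proof.
  induction n as [|n IH]; intros H; simpl; [apply jet_val_const|]. apply jet_val_mult; auto.
Qed.

Lemma jet_val_lprod (l : list C) (f : C -> C -> C) (v : C -> C) :
  (forall x, In x l -> jet_val (f x) (v x)) -> jet_val (fun h => lprod (fun x => f x h) l) (lprod v l).
Proof.
  induction l as [|x l IH]; intros H; simpl; [apply jet_val_const|].
  apply jet_val_mult; [apply H|apply IH; intros; apply H]; simpl; auto.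
Qed.

Lemma lsum_cons (f : C -> C) (x : C) (l : list C) : lsum f (x :: l) = f x + lsum f l.
Proof. reflexivity. Qed.

Lemma lsum_app (f : C -> C) (l k : list C) : lsum f (l ++ k) = lsum f l + lsum f k.
Proof. unfold lsum. induction l as [|x l IH]; simpl; [ring|]. rewrite IH. ring. Qed.

Lemma lsum_ext (f g : C -> C) (l : list C) : (forall x, In x l -> f x = g x) -> lsum f l = lsum g l.
Proof. induction l as [|x l IH]; intros H; simpl; auto. rewrite H, IH; simpl; auto. intros; apply H; simpl; auto. Qed.

Lemma lsum_plus (f g : C -> C) (l : list C) : lsum (fun x => f x + g x) l = lsum f l + lsum g l.
Proof. induction l as [|x l IH]; simpl; [ring|]. rewrite IH. ring. Qed.

Lemma lsum_scal (a : C) (f : C -> C) (l : list C) : lsum (fun x => a * f x) l = a * lsum f l.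
Proof. induction l as [|x l IH]; simpl; [ring|]. rewrite IH. ring. Qed.

Lemma lprod_ext (f g : C -> C) (l : list C) : (forall x, In x l -> f x = g x) -> lprod f l = lprod g l.
Proof. induction l as [|x l IH]; intros H; simpl; auto. rewrite H, IH; simpl; auto. intros; apply H; simpl; auto. Qed.

Lemma lprod_mult (f g : C -> C) (l : list C) : lprod (fun x => f x * g x) l = lprod f l * lprod g l.
Proof. induction l as [|x l IH]; simpl; [ring|]. rewrite IH. ring. Qed.

Lemma lprod_neq_0 (f : C -> C) (l : list C) : (forall x, In x l -> f x <> 0) -> lprod f l <> 0.
Proof.
  induction l as [|x l IH]; intros H; simpl; [apply C1_nz|].
  apply Cmult_neq_0; [apply H|apply IH; intros; apply H]; simpl; auto.
Qed.

(** * Partial fractions *)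

(* [R = 1 + sum_p (B p / (s - p) + A p / (s - p)^2)]; [r] bounds the residue at infinity. *)
Definition pfrac (R : C -> C) (P : list C) (B : C -> C) (r : Rdefinitions.R) : Prop :=
  NoDup P /\ (Cmod (lsum B P) <= r)%R /\
  exists A : C -> C, forall s, ~ In s P ->
    R s = 1 + lsum (fun p => B p / (s - p) + A p / ((s - p) * (s - p))) P.

Lemma pfrac_nil : pfrac (fun _ => 1) [] (fun _ => 0) 0.
Proof.
  split; [constructor|]. split; [simpl; rewrite Cmod_0; lra|].
  exists (fun _ => 0). intros. simpl. ring.
Qed.

Lemma pfrac_ext (R R' : C -> C) (P : list C) (B : C -> C) (r : Rdefinitions.R) :
  (forall s, ~ In s P -> R s = R' s) -> pfrac R P B r -> pfrac R' P B r.
Proof.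
  intros E [Hnd [Hr [A H]]]. split; auto. split; auto. exists A. intros s Hs. rewrite <- E; auto.
Qed.

(** The new factor equals 1 + a/(s - p) + b/(s - p)^2 with a = 2 p - z - w. As [p] is not yet a
    pole, poles stay at most double, and the sum of the residues changes by exactly [a]. A simple
    pole is covered by taking [w = p]. *)
Lemma pfrac_step (R : C -> C) (P : list C) (B : C -> C) (r : Rdefinitions.R) (p z w : C) :
  pfrac R P B r -> ~ In p P ->
  exists B', pfrac (fun s => R s * ((s - z) * (s - w) / ((s - p) * (s - p)))) (p :: P) B'
               (r + Cmod (2 * p - z - w)).
Proof.
  intros [Hnd [Hr [A H]]] Hp.
  set (a := 2 * p - z - w). set (b := (p - z) * (p - w)).
  (* [Rp] and [dRp] are the value and the derivative of [R] at the new pole, [phi] and [dphi] those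
     of the new factor at an old one; [A'] and [B'] are the resulting Laurent coefficients. *)
  set (Rp := 1 + lsum (fun q => B q / (p - q) + A q / ((p - q) * (p - q))) P).
  set (dRp := lsum (fun q => - (B q / ((p - q) * (p - q)) + 2 * A q / ((p - q) * (p - q) * (p - q)))) P).
  set (phi := fun q => 1 + a / (q - p) + b / ((q - p) * (q - p))).
  set (dphi := fun q => - (a / ((q - p) * (q - p)) + 2 * b / ((q - p) * (q - p) * (q - p)))).
  set (B' := fun q => if Ceq_dec q p then a * Rp + b * dRp else B q * phi q + A q * dphi q).
  set (A' := fun q => if Ceq_dec q p then b * Rp else A q * phi q).
  assert (HinB : forall q, In q P -> B' q = B q * phi q + A q * dphi q).
  { intros q Hq. unfold B'. destruct (Ceq_dec q p) as [->|]; [contradiction|reflexivity]. }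
  assert (HinA : forall q, In q P -> A' q = A q * phi q).
  { intros q Hq. unfold A'. destruct (Ceq_dec q p) as [->|]; [contradiction|reflexivity]. }
  assert (HB'p : B' p = a * Rp + b * dRp) by (unfold B'; destruct (Ceq_dec p p); congruence).
  assert (HA'p : A' p = b * Rp) by (unfold A'; destruct (Ceq_dec p p); congruence).
  assert (Hne : forall q, In q P -> p - q <> 0 /\ q - p <> 0).
  { intros q Hq. split; apply Cminus_eq_contra; intros ->; contradiction. }
  exists B'. split; [constructor; auto|]. split.
  (* For each old pole [q] the extra contributions at [p] and at [q] cancel, being the residues of a
     product that is O(s^-2) at infinity; only [a] remains. *)
  - assert (E : lsum B' (p :: P) = lsum B P + a).
    { change (B' p + lsum B' P = lsum B P + a). rewrite HB'p. unfold Rp, dRp.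
      rewrite (lsum_ext _ _ _ HinB).
      replace (lsum B P + a) with (a + lsum B P) by ring.
      rewrite Cmult_plus_distr_l, Cmult_1_r, <- !Cplus_assoc. f_equal.
      rewrite <- !lsum_scal, <- !lsum_plus. apply lsum_ext. intros q Hq.
      destruct (Hne q Hq) as [H1 H2]. unfold phi, dphi. field. auto. }
    rewrite E. eapply Rle_trans; [apply Cmod_triangle|]. fold a. lra.
  - exists A'. intros s Hs.
    assert (Hsp : s - p <> 0). { apply Cminus_eq_contra. intros ->. apply Hs. now left. }
    assert (HsP : ~ In s P). { intros Hin. apply Hs. now right. }
    rewrite H by auto. rewrite lsum_cons, HB'p, HA'p.
    rewrite (lsum_ext (fun p => B' p / (s - p) + A' p / ((s - p) * (s - p))) (fun q => (B q * phi q + A q * dphi q) / (s - q) + A q * phi q / ((s - q) * (s - q))))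
      by (intros q Hq; rewrite HinB, HinA; auto).
    transitivity (1 + a / (s - p) + b / ((s - p) * (s - p)) +
      (((s - z) * (s - w) / ((s - p) * (s - p)))
         * lsum (fun q => B q / (s - q) + A q / ((s - q) * (s - q))) P)).
    + unfold a, b. field. auto.
    + transitivity (1 + a / (s - p) + b / ((s - p) * (s - p)) +
       ((a / (s - p) + b / ((s - p) * (s - p)))
          * lsum (fun q => B q / (p - q) + A q / ((p - q) * (p - q))) P
        + (b / (s - p)) * dRp
        + lsum (fun q => (B q * phi q + A q * dphi q) / (s - q) + A q * phi q / ((s - q) * (s - q))) P)).
      2:{ unfold Rp. field. auto. }
      f_equal. unfold dRp. rewrite <- !lsum_scal, <- !lsum_plus. apply lsum_ext. intros q Hq.
      destruct (Hne q Hq) as [H1 H2].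
      assert (H3 : s - q <> 0). { apply Cminus_eq_contra. intros ->. contradiction. }
      unfold phi, dphi, a, b. field. auto.
Qed.

Lemma away_from_list (p : C) (P : list C) :
  exists d, (0 < d)%R /\ forall h : C, h <> 0 -> (Cmod h < d)%R -> ~ In (p + h) P.
Proof.
  induction P as [|q P [d [Hd IH]]].
  - exists 1%R. split; [lra|]. simpl. auto.
  - destruct (Ceq_dec q p) as [->|Hne].
    + exists d. split; auto. intros h Hh Hlt [E|Hin]; [|now apply (IH h)].
      apply Hh. replace h with (p + h - p) by ring. rewrite <- E. ring.
    + assert (Hpos : (0 < Cmod (q - p))%R) by (apply Cmod_gt_0; now apply Cminus_eq_contra).
      exists (Rmin d (Cmod (q - p))). split; [now apply Rmin_glb_lt|].
      intros h Hh Hlt. pose proof (Rmin_l d (Cmod (q - p))). pose proof (Rmin_r d (Cmod (q - p))).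
      intros [E|Hin]; [|apply (IH h); auto; lra].
      replace h with (p + h - p) in Hlt by ring. rewrite <- E in Hlt. lra.
Qed.

Lemma jet_lsum (P : list C) (f : C -> C -> C) (v a : C -> C) :
  (forall q, In q P -> jet (f q) (v q) (a q)) ->
  jet (fun h => lsum (fun q => f q h) P) (lsum v P) (lsum a P).
Proof.
  induction P as [|q P IH]; intros H; simpl; [apply jet_const|].
  apply jet_plus; [apply H|apply IH; intros; apply H]; simpl; auto.
Qed.

Lemma lsum_delta (P : list C) (p : C) (b : C -> C) : NoDup P -> In p P ->
  lsum (fun q => if Ceq_dec q p then b q else 0) P = b p.
Proof.
  induction P as [|q P IH]; intros Hnd Hin; [contradiction|]. inversion Hnd; subst. simpl.
  destruct (Ceq_dec q p) as [->|Hne].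
  - replace (b p) with (b p + 0) at 2 by ring. f_equal.
    rewrite (lsum_ext _ (fun q => 0 * 0)); [rewrite lsum_scal; ring|].
    intros q Hq. destruct (Ceq_dec q p) as [->|]; [contradiction|ring].
  - destruct Hin as [|Hin]; [contradiction|]. rewrite IH by auto. ring.
Qed.

(** After multiplication by h^2 the terms of the pole [p] become [A p + B p * h], and everything
    else is O(h^2): the residue is a slope. *)
Lemma pfrac_jet (R : C -> C) (P : list C) (B : C -> C) (r : Rdefinitions.R) (p : C) :
  pfrac R P B r -> In p P -> exists v, jet (fun h => h * h * R (p + h)) v (B p).
Proof.
  intros [Hnd [_ [A H]]] Hp. exists (A p).
  destruct (away_from_list p P) as [d [Hd Hd']].
  apply jet_ext with (fun h => h * h + lsum (fun q => h * h * (B q / (p + h - q) + A q / ((p + h - q) * (p + h - q)))) P).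
  { exists d. split; auto. intros h Hh Hlt. rewrite H by auto. rewrite lsum_scal. ring. }
  (* The factor h^2 kills anything regular to first order. *)
  assert (Hhh : forall f v, jet_val f v -> jet (fun h => h * h * f h) 0 0).
  { intros f v [a Hf]. eapply jet_eq; [| |exact (jet_mult _ _ _ _ _ _ (jet_mult _ _ _ _ _ _ jet_id jet_id) Hf)]; ring. }
  apply jet_eq with (0 + A p) (0 + B p); [ring|ring|]. apply jet_plus.
  { apply jet_ext with (fun h => h * h * 1).
    { exists 1%R. split; [lra|]. intros; ring. }
    apply (Hhh (fun _ => 1) 1). apply jet_val_const. }
  (* Both coefficients are written as sums of Kronecker deltas over [P], so that the expansion can
     be proved term by term. *)
  rewrite <- (lsum_delta P p A Hnd Hp) at 1. rewrite <- (lsum_delta P p B Hnd Hp) at 1.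
  apply jet_lsum. intros q Hq. destruct (Ceq_dec q p) as [->|Hne].
  - apply jet_ext with (fun h => A p + B p * h).
    { exists 1%R. split; [lra|]. intros h Hh _. field. replace (p + h - p) with h by ring. auto. }
    apply jet_eq with (A p + B p * 0) (0 + B p * 1); [ring|ring|].
    apply jet_plus; [apply jet_const|]. apply jet_scal, jet_id.
  - assert (Hpq : p - q <> 0) by (apply Cminus_eq_contra; auto).
    assert (Hi : jet_val (fun h => / (p + h - q)) (/ (p - q))).
    { apply jet_val_inv; auto. destruct (jet_val_shift (p - q) 1) as [a Ha]. exists a.
      apply jet_ext with (2 := Ha). exists 1%R. split; [lra|]. intros; ring. }
    destruct (Hi) as [a Ha].
    eapply (Hhh (fun h => B q / (p + h - q) + A q / ((p + h - q) * (p + h - q)))).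
    exists (B q * a + A q * (/ (p - q) * a + a * / (p - q))).
    eapply jet_ext with (fun h => B q * / (p + h - q) + A q * (/ (p + h - q) * / (p + h - q))).
    { destruct (away_from_list p [q]) as [e' [He1 He2]]. exists e'. split; auto.
      intros h Hh Hlt. specialize (He2 h Hh Hlt). field. intros E. apply He2. left.
      apply Ceq_minus. rewrite <- Copp_0, <- E. ring. }
    apply jet_plus; [exact (jet_scal _ _ _ _ Ha)|].
    exact (jet_scal _ _ _ _ (jet_mult _ _ _ _ _ _ Ha Ha)).
Qed.

Lemma pfrac_residue_double (R : C -> C) (P : list C) (B : C -> C) (r : Rdefinitions.R) (p : C)
  (G : C -> C) (v l : C) :
  pfrac R P B r -> In p P -> log_jet G v l ->
  (exists d, (0 < d)%R /\ forall h : C, h <> 0 -> (Cmod h < d)%R -> h * h * R (p + h) = G h) ->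
  B p = v * l.
Proof.
  intros HPF Hp HG HE. destruct (pfrac_jet R P B r p HPF Hp) as [w Hw].
  apply (jet_ext _ _ _ _ HE) in Hw. now destruct (jet_unique _ _ _ _ _ Hw HG).
Qed.

(** A simple pole is a double pole with vanishing leading coefficient: [h * G h] expands as
    [0 + v h]. *)
Lemma pfrac_residue_simple (R : C -> C) (P : list C) (B : C -> C) (r : Rdefinitions.R) (p : C)
  (G : C -> C) (v : C) :
  pfrac R P B r -> In p P -> jet_val G v ->
  (exists d, (0 < d)%R /\ forall h : C, h <> 0 -> (Cmod h < d)%R -> h * R (p + h) = G h) ->
  B p = v.
Proof.
  intros HPF Hp [a HG] [d [Hd HE]]. destruct (pfrac_jet R P B r p HPF Hp) as [w Hw].
  assert (HG' : jet (fun h => h * G h) 0 v).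
  { eapply jet_eq; [| |exact (jet_mult _ _ _ _ _ _ jet_id HG)]; ring. }
  assert (E : exists d, (0 < d)%R /\ forall h : C, h <> 0 -> (Cmod h < d)%R -> h * h * R (p + h) = h * G h).
  { exists d. split; auto. intros h Hh Hlt. rewrite <- HE by auto. ring. }
  apply (jet_ext _ _ _ _ E) in Hw. now destruct (jet_unique _ _ _ _ _ Hw HG').
Qed.

(** * The exponential and the Gamma function *)

Lemma Cexp_plus (a b : C) : Cexp (a + b) = Cexp a * Cexp b.
Proof.
  destruct a as [x y], b as [x' y']. unfold Cexp, Re, Im. simpl.
  rewrite exp_plus, cos_plus, sin_plus. unfold Cmult. simpl. f_equal; ring.
Qed.

Lemma Cexp_0 : Cexp 0 = 1.
Proof. unfold Cexp, Re, Im. simpl. rewrite exp_0, cos_0, sin_0. unfold RtoC. f_equal; ring. Qed.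

Lemma Cexp_neq_0 (z : C) : Cexp z <> 0.
Proof.
  intros E. apply C1_nz. rewrite <- Cexp_0. replace (RtoC 0) with (z + - z) by ring.
  rewrite Cexp_plus, E. ring.
Qed.

Lemma Cexp_opp (z : C) : Cexp (- z) = / Cexp z.
Proof.
  rewrite <- (Cmult_1_l (/ Cexp z)), <- Cexp_0. replace (RtoC 0) with (- z + z) by ring.
  rewrite Cexp_plus. field. apply Cexp_neq_0.
Qed.

Lemma Cexp_RtoC (x : R) : Cexp (RtoC x) = RtoC (exp x).
Proof. unfold Cexp, Re, Im. simpl. rewrite cos_0, sin_0. unfold RtoC. f_equal; ring. Qed.

Lemma Cmod_Cexp (z : C) : Cmod (Cexp z) = exp (Re z).
Proof.
  unfold Cmod, Cexp. simpl.
  replace (exp (Re z) * cos (Im z) * (exp (Re z) * cos (Im z) * 1) +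
           exp (Re z) * sin (Im z) * (exp (Re z) * sin (Im z) * 1))%R
    with (Rsqr (exp (Re z)) * (Rsqr (sin (Im z)) + Rsqr (cos (Im z))))%R by (unfold Rsqr; ring).
  rewrite sin2_cos2, Rmult_1_r. apply sqrt_Rsqr. left. apply exp_pos.
Qed.

Lemma Rabs_sin_le (t : R) : (Rabs (sin t) <= Rabs t)%R.
Proof.
  destruct (MVT_gen sin 0 t cos) as [c [_ H]].
  - intros x _. auto_derive; auto. ring.
  - intros x _. apply continuity_sin.
  - rewrite sin_0, !Rminus_0_r in H. rewrite H, Rabs_mult.
    assert (Rabs (cos c) <= 1)%R by (apply Rabs_le; apply COS_bound).
    pose proof (Rabs_pos t). nra.
Qed.

Lemma one_minus_cos (y : R) : (1 - cos y = 2 * (sin (y / 2) * sin (y / 2)))%R.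
Proof.
  replace y with (2 * (y / 2))%R at 1 by field. rewrite cos_2a_sin. ring.
Qed.

Lemma one_minus_cos_le (y : R) : (0 <= 1 - cos y <= Rmin (Rabs y) (Rabs y * Rabs y))%R.
Proof.
  rewrite one_minus_cos. set (s := sin (y / 2)).
  assert (H1 : (Rabs s <= Rabs y / 2)%R).
  { eapply Rle_trans; [apply Rabs_sin_le|]. unfold Rdiv. rewrite Rabs_mult, (Rabs_pos_eq (/ 2)); lra. }
  assert (H2 : (Rabs s <= 1)%R) by (apply Rabs_le; apply SIN_bound).
  assert (E : (s * s = Rabs s * Rabs s)%R) by (rewrite <- Rabs_mult, Rabs_pos_eq; nra).
  rewrite E. pose proof (Rabs_pos s). split; [nra|]. apply Rmin_glb; nra.
Qed.

Lemma sin_minus_id_le (y : R) : (Rabs (sin y - y) <= Rabs y * Rabs y)%R.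
Proof.
  destruct (MVT_gen sin 0 y cos) as [c [Hc H]].
  - intros x _. auto_derive; auto. ring.
  - intros x _. apply continuity_sin.
  - rewrite sin_0, !Rminus_0_r in H. rewrite H.
    replace (cos c * y - y)%R with (- (1 - cos c) * y)%R by ring.
    rewrite Rabs_mult, Rabs_Ropp. apply Rmult_le_compat_r; [apply Rabs_pos|].
    destruct (one_minus_cos_le c) as [H1 H2]. rewrite Rabs_pos_eq by auto.
    eapply Rle_trans; [exact H2|]. eapply Rle_trans; [apply Rmin_l|].
    revert Hc. unfold Rmin, Rmax, Rabs.
    repeat destruct Rle_dec; repeat destruct Rcase_abs; intros; lra.
Qed.

Lemma Rabs_exp_minus_1 (x : R) : (Rabs (exp x - 1) <= Rabs x * exp (Rabs x))%R.
Proof.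
  pose proof (exp_ineq1_le x). pose proof (exp_ineq1_le (- x)).
  pose proof (exp_pos x).
  assert (H2 : (exp x * exp (- x) = 1)%R) by (rewrite <- exp_plus, Rplus_opp_r; apply exp_0).
  destruct (Rle_dec 0 x) as [Hx|Hx].
  - rewrite (Rabs_pos_eq x) by auto. rewrite Rabs_pos_eq by lra. nra.
  - rewrite (Rabs_left x) by lra. pose proof (exp_ineq1_le (- x)).
    rewrite Rabs_left by (pose proof (exp_increasing x 0 ltac:(lra)); rewrite exp_0 in *; lra).
    assert (1 <= exp (- x))%R by lra. nra.
Qed.

Lemma exp_minus_1_id (x : R) : (0 <= exp x - 1 - x <= x * x * exp (Rabs x))%R.
Proof.
  pose proof (exp_ineq1_le x). pose proof (exp_ineq1_le (- x)). pose proof (exp_pos x).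
  assert (H2 : (exp x * exp (- x) = 1)%R) by (rewrite <- exp_plus, Rplus_opp_r; apply exp_0).
  split; [lra|]. apply Rle_trans with (x * (exp x - 1))%R; [nra|].
  eapply Rle_trans; [apply Rle_abs|]. rewrite Rabs_mult.
  apply Rle_trans with (Rabs x * (Rabs x * exp (Rabs x)))%R.
  - apply Rmult_le_compat_l; [apply Rabs_pos|apply Rabs_exp_minus_1].
  - rewrite <- Rmult_assoc, <- Rabs_mult, (Rabs_pos_eq (x * x)) by nra. lra.
Qed.

(** Real and imaginary part each contribute two errors of size |w|^2 exp |w|, whence the constant 4.
    It is crude, but the exponential factor makes it valid for all [w]. *)
Lemma Cexp_expansion (w : C) :
  (Cmod (Cexp w - 1 - w) <= 4 * (Cmod w * Cmod w) * exp (Cmod w))%R.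
Proof.
  eapply Rle_trans; [apply Cmod_le_ReIm|].
  pose proof (re_le_Cmod w) as Hx. pose proof (im_le_Cmod w) as Hy.
  assert (ER : Re (Cexp w - 1 - w) = (exp (Re w) * cos (Im w) - 1 - Re w)%R)
    by (unfold Cexp, Re; simpl; ring).
  assert (EI : Im (Cexp w - 1 - w) = (exp (Re w) * sin (Im w) - Im w)%R)
    by (unfold Cexp, Im; simpl; ring).
  rewrite ER, EI. clear ER EI. set (x := Re w) in *. set (y := Im w) in *. set (t := Cmod w) in *.
  assert (Hex : (exp x <= exp t)%R).
  { pose proof (Rle_abs x). destruct (Req_dec x t) as [->|]; [lra|]. left. apply exp_increasing. lra. }
  assert (Heax : (exp (Rabs x) <= exp t)%R).
  { destruct (Req_dec (Rabs x) t) as [->|]; [lra|]. left. apply exp_increasing. lra. }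
  pose proof (exp_pos x) as Hp. pose proof (exp_minus_1_id x) as H1.
  pose proof (one_minus_cos_le y) as H2. pose proof (sin_minus_id_le y) as H3.
  pose proof (Rabs_exp_minus_1 x) as H4. pose proof (Rabs_sin_le y) as H5.
  pose proof (Rmin_r (Rabs y) (Rabs y * Rabs y)) as H6.
  pose proof (Rabs_pos x) as Hx0. pose proof (Rabs_pos y) as Hy0.
  assert (Hxx : (x * x <= t * t)%R) by (rewrite <- (Rabs_pos_eq (x * x)), Rabs_mult by nra; nra).
  assert (Het : (1 <= exp t)%R) by (pose proof (exp_ineq1_le t); lra).
  assert (A1 : (Rabs (exp x * cos y - 1 - x) <= t * t * exp t + t * t * exp t)%R).
  { replace (exp x * cos y - 1 - x)%R with ((exp x - 1 - x) - exp x * (1 - cos y))%R by ring.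
    unfold Rminus at 1. eapply Rle_trans; [apply Rabs_triang|]. rewrite Rabs_Ropp, Rabs_mult.
    rewrite (Rabs_pos_eq (exp x - 1 - x)), (Rabs_pos_eq (exp x)), (Rabs_pos_eq (1 - cos y)) by lra.
    apply Rplus_le_compat.
    - eapply Rle_trans; [apply H1|]. apply Rmult_le_compat; try nra. left; apply exp_pos.
    - rewrite Rmult_comm. apply Rmult_le_compat; try lra. nra. }
  assert (A2 : (Rabs (exp x * sin y - y) <= t * t * exp t + t * t * exp t)%R).
  { replace (exp x * sin y - y)%R with ((exp x - 1) * sin y + (sin y - y))%R by ring.
    eapply Rle_trans; [apply Rabs_triang|]. rewrite Rabs_mult. apply Rplus_le_compat.
    - apply Rle_trans with ((t * exp t) * t)%R; [|apply Req_le; ring].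
      apply Rmult_le_compat; try apply Rabs_pos; try lra.
      eapply Rle_trans; [exact H4|]. apply Rmult_le_compat; try lra. left; apply exp_pos.
    - eapply Rle_trans; [exact H3|]. apply Rle_trans with (t * t)%R; [nra|].
      assert (0 <= t * t)%R by nra. nra. }
  lra.
Qed.

(** * Products of factors close to 1 *)

Lemma Cmod_cprod_le (n : nat) (u : nat -> C) (a : nat -> R) :
  (forall j, (Cmod (u j) <= a j)%R) ->
  (Cmod (cprod n (fun j => (1 + u j)%C)) <= exp (rsum n a))%R.
Proof.
  intros H. induction n as [|n IH]; simpl; [rewrite Cmod_1, exp_0; lra|].
  rewrite Cmod_mult, exp_plus. apply Rmult_le_compat; auto using Cmod_ge_0.
  eapply Rle_trans; [apply Cmod_triangle|]. rewrite Cmod_1. specialize (H n).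
  pose proof (exp_ineq1_le (a n)). lra.
Qed.

Lemma cprod_minus_1_le (n : nat) (u : nat -> C) (a : nat -> R) :
  (forall j, (Cmod (u j) <= a j)%R) ->
  (Cmod (cprod n (fun j => (1 + u j)%C) - 1) <= exp (rsum n a) - 1)%R.
Proof.
  intros H. induction n as [|n IH]; simpl.
  - replace (1 - 1) with (RtoC 0) by ring. rewrite Cmod_0, exp_0. lra.
  - set (P := cprod n (fun j => (1 + u j)%C)) in *.
    replace (P * (1 + u n) - 1) with ((P - 1) + P * u n) by ring.
    eapply Rle_trans; [apply Cmod_triangle|]. rewrite Cmod_mult, exp_plus.
    pose proof (Cmod_cprod_le n u a H) as HP. fold P in HP.
    pose proof (H n). pose proof (exp_ineq1_le (a n)).
    pose proof (Cmod_ge_0 P). pose proof (Cmod_ge_0 (u n)). pose proof (exp_pos (rsum n a)).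
    assert (Cmod P * Cmod (u n) <= exp (rsum n a) * a n)%R by (apply Rmult_le_compat; auto).
    nra.
Qed.

(** Beyond its constant and linear terms the product is a polynomial in the [u j] with nonnegative
    coefficients, so the majorants [a j] may replace the [u j]; then 1 + a <= exp a. *)
Lemma cprod_expansion (n : nat) (u : nat -> C) (a : nat -> R) :
  (forall j, (Cmod (u j) <= a j)%R) ->
  (Cmod (cprod n (fun j => (1 + u j)%C) - 1 - csum n u) <= exp (rsum n a) - 1 - rsum n a)%R.
Proof.
  intros H. induction n as [|n IH]; simpl.
  - replace (1 - 1 - 0) with (RtoC 0) by ring. rewrite Cmod_0, exp_0. lra.
  - pose proof (cprod_minus_1_le n u a H) as H1.
    set (P := cprod n (fun j => (1 + u j)%C)) in *.
    replace (P * (1 + u n) - 1 - (csum n u + u n)) with ((P - 1 - csum n u) + (P - 1) * u n) by ring.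
    eapply Rle_trans; [apply Cmod_triangle|]. rewrite Cmod_mult, exp_plus.
    pose proof (H n). pose proof (exp_ineq1_le (a n)).
    pose proof (Cmod_ge_0 (P - 1)). pose proof (Cmod_ge_0 (u n)). pose proof (exp_pos (rsum n a)).
    assert (Cmod (P - 1) * Cmod (u n) <= (exp (rsum n a) - 1) * a n)%R by (apply Rmult_le_compat; auto).
    nra.
Qed.

(** Consecutive partial products differ by the product times [u n], which is at most [exp S * a n];
    the product is thus an absolutely convergent series. *)
Lemma cprod_cvg (u : nat -> C) (a : nat -> R) (S : R) :
  (forall j, (Cmod (u j) <= a j)%R) -> (forall n, (rsum n a <= S)%R) ->
  exists l, Ccvg (fun n => cprod n (fun j => (1 + u j)%C)) l.
Proof.
  intros H HS.
  destruct (csum_cvg (fun k => cprod k (fun j => (1 + u j)%C) * u k) (fun k => exp S * a k)%R (exp S * S)%R)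
    as [l Hl].
  - intros k. rewrite Cmod_mult. apply Rmult_le_compat; auto using Cmod_ge_0.
    eapply Rle_trans; [apply (Cmod_cprod_le _ _ a); auto|].
    destruct (Req_dec (rsum k a) S) as [->|]; [lra|]. left. apply exp_increasing. specialize (HS k). lra.
  - intros n. rewrite rsum_scal. apply Rmult_le_compat_l; auto. left. apply exp_pos.
  - exists (1 + l). apply Ccvg_ext with (fun n => 1 + csum n (fun k => cprod k (fun j => (1 + u j)%C) * u k)).
    + intros n. induction n as [|n IH]; simpl; [ring|]. rewrite Cplus_assoc, IH. ring.
    + apply Ccvg_plus; auto. apply Ccvg_const.
Qed.

Lemma cprod_cvg_neq_0 (u : nat -> C) (a : nat -> R) (S : R) (l : C) :
  (forall j, (Cmod (u j) <= a j)%R) -> (forall n, (rsum n a <= S)%R) -> Ccvg u 0 ->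
  (forall j, 1 + u j <> 0) -> Ccvg (fun n => cprod n (fun j => (1 + u j)%C)) l -> l <> 0.
Proof.
  intros H HS Hu Hn Hl.
  assert (H1 : Ccvg (fun j => (1 + u j)%C) (1 + 0)) by (apply Ccvg_plus; auto; apply Ccvg_const).
  destruct (Ccvg_bounded_below _ _ H1) as [K [HK HB]]; auto.
  { rewrite Cplus_0_r. apply C1_nz. }
  (* The reciprocal factors 1/(1 + u) = 1 - u/(1 + u) are again summably close to 1, so their
     product converges, and its limit times [l] is 1. *)
  destruct (cprod_cvg (fun j => - (u j * / (1 + u j))) (fun j => K * a j)%R (K * S)%R) as [l' Hl'].
  - intros j. rewrite Cmod_opp, Cmod_mult, Rmult_comm, Cmod_inv by auto.
    apply Rmult_le_compat; auto using Cmod_ge_0.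
    + left. apply Rinv_0_lt_compat. now apply Cmod_gt_0.
    + rewrite <- (Rinv_inv K). apply Rinv_le_contravar; auto. now apply Rinv_0_lt_compat.
  - intros n. rewrite rsum_scal. apply Rmult_le_compat_l; auto. lra.
  - assert (E : l * l' = 1).
    { apply (Ccvg_unique (fun _ => 1)); [|apply Ccvg_const].
      refine (Ccvg_ext _ _ _ _ (Ccvg_mult _ _ _ _ Hl Hl')). intros n.
      rewrite <- cprod_mult. rewrite (cprod_ext _ _ (fun _ => 1)).
      - rewrite cprod_const. apply Cpow_1_l.
      - intros k _. field. auto. }
    intros E0. apply C1_nz. rewrite <- E, E0. ring.
Qed.

(** * Gauss' product for 1/Gamma *)

Definition log_step (j : nat) : R := ln ((INR j + 2) / (INR j + 1)).

(** Both bounds come from ln t <= t - 1, used at t = 1 + x and at t = 1/(1 + x) with x = 1/(j +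
    1). *)
Lemma log_step_bounds (j : nat) :
  (0 <= log_step j <= / (INR j + 1))%R /\ (0 <= / (INR j + 1) - log_step j <= / (INR j + 1) * / (INR j + 1))%R.
Proof.
  pose proof (pos_INR j) as Hj. unfold log_step. set (x := (/ (INR j + 1))%R).
  assert (Hx : (0 < x)%R) by (apply Rinv_0_lt_compat; lra).
  replace ((INR j + 2) / (INR j + 1))%R with (1 + x)%R by (unfold x; field; lra).
  assert (Hln : forall t, (0 < t)%R -> (ln t <= t - 1)%R).
  { intros t Ht. pose proof (exp_ineq1_le (ln t)). rewrite exp_ln in H by auto. lra. }
  assert (H1 := Hln (1 + x)%R ltac:(lra)).
  assert (H2 := Hln (/ (1 + x))%R ltac:(apply Rinv_0_lt_compat; lra)).
  rewrite ln_Rinv in H2 by lra.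
  assert (H3 : (1 - / (1 + x) = x * / (1 + x))%R) by (field; lra).
  assert (H4 : (0 < / (1 + x) <= 1)%R).
  { split; [apply Rinv_0_lt_compat; lra|]. rewrite <- Rinv_1. apply Rinv_le_contravar; lra. }
  assert (H5 : (x - x * / (1 + x) = x * x * / (1 + x))%R) by (field; lra).
  split; [split; nra|]. split; [lra|]. assert (0 < x * x)%R by nra. nra.
Qed.

(** Lets the power of n + 1 in Gauss' product be distributed over the factors, one logarithmic step
    for each. *)
Lemma rsum_lam (n : nat) : rsum n log_step = ln (INR n + 1).
Proof.
  induction n as [|n IH]; [simpl; rewrite Rplus_0_l, ln_1; reflexivity|].
  change (rsum n log_step + log_step n = ln (INR (S n) + 1))%R. rewrite IH, S_INR. unfold log_step.
  pose proof (pos_INR n). rewrite ln_div by lra.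
  replace (INR n + 1 + 1)%R with (INR n + 2)%R by ring. ring.
Qed.

Definition inv_sq (j : nat) : R := (/ (INR j + 1) * / (INR j + 1))%R.

Lemma inv_sq_pos (j : nat) : (0 < inv_sq j)%R.
Proof. pose proof (pos_INR j). apply Rmult_lt_0_compat; apply Rinv_0_lt_compat; lra. Qed.

Lemma rsum_sq (n : nat) : (rsum n inv_sq <= 2)%R.
Proof.
  (* The induction needs the sharper, telescoping majorant. *)
  assert (H : (rsum n inv_sq <= 2 - 2 * / (INR n + 1))%R).
  { induction n as [|n IH]; [simpl; rewrite Rplus_0_l, Rinv_1; lra|].
    change (rsum n inv_sq + inv_sq n <= 2 - 2 * / (INR (S n) + 1))%R. rewrite S_INR.
    pose proof (pos_INR n). unfold inv_sq in *.
    assert (E : (2 * / (INR n + 1) - 2 * / (INR n + 1 + 1) = 2 * (/ (INR n + 1) * / (INR n + 1 + 1)))%R)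
      by (field; lra).
    assert (E2 : (/ (INR n + 1) <= 2 * / (INR n + 1 + 1))%R).
    { apply Rmult_le_reg_l with ((INR n + 1) * (INR n + 1 + 1))%R; [nra|].
      replace ((INR n + 1) * (INR n + 1 + 1) * / (INR n + 1))%R with (INR n + 1 + 1)%R by (field; lra).
      replace ((INR n + 1) * (INR n + 1 + 1) * (2 * / (INR n + 1 + 1)))%R with (2 * (INR n + 1))%R by (field; lra).
      lra. }
    assert (0 < / (INR n + 1))%R by (apply Rinv_0_lt_compat; lra). nra. }
  pose proof (pos_INR n). assert (0 < / (INR n + 1))%R by (apply Rinv_0_lt_compat; lra). lra.
Qed.

Lemma rsum_scal_sq (K : R) (n : nat) : (0 <= K)%R -> (rsum n (fun j => K * inv_sq j) <= K * 2)%R.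
Proof. intros HK. rewrite rsum_scal. apply Rmult_le_compat_l; auto. apply rsum_sq. Qed.

Lemma is_lim_seq_inv_INR : is_lim_seq (fun n => / (INR n + 1))%R 0.
Proof.
  apply is_lim_seq_ext with (fun n => / INR (S n))%R; [intros; now rewrite S_INR|].
  replace (Finite 0) with (Rbar_inv p_infty) by reflexivity. apply is_lim_seq_inv; [|discriminate].
  apply (is_lim_seq_incr_1 INR). apply is_lim_seq_INR.
Qed.

Lemma is_lim_seq_sq : is_lim_seq inv_sq 0.
Proof.
  replace 0%R with (0 * 0)%R by ring.
  apply is_lim_seq_mult'; apply is_lim_seq_inv_INR.
Qed.

(** With y j = 1/(z + j) this is the j-th factor of the change of Gauss' product from [z] to
    [z + h]; the exponential is the convergence factor that leaves 1 + O(1/j^2). *)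
Definition gauss_fac (y : nat -> C) (h : C) (j : nat) : C := (1 + h * y j) * Cexp (- (h * log_step j)).

(** Every term beyond the linear ones contains h^2 together with two factors of size 1/(j + 1),
    namely [y j] or [log_step j]. The error is therefore quadratic in [h] and summable in [j] at the
    same time, uniformly for |h| <= [H]. *)
Lemma gauss_fac_expansion (y : nat -> C) (K H : R) : (0 <= K)%R ->
  (forall j, (Cmod (y j) <= K * / (INR j + 1))%R) ->
  exists K2, (0 <= K2)%R /\ forall h j, (Cmod h <= H)%R ->
    (Cmod (gauss_fac y h j - 1 - h * (y j - log_step j)) <= K2 * (Cmod h * Cmod h) * inv_sq j)%R.
Proof.
  intros HK Hy. exists (K + (1 + K * Rabs H) * (4 * exp (Rabs H)))%R.
  pose proof (exp_pos (Rabs H)) as HeH. pose proof (Rabs_pos H) as HH0.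
  assert (HKH : (0 <= K * Rabs H)%R) by now apply Rmult_le_pos.
  split; [nra|]. intros h j Hh.
  assert (HhH : (Cmod h <= Rabs H)%R) by (eapply Rle_trans; [exact Hh|apply Rle_abs]).
  specialize (Hy j). destruct (log_step_bounds j) as [[L1 L2] _].
  pose proof (pos_INR j) as Hj. unfold inv_sq. set (x := (/ (INR j + 1))%R) in *.
  assert (Hx : (0 < x)%R) by (apply Rinv_0_lt_compat; lra).
  assert (Hx1 : (x <= 1)%R) by (unfold x; rewrite <- Rinv_1; apply Rinv_le_contravar; lra).
  pose proof (Cmod_ge_0 h) as Hh0. set (t := Cmod h) in *.
  unfold gauss_fac. pose proof (Cexp_expansion (- (h * log_step j))) as HE.
  rewrite Cmod_opp, Cmod_mult, Cmod_R, Rabs_pos_eq in HE by lra. fold t in HE.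
  set (r := Cexp (- (h * log_step j)) - 1 - - (h * log_step j)) in *.
  replace ((1 + h * y j) * Cexp (- (h * log_step j)) - 1 - h * (y j - log_step j)) with
    (- (h * h * y j * log_step j) + (1 + h * y j) * r) by (unfold r; ring).
  assert (Hr : (Cmod r <= 4 * exp (Rabs H) * (t * t) * (x * x))%R).
  { eapply Rle_trans; [exact HE|].
    assert (exp (t * log_step j) <= exp (Rabs H))%R.
    { destruct (Req_dec (t * log_step j) (Rabs H)) as [->|]; [lra|]. left. apply exp_increasing. nra. }
    replace (4 * exp (Rabs H) * (t * t) * (x * x))%R with (4 * ((t * x) * (t * x)) * exp (Rabs H))%R by ring.
    apply Rmult_le_compat; try (left; apply exp_pos); auto.
    - assert (0 <= t * log_step j)%R by nra. nra.
    - assert (0 <= t * log_step j <= t * x)%R by (split; nra). nra. }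
  eapply Rle_trans; [apply Cmod_triangle|].
  rewrite Cmod_opp, !Cmod_mult, Cmod_R, (Rabs_pos_eq (log_step j)) by lra. fold t.
  assert (H1 : (Cmod (1 + h * y j) <= 1 + K * Rabs H)%R).
  { eapply Rle_trans; [apply Cmod_triangle|]. rewrite Cmod_1, Cmod_mult. fold t.
    pose proof (Cmod_ge_0 (y j)). assert (Cmod (y j) <= K)%R by nra.
    assert (t * Cmod (y j) <= Rabs H * K)%R by (apply Rmult_le_compat; auto). lra. }
  assert (H2 : (Cmod (1 + h * y j) * Cmod r <= (1 + K * Rabs H) * (4 * exp (Rabs H) * (t * t) * (x * x)))%R)
    by (apply Rmult_le_compat; auto using Cmod_ge_0).
  assert (H3 : (t * t * Cmod (y j) * log_step j <= t * t * (K * x) * x)%R).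
  { pose proof (Cmod_ge_0 (y j)). assert (0 <= t * t)%R by nra. apply Rmult_le_compat; try nra. }
  eapply Rle_trans; [apply Rplus_le_compat; [exact H3|exact H2]|]. apply Req_le. ring.
Qed.

(** [y j] and [log_step j] both equal 1/(j + 1) up to a multiple of [inv_sq j], so the linear term
    is summable too. *)
Lemma gauss_fac_minus_1 (y : nat -> C) (K H : R) : (0 <= K)%R ->
  (forall j, (Cmod (y j) <= K * / (INR j + 1))%R) ->
  (forall j, (Cmod (y j - RtoC (/ (INR j + 1))) <= K * inv_sq j)%R) ->
  exists K2, (0 <= K2)%R /\ forall h j, (Cmod h <= H)%R ->
    (Cmod (h * (y j - log_step j)) <= (K + 1) * Cmod h * inv_sq j)%R /\
    (Cmod (gauss_fac y h j - 1 - h * (y j - log_step j)) <= K2 * (Cmod h * Cmod h) * inv_sq j)%R /\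
    (Cmod (gauss_fac y h j - 1) <= (K + 1 + K2 * Rabs H) * Cmod h * inv_sq j)%R.
Proof.
  intros HK H1 H2. destruct (gauss_fac_expansion y K H HK H1) as [K2 [HK2 HF]].
  exists K2. split; auto. intros h j Hh. specialize (HF h j Hh). specialize (H2 j).
  destruct (log_step_bounds j) as [_ [L1 L2]]. fold (inv_sq j) in L2. pose proof (inv_sq_pos j) as Hs.
  pose proof (Cmod_ge_0 h) as Hh0.
  assert (A : (Cmod (h * (y j - log_step j)) <= (K + 1) * Cmod h * inv_sq j)%R).
  { rewrite Cmod_mult. replace ((K + 1) * Cmod h * inv_sq j)%R with (Cmod h * (K * inv_sq j + inv_sq j))%R by ring.
    apply Rmult_le_compat_l; auto.
    replace (y j - log_step j) with ((y j - RtoC (/ (INR j + 1))) + RtoC (/ (INR j + 1) - log_step j))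
      by (rewrite RtoC_minus; ring).
    eapply Rle_trans; [apply Cmod_triangle|]. rewrite Cmod_R, Rabs_pos_eq by lra. lra. }
  split; auto. split; auto.
  eapply Rle_trans; [apply (Cmod_le_add _ (h * (y j - log_step j)))|].
  assert (Cmod h <= Rabs H)%R by (eapply Rle_trans; [exact Hh|apply Rle_abs]).
  assert (K2 * (Cmod h * Cmod h) * inv_sq j <= K2 * Rabs H * Cmod h * inv_sq j)%R.
  { apply Rmult_le_compat_r; [lra|]. rewrite Rmult_assoc. apply Rmult_le_compat_l; auto.
    apply Rmult_le_compat_r; auto. }
  lra.
Qed.

(** [z] is none of 0, -1, -2, ..., the poles of Gamma. This is weaker than [notZ], since it must
    also hold for positive integers. *)
Definition not_pole (z : C) : Prop := forall j : nat, z + INR j <> 0.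

Lemma RtoC_INR_S (j : nat) : RtoC (INR j) + 1 = RtoC (INR (S j)).
Proof. now rewrite S_INR, RtoC_plus. Qed.

Lemma INR_S_neq_0 (j : nat) : RtoC (INR j) + 1 <> 0.
Proof. rewrite RtoC_INR_S. intros E. apply RtoC_inj in E. pose proof (lt_0_INR (S j) ltac:(lia)). lra. Qed.

(** The ratio (z + j)/(j + 1) tends to 1 and never vanishes, so it stays away from 0. *)
Lemma not_pole_bound (z : C) : not_pole z -> exists K, (0 < K)%R /\ forall j, (INR j + 1 <= K * Cmod (z + INR j))%R.
Proof.
  intros Hz. assert (Hlim : Ccvg (fun j => (z + INR j) / (INR j + 1)) 1).
  { apply Ccvg_ext with (fun j => 1 + (z - 1) * RtoC (/ (INR j + 1))).
    - intros j. rewrite RtoC_inv, RtoC_plus by (pose proof (pos_INR j); lra). field. apply INR_S_neq_0.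
    - apply Ccvg_eq with (1 + (z - 1) * 0); [ring|]. apply Ccvg_plus; [apply Ccvg_const|].
      apply Ccvg_mult; [apply Ccvg_const|]. apply Ccvg_RtoC. apply is_lim_seq_inv_INR. }
  destruct (Ccvg_bounded_below _ _ Hlim C1_nz) as [K [HK HB]].
  - intros j. apply Cmult_neq_0; auto. intros E. apply C1_nz.
    rewrite <- (Cinv_l _ (INR_S_neq_0 j)), E. ring.
  - exists K. split; auto. intros j. specialize (HB j). pose proof (pos_INR j).
    rewrite Cmod_div, <- RtoC_plus, Cmod_R, Rabs_pos_eq in HB by (try lra; rewrite ?RtoC_plus; apply INR_S_neq_0).
    apply Rmult_le_reg_l with (/ K * / (INR j + 1))%R.
    { apply Rmult_lt_0_compat; apply Rinv_0_lt_compat; lra. }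
    replace (/ K * / (INR j + 1) * (INR j + 1))%R with (/ K)%R by (field; lra).
    replace (/ K * / (INR j + 1) * (K * Cmod (z + INR j)))%R with (Cmod (z + INR j) / (INR j + 1))%R
      by (field; lra). exact HB.
Qed.

Lemma not_pole_inv_bound (z : C) : not_pole z -> exists K, (0 <= K)%R /\
  (forall j, (Cmod (/ (z + INR j)) <= K * / (INR j + 1))%R) /\
  (forall j, (Cmod (/ (z + INR j) - RtoC (/ (INR j + 1))) <= K * inv_sq j)%R).
Proof.
  intros Hz. destruct (not_pole_bound z Hz) as [K [HK HB]].
  assert (H1 : forall j, (Cmod (/ (z + INR j)) <= K * / (INR j + 1))%R).
  { intros j. specialize (HB j). rewrite Cmod_inv by auto. pose proof (pos_INR j).
    assert (Hp : (0 < Cmod (z + INR j))%R) by (apply Cmod_gt_0; auto).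
    apply Rmult_le_reg_l with (Cmod (z + INR j) * (INR j + 1))%R; [nra|].
    replace (Cmod (z + INR j) * (INR j + 1) * / Cmod (z + INR j))%R with (INR j + 1)%R by (field; lra).
    replace (Cmod (z + INR j) * (INR j + 1) * (K * / (INR j + 1)))%R with (K * Cmod (z + INR j))%R by (field; lra).
    exact HB. }
  exists (K + K * Cmod (1 - z))%R. pose proof (Cmod_ge_0 (1 - z)) as H0.
  assert (H2 : (0 <= K * Cmod (1 - z))%R) by nra.
  split; [lra|]. split.
  - intros j. eapply Rle_trans; [apply H1|]. apply Rmult_le_compat_r; [|lra].
    left. apply Rinv_0_lt_compat. pose proof (pos_INR j). lra.
  - intros j. pose proof (pos_INR j). specialize (H1 j).
    rewrite RtoC_inv, RtoC_plus by lra.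
    replace (/ (z + INR j) - / (INR j + 1)) with ((1 - z) * (/ (z + INR j) * / (INR j + 1)))
      by (field; split; [apply INR_S_neq_0|apply Hz]).
    rewrite !Cmod_mult, (Cmod_inv (INR j + 1)) by apply INR_S_neq_0.
    rewrite <- RtoC_plus, Cmod_R, Rabs_pos_eq by lra. unfold inv_sq.
    assert (Hx : (0 < / (INR j + 1))%R) by (apply Rinv_0_lt_compat; lra).
    set (x := (/ (INR j + 1))%R) in *.
    assert (Cmod (/ (z + INR j)) * x <= K * x * x)%R by (apply Rmult_le_compat_r; lra).
    apply Rle_trans with (Cmod (1 - z) * (K * x * x))%R; [apply Rmult_le_compat_l; auto|].
    assert (0 <= K * (x * x))%R by (apply Rmult_le_pos; nra). nra.
Qed.

Lemma poch_S (z : C) (n : nat) : poch z (S n) = poch z n * (z + INR n).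
Proof. reflexivity. Qed.

Lemma poch_neq_0 (z : C) (n : nat) : not_pole z -> poch z n <> 0.
Proof. intros H. apply cprod_neq_0. intros k _. apply H. Qed.

Lemma poch_1 (n : nat) : poch 1 n = INR (fact n).
Proof.
  induction n as [|n IH]; [reflexivity|]. rewrite poch_S, IH, fact_simpl, mult_INR, RtoC_mult.
  rewrite S_INR, RtoC_plus. ring.
Qed.

Lemma INR_fact_neq_0_C (n : nat) : RtoC (INR (fact n)) <> 0.
Proof. intros E. apply RtoC_inj in E. now apply (INR_fact_neq_0 n). Qed.

Lemma Rcpow_plus (x : R) (a b : C) : Rcpow x (a + b) = Rcpow x a * Rcpow x b.
Proof. unfold Rcpow. rewrite <- Cexp_plus. f_equal. ring. Qed.

Lemma Rcpow_1 (x : R) : (0 < x)%R -> Rcpow x 1 = x.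
Proof. intros Hx. unfold Rcpow. rewrite Cmult_1_l, Cexp_RtoC, exp_ln; auto. Qed.

Lemma Rcpow_0 (x : R) : Rcpow x 0 = 1.
Proof. unfold Rcpow. rewrite Cmult_0_l. apply Cexp_0. Qed.

Lemma Rcpow_neq_0 (x : R) (z : C) : Rcpow x z <> 0.
Proof. apply Cexp_neq_0. Qed.

Lemma Cmod_Rcpow (x : R) (z : C) : Cmod (Rcpow x z) = Rpower x (Re z).
Proof. unfold Rcpow, Rpower. rewrite Cmod_Cexp. f_equal. apply re_scal_r. Qed.

Definition recip (z : C) (j : nat) : C := / (z + INR j).

(* Its limit is [1 / Gamma z]. Written with [n + 1] and [z - 1], it changes under [z -> z + h] exactly by the
   factors [gauss_fac], without boundary terms. *)
Definition gauss_quot (z : C) (n : nat) : C :=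
  poch z n / (INR (fact n) * Rcpow (INR n + 1) (z - 1)).

Lemma gauss_quot_den_neq_0 (z : C) (n : nat) : INR (fact n) * Rcpow (INR n + 1) z <> 0.
Proof. apply Cmult_neq_0; [apply INR_fact_neq_0_C|apply Rcpow_neq_0]. Qed.

Lemma gauss_quot_neq_0 (z : C) (n : nat) : not_pole z -> gauss_quot z n <> 0.
Proof.
  intros H. unfold gauss_quot. apply Cmult_neq_0; [now apply poch_neq_0|].
  intros E. apply C1_nz. rewrite <- (Cinv_l _ (gauss_quot_den_neq_0 (z - 1) n)), E. ring.
Qed.

Lemma poch_gq (z : C) (n : nat) : poch z n = gauss_quot z n * (INR (fact n) * Rcpow (INR n + 1) (z - 1)).
Proof. unfold gauss_quot. field. split; [apply Rcpow_neq_0|apply INR_fact_neq_0_C]. Qed.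

Lemma cprod_Cexp_lam (h : C) (n : nat) :
  cprod n (fun j => Cexp (- (h * log_step j))) = / Rcpow (INR n + 1) h.
Proof.
  unfold Rcpow. rewrite <- rsum_lam, <- Cexp_opp.
  induction n as [|n IH]; simpl.
  - rewrite Cmult_0_r, Copp_0, Cexp_0. reflexivity.
  - rewrite IH, <- Cexp_plus. f_equal. rewrite RtoC_plus. ring.
Qed.

(** Exact for every [n]. With base point 1 it gives the convergence of Gauss' product everywhere,
    with base point [z] the expansion of 1/Gamma in [h]. *)
Lemma gauss_quot_ratio (z h : C) (n : nat) : not_pole z ->
  gauss_quot (z + h) n = gauss_quot z n * cprod n (gauss_fac (recip z) h).
Proof.
  intros Hz. unfold gauss_fac. rewrite cprod_mult, cprod_Cexp_lam.
  assert (E : poch (z + h) n = poch z n * cprod n (fun j => 1 + h * recip z j)).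
  { unfold poch. rewrite <- cprod_mult. apply cprod_ext. intros j _. unfold recip. field. apply Hz. }
  unfold gauss_quot. rewrite E. replace (z + h - 1) with ((z - 1) + h) by ring. rewrite Rcpow_plus.
  field. repeat split; try apply Rcpow_neq_0. apply INR_fact_neq_0_C.
Qed.

Lemma gauss_quot_1 (n : nat) : gauss_quot 1 n = 1.
Proof.
  unfold gauss_quot. rewrite poch_1. replace (1 - 1) with (RtoC 0) by ring. rewrite Rcpow_0.
  field. apply INR_fact_neq_0_C.
Qed.

Lemma not_pole_1 : not_pole 1.
Proof. intros j. rewrite Cplus_comm. apply INR_S_neq_0. Qed.

Lemma Ccvg_0_le (u : nat -> C) (v : nat -> R) : (forall n, (Cmod (u n) <= v n)%R) ->
  is_lim_seq v 0 -> Ccvg u 0.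
Proof.
  intros H Hv. apply lim0_le with v; auto. intros n.
  replace (u n - 0) with (u n) by ring. split; [apply Cmod_ge_0|apply H].
Qed.

Lemma gauss_fac_cvg (z h : C) : not_pole z -> exists a : R, (0 <= a)%R /\
  (forall j, (Cmod (gauss_fac (recip z) h j - 1) <= a * inv_sq j)%R).
Proof.
  intros Hz. destruct (not_pole_inv_bound z Hz) as [K [HK [H1 H2]]].
  destruct (gauss_fac_minus_1 (recip z) K (Cmod h) HK H1 H2) as [K2 [HK2 HF]].
  exists ((K + 1 + K2 * Rabs (Cmod h)) * Cmod h)%R. split.
  - apply Rmult_le_pos; [|apply Cmod_ge_0]. pose proof (Rabs_pos (Cmod h)). nra.
  - intros j. apply HF. lra.
Qed.

Lemma gauss_fac_eq (y : nat -> C) (h : C) (n : nat) :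
  cprod n (gauss_fac y h) = cprod n (fun j => 1 + (gauss_fac y h j - 1)).
Proof. apply cprod_ext. intros; ring. Qed.

(** At the base point 1 the quotient is constantly 1, so at [z] it is a bare product of the factors
    [gauss_fac] with h = z - 1. *)
Lemma gauss_quot_ex (z : C) : exists l, Ccvg (gauss_quot z) l /\ (not_pole z -> l <> 0).
Proof.
  destruct (gauss_fac_cvg 1 (z - 1) not_pole_1) as [a [Ha HF]].
  destruct (cprod_cvg (fun j => gauss_fac (recip 1) (z - 1) j - 1) (fun j => a * inv_sq j)%R (a * 2)%R) as [l Hl];
    auto.
  { intros n. now apply rsum_scal_sq. }
  exists l. split.
  - refine (Ccvg_ext _ _ _ _ Hl). intros n. rewrite <- gauss_fac_eq. replace z with (1 + (z - 1)) at 2 by ring.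
    rewrite gauss_quot_ratio by apply not_pole_1. rewrite gauss_quot_1. ring.
  - intros Hz. refine (cprod_cvg_neq_0 _ _ _ _ HF (fun n => rsum_scal_sq _ n Ha) _ _ Hl).
    + apply (Ccvg_0_le _ _ HF). replace 0%R with (a * 0)%R by ring.
      apply is_lim_seq_mult'; [apply is_lim_seq_const|apply is_lim_seq_sq].
    + intros j. replace (1 + (gauss_fac (recip 1) (z - 1) j - 1)) with
        (gauss_fac (recip 1) (z - 1) j) by ring.
      unfold gauss_fac, recip. apply Cmult_neq_0; [|apply Cexp_neq_0].
      replace (1 + (z - 1) * / (1 + INR j)) with ((z + INR j) * / (1 + INR j)) by (field; apply not_pole_1).
      apply Cmult_neq_0; auto. intros E. apply C1_nz. rewrite <- (Cinv_l _ (not_pole_1 j)), E. ring.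
Qed.

Lemma Ccvg_linear_ratio (z : C) : Ccvg (fun n => (z + INR n) / (INR n + 1)) 1.
Proof.
  apply Ccvg_ext with (fun j => 1 + (z - 1) * RtoC (/ (INR j + 1))).
  - intros j. rewrite RtoC_inv, RtoC_plus by (pose proof (pos_INR j); lra). field. apply INR_S_neq_0.
  - apply Ccvg_eq with (1 + (z - 1) * 0); [ring|]. apply Ccvg_plus; [apply Ccvg_const|].
    apply Ccvg_mult; [apply Ccvg_const|]. apply Ccvg_RtoC. apply is_lim_seq_inv_INR.
Qed.

Lemma rGamma_seq (z : C) (n : nat) :
  cprod (S (S n)) (fun j => z + INR j) / (INR (fact (S n)) * Rcpow (INR (S n)) z) =
  gauss_quot z n * ((z + INR n) / (INR n + 1)) * ((z + 1 + INR n) / (INR n + 1)).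
Proof.
  change (cprod (S (S n)) (fun j => z + INR j)) with (poch z n * (z + INR n) * (z + INR (S n))).
  rewrite poch_gq, fact_simpl, mult_INR, RtoC_mult, <- RtoC_INR_S, S_INR.
  pose proof (pos_INR n).
  replace (Rcpow (INR n + 1) z) with (Rcpow (INR n + 1) (z - 1) * (INR n + 1)).
  2:{ replace z with ((z - 1) + 1) at 2 by ring. rewrite Rcpow_plus, Rcpow_1, RtoC_plus by lra. reflexivity. }
  field. repeat split; try apply INR_S_neq_0; try apply Rcpow_neq_0. apply INR_fact_neq_0_C.
Qed.

Lemma rGamma_Cv (z l : C) : Ccvg (gauss_quot z) l ->
  Ccvg (fun n => cprod (S n) (fun j => z + INR j) / (INR (fact n) * Rcpow (INR n) z)) l.
Proof.
  (* The shift by one avoids n = 0, where [ln 0] is a default value; the surplus linear factors tend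
     to 1. *)
  intros H. apply (Ccvg_decr_n _ _ 1).
  apply Ccvg_ext with (fun n => gauss_quot z n * ((z + INR n) / (INR n + 1)) * ((z + 1 + INR n) / (INR n + 1))).
  - intros n. rewrite <- rGamma_seq. rewrite Nat.add_1_r. reflexivity.
  - apply Ccvg_eq with (l * 1 * 1); [ring|].
    apply Ccvg_mult; [apply Ccvg_mult; auto|]; apply Ccvg_linear_ratio.
Qed.

Lemma gauss_quot_Cv (z : C) : Ccvg (gauss_quot z) (rGamma z).
Proof.
  destruct (gauss_quot_ex z) as [l [Hl _]].
  apply Ccvg_eq with l; auto. symmetry. apply Ccvg_Clim. now apply rGamma_Cv.
Qed.

Lemma rGamma_neq_0 (z : C) : not_pole z -> rGamma z <> 0.
Proof.
  intros Hz. destruct (gauss_quot_ex z) as [l [Hl Hn]].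
  rewrite (Ccvg_unique _ _ _ (gauss_quot_Cv z) Hl). auto.
Qed.

Lemma Cinv_div (a b : C) : a <> 0 -> b <> 0 -> / (a / b) = b / a.
Proof. intros. field. auto. Qed.

Lemma Gamma_rGamma (z : C) : not_pole z -> Gamma z = / rGamma z.
Proof.
  intros Hz. apply Ccvg_Clim.
  refine (Ccvg_ext _ _ _ _ (Ccvg_inv _ _ (rGamma_Cv z _ (gauss_quot_Cv z)) (rGamma_neq_0 z Hz))).
  intros n. apply Cinv_div.
  - now apply (poch_neq_0 z (S n)).
  - apply Cmult_neq_0; [apply INR_fact_neq_0_C|apply Rcpow_neq_0].
Qed.

(** At a pole of Gamma the Pochhammer products are 0 from some index on. *)
Lemma rGamma_neq_0_np (z : C) : rGamma z <> 0 -> not_pole z.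
Proof.
  intros H j E. apply H. apply (Ccvg_unique (gauss_quot z)); [apply gauss_quot_Cv|].
  apply Ccvg_ext_loc with (fun _ => 0); [|apply Ccvg_const].
  exists (S j). intros n Hn. unfold gauss_quot. replace (poch z n) with (RtoC 0); [unfold Cdiv; ring|].
  unfold poch. replace n with (S j + (n - S j))%nat by lia.
  rewrite cprod_app. simpl. rewrite E. ring.
Qed.

Lemma rGamma_shift (z : C) : rGamma z = z * rGamma (z + 1).
Proof.
  apply (Ccvg_unique (fun n => gauss_quot z (n + 1)%nat)); [apply Ccvg_incr_n, gauss_quot_Cv|].
  (* Taking n + 1 instead of n factors, the only correction is the quotient of the powers of n + 2
     and n + 1, which tends to 1. *)
  apply Ccvg_ext with (fun n => z * gauss_quot (z + 1) n * / (Rcpow ((INR n + 2) / (INR n + 1)) (z - 1))).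
  - intros n. rewrite Nat.add_1_r. unfold gauss_quot.
    replace (poch z (S n)) with (z * poch (z + 1) n).
    2:{ unfold poch. rewrite cprod_S_l. simpl (INR 0). rewrite Cplus_0_r. f_equal.
        apply cprod_ext. intros k _. rewrite <- RtoC_INR_S. ring. }
    rewrite fact_simpl, mult_INR, RtoC_mult, <- RtoC_INR_S, S_INR.
    replace (INR n + 1 + 1)%R with (INR n + 2)%R by ring.
    pose proof (pos_INR n).
    replace (Rcpow ((INR n + 2) / (INR n + 1)) (z - 1)) with
      (Rcpow (INR n + 2) (z - 1) / Rcpow (INR n + 1) (z - 1)).
    2:{ unfold Rcpow. rewrite ln_div, RtoC_minus by lra. unfold Cdiv. rewrite <- Cexp_opp, <- Cexp_plus.
        f_equal. ring. }
    replace (z + 1 - 1) with ((z - 1) + 1) by ring. rewrite Rcpow_plus, Rcpow_1, RtoC_plus by lra.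
    field. repeat split; try apply Rcpow_neq_0; try apply INR_S_neq_0. apply INR_fact_neq_0_C.
  - apply Ccvg_eq with (z * rGamma (z + 1) * 1); [ring|]. apply Ccvg_mult.
    { apply Ccvg_mult; [apply Ccvg_const|apply gauss_quot_Cv]. }
    apply Ccvg_eq with (/ (1 + 0)); [field; apply C1_nz|]. apply Ccvg_inv; [|rewrite Cplus_0_r; apply C1_nz].
    apply Ccvg_ext with (fun n => 1 + (Rcpow ((INR n + 2) / (INR n + 1)) (z - 1) - 1)); [intros; ring|].
    apply Ccvg_plus; [apply Ccvg_const|].
    apply Ccvg_0_le with (fun n => (Cmod (z - 1) + 4 * (Cmod (z - 1) * Cmod (z - 1)) * exp (Cmod (z - 1))) * / (INR n + 1))%R.
    + intros n. unfold Rcpow. fold (log_step n). destruct (log_step_bounds n) as [[L1 L2] _].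
      pose proof (Cexp_expansion ((z - 1) * log_step n)) as HE.
      rewrite Cmod_mult, Cmod_R, Rabs_pos_eq in HE by auto.
      pose proof (Cmod_le_add (Cexp ((z - 1) * log_step n) - 1) ((z - 1) * log_step n)) as HA.
      rewrite Cmod_mult, Cmod_R, Rabs_pos_eq in HA by auto.
      pose proof (Cmod_ge_0 (z - 1)) as H0. set (t := Cmod (z - 1)) in *.
      assert (Hx1 : (/ (INR n + 1) <= 1)%R).
      { pose proof (pos_INR n). rewrite <- Rinv_1. apply Rinv_le_contravar; lra. }
      assert (Hx : (0 < / (INR n + 1))%R) by (pose proof (pos_INR n); apply Rinv_0_lt_compat; lra).
      set (x := (/ (INR n + 1))%R) in *.
      assert (He : (exp (t * log_step n) <= exp t)%R).
      { destruct (Req_dec (t * log_step n) t) as [->|]; [lra|]. left. apply exp_increasing. nra. }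
      assert (H1 : (4 * (t * log_step n * (t * log_step n)) * exp (t * log_step n) <= 4 * (t * t) * exp t * x)%R).
      { apply Rle_trans with (4 * (t * t) * x * exp t)%R; [|apply Req_le; ring].
        apply Rmult_le_compat; auto; try (left; apply exp_pos).
        - assert (0 <= t * log_step n)%R by nra. nra.
        - assert (log_step n * log_step n <= x)%R by nra. assert (0 <= t * t)%R by nra.
          replace (t * log_step n * (t * log_step n))%R with (t * t * (log_step n * log_step n))%R by ring.
          rewrite Rmult_assoc, (Rmult_comm 4). nra. }
      rewrite Rmult_plus_distr_r. assert (t * log_step n <= t * x)%R by nra. lra.
    + replace (Finite 0) with (Finite ((Cmod (z - 1) + 4 * (Cmod (z - 1) * Cmod (z - 1)) * exp (Cmod (z - 1))) * 0)%R) by (f_equal; ring).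
      apply is_lim_seq_mult'; [apply is_lim_seq_const|apply is_lim_seq_inv_INR].
Qed.

Lemma not_pole_S (z : C) : not_pole z -> not_pole (z + 1).
Proof. intros H j. specialize (H (S j)). rewrite <- RtoC_INR_S in H. intros E. apply H. rewrite <- E. ring. Qed.

Lemma not_pole_neq_0 (z : C) : not_pole z -> z <> 0.
Proof. intros H. specialize (H O). simpl in H. rewrite Cplus_0_r in H. exact H. Qed.

Lemma Gamma_shift (z : C) : not_pole z -> Gamma (z + 1) = z * Gamma z.
Proof.
  intros Hz. rewrite !Gamma_rGamma by (auto using not_pole_S). rewrite (rGamma_shift z). field. split.
  - apply rGamma_neq_0. now apply not_pole_S.
  - now apply not_pole_neq_0.
Qed.

(** * The digamma function *)

Lemma dig_partial_cvg (z : C) : not_pole z ->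
  exists l, Ccvg (fun n => csum n (fun j => recip z j - log_step j)) l.
Proof.
  intros Hz. destruct (not_pole_inv_bound z Hz) as [K [HK [H1 H2]]].
  destruct (gauss_fac_minus_1 (recip z) K 1 HK H1 H2) as [K2 [HK2 HF]].
  apply (csum_cvg _ (fun j => (K + 1) * inv_sq j)%R ((K + 1) * 2)%R).
  - intros k. destruct (HF 1 k) as [HA _]; [rewrite Cmod_1; lra|]. rewrite Cmod_1, Cmult_1_l in HA. lra.
  - intros n. apply rsum_scal_sq. lra.
Qed.

(** No limit is differentiated: for fixed [h] the quadratic estimate holds for each finite product
    with a constant independent of [n], and it survives the passage to the limit. *)
Lemma rGamma_jet (z l : C) : not_pole z -> Ccvg (fun n => csum n (fun j => recip z j - log_step j)) l ->
  log_jet (fun h => rGamma (z + h)) (rGamma z) l.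
Proof.
  intros Hz Hl. destruct (not_pole_inv_bound z Hz) as [K [HK [H1 H2]]].
  destruct (gauss_fac_minus_1 (recip z) K 1 HK H1 H2) as [K2 [HK2 HF]].
  set (y := recip z) in *.
  set (C1 := (K + 1 + K2 * Rabs 1)%R) in *.
  assert (HC1 : (0 <= C1)%R) by (unfold C1; rewrite Rabs_R1; lra).
  (* The product expansion gives A^2 exp A with A <= 2 [C1] |h|; the quadratic errors of the single
     factors sum to 2 [K2] |h|^2, the 2 bounding the sum of [inv_sq]. *)
  exists (Cmod (rGamma z) * (4 * C1 * C1 * exp (2 * C1) + 2 * K2))%R, 1%R.
  pose proof (exp_pos (2 * C1)) as He.
  split. { apply Rmult_le_pos; [apply Cmod_ge_0|]. assert (0 <= C1 * C1)%R by nra. nra. }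
  split; [lra|]. intros h Hh Hlt.
  (* The last subtracted term tends to 0; it trades [gauss_quot z n] for its limit, so that
     [rGamma z] factors out of the finite expression exactly. *)
  apply (Ccvg_Cmod_le (fun n => gauss_quot (z + h) n - rGamma z - rGamma z * csum n (fun j => y j - log_step j) * h
            - (gauss_quot z n - rGamma z) * cprod n (gauss_fac y h))).
  - apply Ccvg_eq with ((rGamma (z + h) - rGamma z - rGamma z * l * h) - 0); [ring|].
    apply Ccvg_minus.
    + apply Ccvg_minus; [apply Ccvg_minus; [apply gauss_quot_Cv|apply Ccvg_const]|].
      apply Ccvg_mult; [|apply Ccvg_const]. apply Ccvg_mult; [apply Ccvg_const|exact Hl].
    + destruct (cprod_cvg (fun j => gauss_fac y h j - 1) (fun j => C1 * inv_sq j)%R (C1 * 2)%R) as [p Hp].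
      * intros j. eapply Rle_trans; [apply HF; lra|].
        apply Rmult_le_compat_r; [left; apply inv_sq_pos|]. nra.
      * intros n. now apply rsum_scal_sq.
      * apply Ccvg_eq with ((rGamma z - rGamma z) * p); [ring|]. apply Ccvg_mult.
        { apply Ccvg_minus; [apply gauss_quot_Cv|apply Ccvg_const]. }
        refine (Ccvg_ext _ _ _ _ Hp). intros n. now rewrite <- gauss_fac_eq.
  - exists O. intros n _. rewrite gauss_quot_ratio by auto. fold y.
    pose proof (Cmod_ge_0 h) as Hh0. assert (Hh1 : (Cmod h <= 1)%R) by lra. set (t := Cmod h) in *.
    set (P := cprod n (gauss_fac y h)).
    replace (gauss_quot z n * P - rGamma z - rGamma z * csum n (fun j => y j - log_step j) * h - (gauss_quot z n - rGamma z) * P)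
      with (rGamma z * ((P - 1 - csum n (fun j => gauss_fac y h j - 1))
              + (csum n (fun j => gauss_fac y h j - 1 - h * (y j - log_step j))))).
    2:{ replace (csum n (fun j => gauss_fac y h j - 1)) with
          (csum n (fun j => (gauss_fac y h j - 1 - h * (y j - log_step j)) + h * (y j - log_step j)))
          by (apply csum_ext; intros; ring).
        rewrite csum_plus, csum_scal. ring. }
    rewrite Cmod_mult, Rmult_assoc. apply Rmult_le_compat_l; [apply Cmod_ge_0|].
    eapply Rle_trans; [apply Cmod_triangle|]. rewrite Rmult_plus_distr_r. apply Rplus_le_compat.
    + assert (HA : forall j, (Cmod (gauss_fac y h j - 1) <= C1 * t * inv_sq j)%R).
      { intros j. destruct (HF h j Hh1) as [_ [_ HA]]. exact HA. }
      unfold P. rewrite gauss_fac_eq.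
      eapply Rle_trans; [apply (cprod_expansion n (fun j => gauss_fac y h j - 1) _ HA)|].
      assert (H0 : (0 <= C1 * t)%R) by nra.
      pose proof (rsum_scal_sq (C1 * t) n H0) as HS.
      assert (HS0 : (0 <= rsum n (fun j => C1 * t * inv_sq j))%R).
      { apply (rsum_mono 0 n); [lia|]. intros j. pose proof (inv_sq_pos j). nra. }
      set (A := rsum n (fun j => (C1 * t * inv_sq j)%R)) in *.
      eapply Rle_trans; [apply exp_minus_1_id|]. rewrite Rabs_pos_eq by auto.
      assert (Ht : (C1 * t <= C1)%R) by nra.
      assert (HeA : (exp A <= exp (2 * C1))%R).
      { destruct (Req_dec A (2 * C1)) as [->|]; [lra|]. left. apply exp_increasing. nra. }
      replace (4 * C1 * C1 * exp (2 * C1) * (t * t))%R with ((2 * (C1 * t)) * (2 * (C1 * t)) * exp (2 * C1))%R by ring.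
      apply Rmult_le_compat; auto; try (left; apply exp_pos); nra.
    + eapply Rle_trans; [apply Cmod_csum_le with (b := fun j => (K2 * (t * t) * inv_sq j)%R)|].
      * intros j _. destruct (HF h j Hh1) as [_ [HB _]]. exact HB.
      * eapply Rle_trans; [apply rsum_scal_sq; nra|]. lra.
Qed.

Lemma is_lim_C_derive (f : C -> C) (z a : C) : jet (fun h => f (z + h)) (f z) a -> C_derive f z = a.
Proof.
  intros [M [d [HM [Hd H]]]]. apply is_C_lim_unique. intros P [eps HP].
  assert (Hq : (0 < Rmin d (eps / (M + 1)))%R).
  { apply Rmin_glb_lt; [tauto|]. apply Rdiv_lt_0_compat; [apply eps|lra]. }
  (* Balls in [C] are squares; halving the radius bounds the modulus by the sum of the two
     coordinates. *)
  assert (Hq2 : (0 < Rmin d (eps / (M + 1)) / 2)%R) by lra.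
  exists (mkposreal _ Hq2). intros x. change C in x. intros Hx Hne. apply HP.
  apply C_NormedModule_mixin_compat1. change (Cmod ((f x - f z) / (x - z) - a) < eps)%R.
  assert (Hlt : (Cmod (x - z) < Rmin d (eps / (M + 1)))%R).
  { destruct Hx as [Hx1 Hx2]. simpl in Hx1, Hx2.
    eapply Rle_lt_trans; [apply Cmod_le_ReIm|].
    change (Rabs (fst x - fst z) < Rmin d (eps / (M + 1)) / 2)%R in Hx1.
    change (Rabs (snd x - snd z) < Rmin d (eps / (M + 1)) / 2)%R in Hx2.
    assert (E1 : Re (x - z) = (fst x - fst z)%R) by reflexivity.
    assert (E2 : Im (x - z) = (snd x - snd z)%R) by reflexivity. rewrite E1, E2. lra. }
  pose proof (Rmin_l d (eps / (M + 1))). pose proof (Rmin_r d (eps / (M + 1))).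
  assert (Hh : x - z <> 0) by now apply Cminus_eq_contra.
  specialize (H (x - z) Hh ltac:(lra)). replace (z + (x - z)) with x in H by ring.
  replace ((f x - f z) / (x - z) - a) with ((f x - f z - a * (x - z)) / (x - z)) by (field; auto).
  rewrite Cmod_div by auto. pose proof (proj1 (Cmod_gt_0 _) Hh) as Hp. set (t := Cmod (x - z)) in *.
  apply Rle_lt_trans with (M * t)%R.
  - apply Rmult_le_reg_r with t; auto. unfold Rdiv. rewrite Rmult_assoc, Rinv_l by lra. lra.
  - assert (Ht : (t < eps / (M + 1))%R) by lra.
    apply Rmult_lt_compat_r with (r := (M + 1)%R) in Ht; [|lra].
    replace (eps / (M + 1) * (M + 1))%R with (pos eps) in Ht by (field; lra). lra.
Qed.

(** The logarithmic derivative of Gamma = 1/[rGamma] is the negative of that of [rGamma]. *)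
Lemma digamma_series (z l : C) : not_pole z -> Ccvg (fun n => csum n (fun j => recip z j - log_step j)) l ->
  digamma z = - l.
Proof.
  intros Hz Hl. pose proof (rGamma_jet z l Hz Hl) as HJ.
  pose proof (rGamma_neq_0 z Hz) as Hn.
  assert (HG : jet (fun h => Gamma (z + h)) (Gamma z) (Gamma z * - l)).
  { rewrite (Gamma_rGamma z) by auto.
    apply jet_ext with (2 := log_jet_inv _ _ _ HJ Hn).
    (* Near [z] the function [rGamma] does not vanish, so there are no poles of Gamma there and
       [Gamma] really is its reciprocal. *)
    destruct (jet_near _ _ _ HJ Hn) as [d [Hd H]]. exists d. split; auto.
    intros h Hh Hlt. specialize (H h Hh Hlt). symmetry. apply Gamma_rGamma. apply rGamma_neq_0_np.
    intros E. rewrite E, Cmod_0 in H. apply Cmod_gt_0 in Hn. lra. }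
  unfold digamma. rewrite (is_lim_C_derive _ _ _ HG).
  assert (Gamma z <> 0).
  { rewrite Gamma_rGamma by auto. intros E. apply C1_nz. rewrite <- (Cinv_l _ Hn), E. ring. }
  field. auto.
Qed.

(** Tends to -psi(z); the logarithm keeps the harmonic-type sum bounded. *)
Definition dig_partial (z : C) (n : nat) : C := csum n (recip z) - ln (INR n + 1).

Lemma digamma_Cv (z : C) : not_pole z -> Ccvg (dig_partial z) (- digamma z).
Proof.
  intros Hz. destruct (dig_partial_cvg z Hz) as [l Hl].
  rewrite (digamma_series z l Hz Hl). apply Ccvg_eq with l; [ring|].
  refine (Ccvg_ext _ _ _ _ Hl). intros n. unfold dig_partial. rewrite <- rsum_lam.
  clear Hl. induction n as [|n IH]; simpl; [ring|]. rewrite IH, RtoC_plus. ring.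
Qed.

Lemma digamma_shift (z : C) : not_pole z -> digamma (z + 1) = digamma z + / z.
Proof.
  intros Hz.
  assert (E : - digamma (z + 1) = - digamma z - / z + 0).
  { apply (Ccvg_unique (dig_partial (z + 1))); [apply digamma_Cv; now apply not_pole_S|].
    apply Ccvg_ext with (fun n => dig_partial z n - / z + recip z n).
    - intros n. unfold dig_partial.
      assert (E : csum n (recip (z + 1)) = csum (S n) (recip z) - / z).
      { rewrite csum_S_l. rewrite (csum_ext n _ (fun k => recip z (S k))).
        { unfold recip at 2. simpl (INR 0). rewrite Cplus_0_r. ring. }
        intros k _. unfold recip. rewrite <- RtoC_INR_S. f_equal. ring. }
      rewrite E. simpl. ring.
    - apply Ccvg_plus; [apply Ccvg_minus; [now apply digamma_Cv|apply Ccvg_const]|].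
      destruct (not_pole_inv_bound z Hz) as [K [HK [H1 _]]]. apply (Ccvg_0_le _ _ H1).
      replace 0%R with (K * 0)%R by ring.
      apply is_lim_seq_mult'; [apply is_lim_seq_const|apply is_lim_seq_inv_INR]. }
  replace (digamma (z + 1)) with (- - digamma (z + 1)) by ring. rewrite E. ring.
Qed.

Lemma not_pole_plus (z : C) (k : nat) : not_pole z -> not_pole (z + INR k).
Proof.
  intros H j. rewrite <- Cplus_assoc, <- RtoC_plus, <- plus_INR. apply H.
Qed.

Lemma digamma_plus (z : C) (k : nat) : not_pole z ->
  digamma (z + INR k) = digamma z + csum k (recip z).
Proof.
  intros Hz. induction k as [|k IH].
  - simpl. rewrite !Cplus_0_r. reflexivity.
  - rewrite <- RtoC_INR_S. replace (z + (INR k + 1)) with ((z + INR k) + 1) by ring.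
    rewrite digamma_shift by now apply not_pole_plus. rewrite IH. simpl. unfold recip. ring.
Qed.

(** * The cotangent reflection formula for the digamma function *)

(** In q = exp(2 i w) the cotangent is the rational function i (q + 1)/(q - 1), and a shift by half
    a period is q -> -q. *)
Definition Cexp2i (w : C) : C := Cexp (2 * Ci * w).

Lemma Cexp_iPI : Cexp (Ci * PI) = - (1).
Proof.
  unfold Cexp. replace (Re (Ci * PI)) with 0%R by (unfold Ci, Re; simpl; ring).
  replace (Im (Ci * PI)) with PI by (unfold Ci, Im; simpl; ring).
  rewrite exp_0, cos_PI, sin_PI. unfold RtoC, Copp. simpl. f_equal; ring.
Qed.

Lemma two_neq_0 : RtoC 2 <> 0.
Proof. intros E. apply RtoC_inj in E. lra. Qed.

Lemma Cexp2i_half_period (w : C) : Cexp2i (w + PI / 2) = - Cexp2i w.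
Proof.
  unfold Cexp2i. replace (2 * Ci * (w + PI / 2)) with (2 * Ci * w + Ci * PI) by field.
  rewrite Cexp_plus, Cexp_iPI. ring.
Qed.

Lemma Cexp2i_half_period' (w : C) : Cexp2i (w - PI / 2) = - Cexp2i w.
Proof.
  replace w with ((w - PI / 2) + PI / 2) at 2 by ring. rewrite Cexp2i_half_period. ring.
Qed.

Lemma Ccot_Qe (w : C) : Cexp2i w <> 1 -> Ccot w = Ci * (Cexp2i w + 1) / (Cexp2i w - 1).
Proof.
  intros H. unfold Ccot, Ccos, Csin. rewrite Cexp_opp.
  assert (HQ : Cexp2i w = Cexp (Ci * w) * Cexp (Ci * w)) by (unfold Cexp2i; rewrite <- Cexp_plus; f_equal; ring).
  rewrite HQ in *. pose proof (Cexp_neq_0 (Ci * w)) as He. set (e := Cexp (Ci * w)) in *.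
  assert (H1 : e * e - 1 <> 0) by now apply Cminus_eq_contra.
  field. repeat split; auto using Ci_nz, two_neq_0.
Qed.

(** The hypothesis on [w'] mentions only its exponential, so that [w'] may be w/2 + pi/2 as well as
    w/2 - pi/2. *)
Lemma Ccot_double (w w' : C) : Cexp2i w' = - Cexp2i (w / 2) -> Cexp2i w <> 1 ->
  Ccot w = (Ccot (w / 2) + Ccot w') / 2.
Proof.
  intros E H. assert (HQ : Cexp2i w = Cexp2i (w / 2) * Cexp2i (w / 2)).
  { unfold Cexp2i. rewrite <- Cexp_plus. f_equal. field. }
  assert (H1 : Cexp2i (w / 2) - 1 <> 0).
  { apply Cminus_eq_contra. intros E1. apply H. rewrite HQ, E1. ring. }
  assert (H2 : Cexp2i (w / 2) + 1 <> 0).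
  { intros E1. apply H. replace (Cexp2i (w / 2)) with ((Cexp2i (w / 2) + 1) - 1) in HQ by ring.
    rewrite HQ, E1. ring. }
  rewrite !Ccot_Qe; auto.
  - rewrite E, HQ. set (q := Cexp2i (w / 2)) in *. field. repeat split; auto using two_neq_0.
    + replace (- q - 1) with (- (q + 1)) by ring. intros E1. apply H2.
      replace (q + 1) with (- - (q + 1)) by ring. rewrite E1. ring.
    + replace (q * q - 1) with ((q - 1) * (q + 1)) by ring. now apply Cmult_neq_0.
  - rewrite E. intros E1. apply H2. replace (Cexp2i (w / 2)) with (- - Cexp2i (w / 2)) by ring. rewrite E1. ring.
  - intros E1. apply H1. rewrite E1. ring.
Qed.

(** With x = Re z and y = Im z, |exp z - 1|^2 = (exp x - 1)^2 + 4 exp x sin(y/2)^2. *)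
Lemma Cmod_Cexp_minus_1 (z : C) :
  (2 * exp (Re z / 2) * Rabs (sin (Im z / 2)) <= Cmod (Cexp z - 1))%R.
Proof.
  set (s := sin (Im z / 2)).
  apply Rsqr_incr_0_var; [|apply Cmod_ge_0].
  assert (E : (Rsqr (Cmod (Cexp z - 1)) = Re (Cexp z - 1) ^ 2 + Im (Cexp z - 1) ^ 2)%R).
  { rewrite <- Cmod2_alt. unfold Rsqr. ring. }
  rewrite E. unfold Cexp, Re at 2, Im at 2. simpl.
  set (x := exp (Re z)).
  assert (Hx : (exp (Re z / 2) * exp (Re z / 2) = x)%R).
  { rewrite <- exp_plus. unfold x. f_equal. field. }
  pose proof (one_minus_cos (Im z)) as Hc. fold s in Hc.
  pose proof (sin2_cos2 (Im z)) as Hsc. unfold Rsqr in *.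
  assert (Hs : (Rabs s * Rabs s = s * s)%R) by (rewrite <- Rabs_mult, Rabs_pos_eq; nra).
  replace (2 * exp (Re z / 2) * Rabs s * (2 * exp (Re z / 2) * Rabs s))%R with
    (4 * (exp (Re z / 2) * exp (Re z / 2)) * (Rabs s * Rabs s))%R by ring.
  rewrite Hx, Hs.
  replace (4 * x * (s * s))%R with (2 * x * (2 * (s * s)))%R by ring. rewrite <- Hc.
  set (cs := cos (Im z)) in *. set (sn := sin (Im z)) in *.
  assert (Hsn : (sn * sn = 1 - cs * cs)%R) by lra.
  change (Re z) with (fst z) in *. fold x.
  replace ((x * cs + - (1)) * ((x * cs + - (1)) * 1) + (x * sn + - 0) * ((x * sn + - 0) * 1))%R
    with (x * x * (cs * cs) - 2 * x * cs + 1 + x * x * (sn * sn))%R by ring.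
  rewrite Hsn. pose proof (Rle_0_sqr (x - 1)) as Hsq. unfold Rsqr in Hsq. nra.
Qed.

(** The modulus forces Im w = 0, and then the lower bound for |exp z - 1| forces sin(Re w) = 0. *)
Lemma Cexp2i_neq_1 (w : C) : Cexp2i w = 1 -> exists k : Z, w = RtoC (IZR k * PI).
Proof.
  intros H. assert (Hm : Cmod (Cexp2i w) = 1%R) by (rewrite H; apply Cmod_1).
  unfold Cexp2i in *. rewrite Cmod_Cexp in Hm.
  assert (ER : Re (2 * Ci * w) = (- 2 * Im w)%R) by (unfold Re, Im, Ci; simpl; ring).
  assert (EI : Im (2 * Ci * w) = (2 * Re w)%R) by (unfold Re, Im, Ci; simpl; ring).
  rewrite ER in Hm. rewrite <- exp_0 in Hm. apply exp_inv in Hm.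
  pose proof (Cmod_Cexp_minus_1 (2 * Ci * w)) as Hb. rewrite H in Hb.
  replace (1 - 1) with (RtoC 0) in Hb by ring. rewrite Cmod_0, EI in Hb.
  replace (2 * Re w / 2)%R with (Re w) in Hb by field.
  assert (Hs : sin (Re w) = 0%R).
  { destruct (Req_dec (sin (Re w)) 0) as [|Hne]; auto. exfalso.
    apply Rabs_pos_lt in Hne. pose proof (exp_pos (Re (2 * Ci * w) / 2)). nra. }
  destruct (sin_eq_0_0 _ Hs) as [k Hk]. exists k. rewrite <- Hk.
  apply injective_projections; unfold Re, Im in *; simpl; lra.
Qed.

(** A crude Jordan inequality: q = u/4 is at most 1/2, where the elementary bounds are good, and sin
    u = 4 sin q cos q cos 2q. Any positive constant would serve. *)
Lemma sin_lower (u : R) : (0 <= u <= PI / 2)%R -> (u / 32 <= sin u)%R.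
Proof.
  intros Hu. pose proof PI_4 as HP. set (q := (u / 4)%R).
  assert (Hq : (0 <= q <= 1 / 2)%R) by (unfold q; lra).
  pose proof (sin_minus_id_le q) as H1. rewrite (Rabs_pos_eq q) in H1 by lra.
  destruct (one_minus_cos_le q) as [_ H2]. rewrite (Rabs_pos_eq q) in H2 by lra.
  pose proof (Rmin_r q (q * q)) as H3.
  apply Rabs_le_between in H1.
  assert (Hs : (q / 2 <= sin q)%R) by nra.
  assert (Hc : (3 / 4 <= cos q)%R) by nra.
  assert (Hc2 : (1 / 8 <= cos (2 * q))%R) by (rewrite cos_2a_cos; nra).
  assert (E : (sin u = 4 * (sin q * cos q * cos (2 * q)))%R).
  { replace u with (2 * (2 * q))%R by (unfold q; field). rewrite sin_2a, sin_2a. ring. }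
  rewrite E. assert (0 <= sin q)%R by lra.
  assert (A1 : (q / 2 * (3 / 4) <= sin q * cos q)%R) by (apply Rmult_le_compat; lra).
  assert (A2 : (q / 2 * (3 / 4) * (1 / 8) <= sin q * cos q * cos (2 * q))%R).
  { apply Rmult_le_compat; try lra. }
  unfold q in *. lra.
Qed.

Lemma Rabs_sin_lower (u : R) : (Rabs u <= PI / 2)%R -> (Rabs u / 32 <= Rabs (sin u))%R.
Proof.
  intros Hu. destruct (Rle_dec 0 u) as [H|H].
  - rewrite (Rabs_pos_eq u) in * by auto. eapply Rle_trans; [apply sin_lower; lra|apply Rle_abs].
  - rewrite (Rabs_left u) in * by lra. rewrite <- (Rabs_Ropp (sin u)), <- sin_neg.
    eapply Rle_trans; [apply sin_lower; lra|apply Rle_abs].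
Qed.

Definition scot (a : R) (y : C) : C := a * Ccot (a * y).

Lemma notZ_Qe (a : R) (y : C) (n : nat) : (0 < n)%nat -> a = (PI / INR n)%R -> notZ y -> Cexp2i (a * y) <> 1.
Proof.
  intros Hn -> Hy E. destruct (Cexp2i_neq_1 _ E) as [k Hk]. apply (Hy (k * Z.of_nat n)%Z).
  rewrite mult_IZR, <- INR_IZR_INZ. apply lt_0_INR in Hn. pose proof PI_RGT_0.
  assert (Hp : RtoC (PI / INR n) <> 0).
  { intros E1. apply RtoC_inj in E1. assert (0 < PI / INR n)%R by (apply Rdiv_lt_0_compat; lra). lra. }
  replace y with (/ RtoC (PI / INR n) * (RtoC (PI / INR n) * y)) by (field; auto).
  rewrite Hk, <- RtoC_inv, <- RtoC_mult by (apply Rgt_not_eq; apply Rdiv_lt_0_compat; lra).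
  f_equal. field. lra.
Qed.

Lemma scot_double (n : nat) (y y' : C) : (0 < n)%nat -> notZ y ->
  y' = y - INR n \/ y' = y + INR n ->
  scot (PI / INR n) y = scot (PI / INR (2 * n)) y + scot (PI / INR (2 * n)) y'.
Proof.
  intros Hn Hy Hy'. pose proof (notZ_Qe _ y n Hn eq_refl Hy) as HQ. unfold scot.
  assert (Hn' : RtoC (INR n) <> 0). { intros E. apply RtoC_inj in E. apply lt_0_INR in Hn. lra. }
  assert (Hn2 : INR n <> 0%R) by (apply lt_0_INR in Hn; lra).
  assert (Ea : RtoC (PI / INR (2 * n)) = RtoC (PI / INR n) / 2).
  { rewrite mult_INR. simpl (INR 2). rewrite <- RtoC_div by lra. f_equal. field. auto. }
  rewrite Ea. rewrite (Ccot_double (RtoC (PI / INR n) * y) (RtoC (PI / INR n) / 2 * y')); auto.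
  - replace (RtoC (PI / INR n) * y / 2) with (RtoC (PI / INR n) / 2 * y) by field.
    field.
  - destruct Hy' as [-> | ->].
    + rewrite <- Cexp2i_half_period'. f_equal. rewrite RtoC_div by auto. field; auto.
    + rewrite <- Cexp2i_half_period. f_equal. rewrite RtoC_div by auto. field; auto.
Qed.

(** The arguments x + r and x - 1 - r are exchanged, up to sign, by x -> 1 - x; paired in this way
    the terms decay like 1/r^2. *)
Definition pcot (x : C) (M r : nat) : C :=
  scot (PI / INR (2 * M)) (x + INR r) + scot (PI / INR (2 * M)) (x - 1 - INR r).

Lemma notZ_plus_Z (x : C) (k : Z) : notZ x -> notZ (x + IZR k).
Proof.
  intros H j E. apply (H (j - k)%Z). rewrite minus_IZR, RtoC_minus, <- E. ring.
Qed.

Lemma notZ_plus_INR (x : C) (k : nat) : notZ x -> notZ (x + INR k).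
Proof. intros H. rewrite INR_IZR_INZ. now apply notZ_plus_Z. Qed.

Lemma notZ_opp (x : C) : notZ x -> notZ (- x).
Proof.
  intros H j E. apply (H (- j)%Z). rewrite opp_IZR, RtoC_opp, <- E. ring.
Qed.

Lemma notZ_minus_INR (x : C) (k : nat) : notZ x -> notZ (x - INR k).
Proof.
  intros H. unfold Cminus. rewrite INR_IZR_INZ, <- RtoC_opp, <- opp_IZR. now apply notZ_plus_Z.
Qed.

Lemma notZ_one_minus (x : C) : notZ x -> notZ (1 - x).
Proof.
  intros H. replace (1 - x) with (- x + IZR 1) by ring. apply notZ_plus_Z. now apply notZ_opp.
Qed.

Lemma notZ_np (x : C) : notZ x -> not_pole x.
Proof.
  intros H j E. apply (H (- Z.of_nat j)%Z). rewrite opp_IZR, <- INR_IZR_INZ, RtoC_opp.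
  replace x with (x + INR j - INR j) by ring. rewrite E. ring.
Qed.

Lemma pcot_double (x : C) (M : nat) : (0 < M)%nat -> notZ x ->
  csum (2 * M) (pcot x (2 * M)) = csum M (pcot x M).
Proof.
  intros HM Hx. replace (2 * M)%nat with (M + M)%nat at 1 by lia.
  rewrite csum_app, (csum_rev M (fun j => pcot x (2 * M) (M + j))), <- csum_plus.
  apply csum_ext. intros r Hr. unfold pcot.
  (* Halving sends the argument x + r to itself and to x + r - 2M = x - 1 - (2M - 1 - r): the new
     summands are those of index 2M - 1 - r in the upper half, which is why that half was
     reversed. *)
  rewrite (scot_double (2 * M) (x + INR r) (x - 1 - INR (M + (M - 1 - r)))); [|lia|now apply notZ_plus_INR|].
  2:{ left. replace (2 * M)%nat with (M + (M - 1 - r) + 1 + r)%nat by lia. rewrite !plus_INR, !RtoC_plus.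
      simpl (INR 1). ring. }
  rewrite (scot_double (2 * M) (x - 1 - INR r) (x + INR (M + (M - 1 - r)))); [ring|lia| |].
  - apply notZ_minus_INR. replace (x - 1) with (x - INR 1) by reflexivity. now apply notZ_minus_INR.
  - right. replace (2 * M)%nat with (M + (M - 1 - r) + 1 + r)%nat by lia. rewrite !plus_INR, !RtoC_plus.
    simpl (INR 1). ring.
Qed.

(* Euler's route to the partial fractions of the cotangent: [2^t] terms obtained by repeated halving. *)
Lemma pcot_sum (x : C) (t : nat) : notZ x -> csum (2 ^ t) (pcot x (2 ^ t)) = PI * Ccot (PI * x).
Proof.
  intros Hx. induction t as [|t IH].
  - simpl. rewrite Cplus_0_l. unfold pcot.
    rewrite <- (scot_double 1 (x + INR 0) (x - 1 - INR 0)).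
    + unfold scot. simpl. rewrite Rdiv_1_r. rewrite Cplus_0_r. reflexivity.
    + lia.
    + now apply notZ_plus_INR.
    + left. simpl. ring.
  - change (2 ^ S t)%nat with (2 * 2 ^ t)%nat. rewrite pcot_double, IH; auto.
    apply Nat.neq_0_lt_0. apply Nat.pow_nonzero. lia.
Qed.

Lemma Ccvg_Cexp_diff (w : nat -> C) : Ccvg w 0 -> (forall n, w n <> 0) ->
  Ccvg (fun n => (Cexp (w n) - 1) / w n) 1.
Proof.
  intros Hw Hn. apply lim0_le_loc with (fun n => 4 * exp 1 * Cmod (w n - 0))%R.
  - destruct (Ccvg_eps _ _ Hw 1 ltac:(lra)) as [N HN]. exists N. intros n Hge. specialize (HN n Hge).
    split; [apply Cmod_ge_0|]. replace (w n - 0) with (w n) in * by ring.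
    replace ((Cexp (w n) - 1) / w n - 1) with ((Cexp (w n) - 1 - w n) / w n) by (field; auto).
    rewrite Cmod_div by auto. pose proof (proj1 (Cmod_gt_0 _) (Hn n)) as Hp.
    apply Rmult_le_reg_r with (Cmod (w n)); auto. unfold Rdiv. rewrite Rmult_assoc, Rinv_l by lra.
    rewrite Rmult_1_r. eapply Rle_trans; [apply Cexp_expansion|].
    assert (exp (Cmod (w n)) <= exp 1)%R by (left; now apply exp_increasing).
    apply Rle_trans with (4 * (Cmod (w n) * Cmod (w n)) * exp 1)%R; [|apply Req_le; ring].
    apply Rmult_le_compat_l; auto. nra.
  - replace (Finite 0) with (Finite (4 * exp 1 * 0)) by (f_equal; ring).
    apply is_lim_seq_mult'; [apply is_lim_seq_const|exact Hw].
Qed.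

Lemma pow2_pos (t : nat) : (0 < 2 ^ t)%nat.
Proof. apply Nat.neq_0_lt_0. apply Nat.pow_nonzero. lia. Qed.

Lemma pow2_gt (t : nat) : (t < 2 ^ t)%nat.
Proof. induction t as [|t IH]; simpl; lia. Qed.

Lemma scale_cvg : is_lim_seq (fun t => PI / INR (2 * 2 ^ t))%R 0.
Proof.
  apply lim0_le with (fun t => PI * / (INR t + 1))%R.
  - intros t. pose proof PI_RGT_0. pose proof (pow2_gt t) as Ht. pose proof (pow2_pos t).
    assert (Hi : (INR t + 1 <= INR (2 * 2 ^ t))%R).
    { rewrite <- S_INR. apply le_INR. lia. }
    pose proof (pos_INR t). split.
    + left. apply Rdiv_lt_0_compat; lra.
    + apply Rmult_le_compat_l; [lra|]. apply Rinv_le_contravar; lra.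
  - replace 0%R with (PI * 0)%R by ring. apply is_lim_seq_mult'; [apply is_lim_seq_const|apply is_lim_seq_inv_INR].
Qed.

Lemma scale_pos (t : nat) : (0 < PI / INR (2 * 2 ^ t))%R.
Proof.
  apply Rdiv_lt_0_compat; [apply PI_RGT_0|]. apply lt_0_INR. pose proof (pow2_pos t). lia.
Qed.

Lemma scot_cvg (y : C) : notZ y -> Ccvg (fun t => scot (PI / INR (2 * 2 ^ t)) y) (/ y).
Proof.
  intros Hy. assert (Hy0 : y <> 0) by (intros ->; now apply (Hy 0%Z)).
  set (w := fun t => 2 * Ci * (RtoC (PI / INR (2 * 2 ^ t)) * y)).
  assert (Hw : Ccvg w 0).
  { unfold w. apply Ccvg_eq with (2 * Ci * (0 * y)); [ring|]. apply Ccvg_mult; [apply Ccvg_const|].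
    apply Ccvg_mult; [|apply Ccvg_const]. apply Ccvg_RtoC. apply scale_cvg. }
  assert (Ha0 : forall t, RtoC (PI / INR (2 * 2 ^ t)) <> 0).
  { intros t E. apply RtoC_inj in E. pose proof (scale_pos t). lra. }
  assert (Hw0 : forall t, w t <> 0).
  { intros t. unfold w. repeat apply Cmult_neq_0; auto using two_neq_0, Ci_nz. }
  pose proof (Ccvg_Cexp_diff w Hw Hw0) as Hd.
  assert (Hn1 : forall t, Cexp (w t) - 1 <> 0).
  { intros t. apply Cminus_eq_contra. apply (notZ_Qe _ y (2 * 2 ^ t)); auto. pose proof (pow2_pos t). lia. }
  (* With D = (exp w - 1)/w and w = 2 i a y, a cot(a y) = (1 + w D/2)/(y D), where D tends to 1. *)
  apply Ccvg_ext with (fun t => (1 + (w t * ((Cexp (w t) - 1) / w t)) / 2) * / y * / ((Cexp (w t) - 1) / w t)).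
  - intros t. unfold scot. rewrite Ccot_Qe by (intros E; apply (Hn1 t); unfold Cexp2i in E; fold (w t) in E; rewrite E; ring).
    unfold Cexp2i. fold (w t). specialize (Hn1 t). specialize (Hw0 t). specialize (Ha0 t).
    set (e := Cexp (w t)) in *. set (a := RtoC (PI / INR (2 * 2 ^ t))) in *.
    replace (w t) with (2 * Ci * (a * y)) by reflexivity.
    field. repeat split; auto using two_neq_0, Ci_nz.
  - apply Ccvg_eq with ((1 + (0 * 1) / 2) * / y * / 1); [field; auto|].
    apply Ccvg_mult; [|apply Ccvg_inv; auto using C1_nz].
    apply Ccvg_mult; [|apply Ccvg_const]. apply Ccvg_plus; [apply Ccvg_const|].
    apply Ccvg_mult; [|apply Ccvg_const]. now apply Ccvg_mult.
Qed.

(** On a common denominator the index [r] drops out of the numerator, which is O(a^2) together with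
    the prefactor [a]. Each denominator is at least a constant times a r, since for 0 <= Re x <= 1
    the arguments stay where the sine is bounded below linearly. So [a] cancels and 1/r^2 is left.
    For r = 0 this lower bound is empty. *)
Lemma pcot_bound (x : C) : notZ x -> (0 <= Re x <= 1)%R -> exists K, (0 <= K)%R /\
  forall t r, (1 <= r < 2 ^ t)%nat -> (Cmod (pcot x (2 ^ t) r) <= K * inv_sq r)%R.
Proof.
  intros Hx Hre.
  set (b := (4 * Cmod (2 * x - 1))%R).
  set (K1 := (1 + 4 * (2 * b) * exp (2 * b))%R).
  set (ei := exp (4 * Rabs (Im x))).
  assert (Hb : (0 <= b)%R) by (unfold b; pose proof (Cmod_ge_0 (2 * x - 1)); lra).
  assert (HK1 : (1 <= K1)%R) by (unfold K1; pose proof (exp_pos (2 * b)); nra).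
  assert (Hei : (0 < ei)%R) by apply exp_pos.
  assert (Hbk : (0 <= b * K1)%R) by (apply Rmult_le_pos; lra).
  assert (Hbke : (0 <= b * K1 * ei)%R) by (apply Rmult_le_pos; lra).
  (* 512 is 2 * 16^2 from the two lower bounds [L], [ei] undoes their factors exp(-2 |Im x|), and 4
     passes from 1/r^2 to 4/(r + 1)^2. *)
  exists (b * K1 * 512 * ei * 4)%R. split.
  { lra. }
  intros t r [Hr1 Hr2].
  pose proof (scale_pos t) as Ha. set (M := (2 ^ t)%nat) in *.
  assert (HMpos : (0 < M)%nat) by apply pow2_pos.
  set (a := (PI / INR (2 * M))%R) in *.
  assert (HaM : (a * INR M = PI / 2)%R).
  { unfold a. rewrite mult_INR. simpl (INR 2). field. apply Rgt_not_eq. now apply lt_0_INR. }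
  assert (HM1 : (1 <= INR M)%R) by (apply (le_INR 1); lia).
  pose proof PI_4 as HPI. pose proof PI_RGT_0 as HPI0.
  assert (Ha2 : (a <= 2)%R) by nra.
  assert (Hr : (1 <= INR r)%R) by (apply (le_INR 1); lia).
  assert (HrM : (INR r + 1 <= INR M)%R) by (rewrite <- S_INR; apply le_INR; lia).
  set (A := x + INR r). set (B := x - 1 - INR r).
  assert (HA : notZ A) by now apply notZ_plus_INR.
  assert (HB : notZ B). { apply notZ_minus_INR. replace (x - 1) with (x - INR 1) by reflexivity. now apply notZ_minus_INR. }
  assert (QA : Cexp2i (a * A) <> 1) by (apply (notZ_Qe _ _ (2 * M)); auto; lia).
  assert (QB : Cexp2i (a * B) <> 1) by (apply (notZ_Qe _ _ (2 * M)); auto; lia).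
  assert (low : forall u : C, Im u = Im x -> (Rabs (a * Re u) <= PI / 2)%R -> (INR r <= Rabs (Re u))%R ->
           (2 * exp (- (2 * Rabs (Im x))) * (a * INR r / 32) <= Cmod (Cexp2i (a * u) - 1))%R).
  { intros u Hu1 Hu2 Hu3. unfold Cexp2i. eapply Rle_trans; [|apply Cmod_Cexp_minus_1].
    assert (ER : (Re (2 * Ci * (a * u)) / 2 = - (a * Im x))%R) by (rewrite <- Hu1; unfold Re, Im, Ci; simpl; field).
    assert (EI : (Im (2 * Ci * (a * u)) / 2 = a * Re u)%R) by (unfold Re, Im, Ci; simpl; field).
    rewrite ER, EI.
    apply Rmult_le_compat.
    - pose proof (exp_pos (- (2 * Rabs (Im x)))). lra.
    - assert (0 <= a * INR r)%R by nra. lra.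
    - apply Rmult_le_compat_l; [lra|].
      assert (Hle : (- (2 * Rabs (Im x)) <= - (a * Im x))%R).
      { pose proof (Rle_abs (Im x)). pose proof (Rabs_pos (Im x)). nra. }
      destruct Hle as [Hlt| ->]; [left; now apply exp_increasing|lra].
    - eapply Rle_trans; [|apply Rabs_sin_lower; auto]. rewrite Rabs_mult, (Rabs_pos_eq a) by lra.
      assert (a * INR r <= a * Rabs (Re u))%R by (apply Rmult_le_compat_l; lra). lra. }
  assert (EA : Re A = (Re x + INR r)%R) by (unfold A, Re; simpl; ring).
  assert (EB : Re B = (Re x - 1 - INR r)%R) by (unfold B, Re; simpl; ring).
  assert (LA := low A). assert (LB := low B). clear low.
  rewrite EA in LA. rewrite EB in LB.
  specialize (LA ltac:(unfold A, Im; simpl; ring)). specialize (LB ltac:(unfold B, Im; simpl; ring)).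
  rewrite (Rabs_pos_eq (Re x + INR r)), Rabs_pos_eq in LA by nra. specialize (LA ltac:(nra) ltac:(lra)).
  rewrite Rabs_mult, (Rabs_pos_eq a), (Rabs_left (Re x - 1 - INR r)) in LB by lra.
  specialize (LB ltac:(nra) ltac:(lra)).
  unfold pcot, scot. fold a A B. rewrite !Ccot_Qe by auto.
  assert (HPA : Cexp2i (a * A) - 1 <> 0) by now apply Cminus_eq_contra.
  assert (HPB : Cexp2i (a * B) - 1 <> 0) by now apply Cminus_eq_contra.
  replace (a * (Ci * (Cexp2i (a * A) + 1) / (Cexp2i (a * A) - 1)) + a * (Ci * (Cexp2i (a * B) + 1) / (Cexp2i (a * B) - 1)))
    with (a * (Ci * (2 * (Cexp2i (a * A) * Cexp2i (a * B) - 1))) / ((Cexp2i (a * A) - 1) * (Cexp2i (a * B) - 1)))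
    by (field; auto).
  assert (EQ : Cexp2i (a * A) * Cexp2i (a * B) = Cexp (2 * Ci * (a * (2 * x - 1)))).
  { unfold Cexp2i. rewrite <- Cexp_plus. f_equal. unfold A, B. ring. }
  rewrite EQ. set (w := 2 * Ci * (a * (2 * x - 1))).
  assert (Hw : Cmod w = (a * (b / 2))%R).
  { unfold w, b. rewrite !Cmod_mult, Cmod_Ci, !Cmod_R, (Rabs_pos_eq a), (Rabs_pos_eq 2) by lra. field. }
  assert (HwU : (Cmod (Cexp w - 1) <= a * b * K1)%R).
  { eapply Rle_trans; [apply (Cmod_le_add _ w)|]. pose proof (Cexp_expansion w) as HE.
    assert (Hwb : (Cmod w <= 2 * b)%R) by (rewrite Hw; nra).
    assert (He : (exp (Cmod w) <= exp (2 * b))%R) by (destruct Hwb as [?| ->]; [left; now apply exp_increasing|lra]).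
    assert (H4 : (4 * (Cmod w * Cmod w) * exp (Cmod w) <= 4 * (2 * b) * exp (2 * b) * (a * b))%R).
    { apply Rle_trans with (4 * (Cmod w * Cmod w) * exp (2 * b))%R.
      - apply Rmult_le_compat_l; auto. pose proof (Cmod_ge_0 w). nra.
      - replace (4 * (2 * b) * exp (2 * b) * (a * b))%R with (4 * (2 * b * (a * b)) * exp (2 * b))%R by ring.
        apply Rmult_le_compat_r; [left; apply exp_pos|]. pose proof (Cmod_ge_0 w).
        assert (Cmod w <= a * b)%R by (rewrite Hw; nra).
        assert (Cmod w * Cmod w <= 2 * b * (a * b))%R by (apply Rmult_le_compat; auto). lra. }
    replace (a * b * K1)%R with (a * b + 4 * (2 * b) * exp (2 * b) * (a * b))%R by (unfold K1; ring).
    assert (Cmod w <= a * b)%R by (rewrite Hw; nra). lra. }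
  rewrite Cmod_div by now apply Cmult_neq_0. rewrite !Cmod_mult, Cmod_Ci, !Cmod_R.
  rewrite (Rabs_pos_eq a), (Rabs_pos_eq 2), Rmult_1_l by lra.
  set (L := (2 * exp (- (2 * Rabs (Im x))) * (a * INR r / 32))%R) in *.
  assert (HL : (0 < L)%R).
  { unfold L. apply Rmult_lt_0_compat; [pose proof (exp_pos (- (2 * Rabs (Im x)))); lra|].
    assert (0 < a * INR r)%R by nra. lra. }
  apply Rle_trans with (a * (2 * (a * b * K1)) / (L * L))%R.
  - unfold Rdiv. apply Rmult_le_compat.
    + pose proof (Cmod_ge_0 (Cexp w - 1)). nra.
    + left. apply Rinv_0_lt_compat. apply Rmult_lt_0_compat; now apply Cmod_gt_0.
    + apply Rmult_le_compat_l; lra.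
    + apply Rinv_le_contravar; [nra|]. apply Rmult_le_compat; lra.
  - assert (Eei : (exp (- (2 * Rabs (Im x))) * exp (- (2 * Rabs (Im x))) * ei = 1)%R).
    { unfold ei. rewrite <- !exp_plus, <- exp_0. f_equal. ring. }
    set (g := exp (- (2 * Rabs (Im x)))) in *.
    assert (Hg : (0 < g)%R) by apply exp_pos.
    assert (EL : (a * (2 * (a * b * K1)) / (L * L) = b * K1 * 512 * ei * / (INR r * INR r))%R).
    { unfold L. apply Rmult_eq_reg_r with (g * g)%R; [|nra].
      replace (b * K1 * 512 * ei * / (INR r * INR r) * (g * g))%R with
        (b * K1 * 512 * / (INR r * INR r) * (g * g * ei))%R by ring.
      rewrite Eei. field. repeat split; lra. }
    rewrite EL.
    rewrite (Rmult_assoc _ 4). apply Rmult_le_compat_l; [lra|].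
    unfold inv_sq. rewrite <- Rinv_mult.
    replace (4 * / ((INR r + 1) * (INR r + 1)))%R with (/ ((INR r + 1) * (INR r + 1) / 4))%R by (field; lra).
    apply Rinv_le_contravar; nra.
Qed.

(** Tannery's theorem for the 2^t terms of the halved cotangent. The term r = 0, not covered by
    [pcot_bound], is bounded because it converges in [t]. *)
Lemma cot_series (x : C) : notZ x -> (0 <= Re x <= 1)%R ->
  Ccvg (fun n => csum n (fun r => / (x + INR r) + / (x - 1 - INR r))) (PI * Ccot (PI * x)).
Proof.
  intros Hx Hre. destruct (pcot_bound x Hx Hre) as [K [HK HB]].
  assert (Hlim : forall r, Ccvg (fun t => pcot x (2 ^ t) r) (/ (x + INR r) + / (x - 1 - INR r))).
  { intros r. apply Ccvg_plus; apply scot_cvg; [now apply notZ_plus_INR|].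
    apply notZ_minus_INR. replace (x - 1) with (x - INR 1) by reflexivity. now apply notZ_minus_INR. }
  destruct (Ccvg_bounded _ _ (Hlim O)) as [K0 [HK0 HB0]].
  destruct (tannery (fun t => pcot x (2 ^ t)) (fun r => / (x + INR r) + / (x - 1 - INR r))
    (fun r => (K0 + K) * inv_sq r)%R (fun t => (2 ^ t)%nat) ((K0 + K) * 2)%R) as [L [HL1 HL2]]; auto.
  - intros t r Hr. pose proof (inv_sq_pos r). destruct r as [|r].
    + eapply Rle_trans; [apply HB0|].
      replace (inv_sq 0) with 1%R by (unfold inv_sq; simpl; field). lra.
    + eapply Rle_trans; [apply HB; lia|]. nra.
  - intros r. exists r. intros t Ht. pose proof (pow2_gt t). lia.
  - intros n. apply rsum_scal_sq. lra.
  - apply Ccvg_eq with L; auto. apply (Ccvg_unique (fun t => csum (2 ^ t) (pcot x (2 ^ t)))); auto.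
    apply Ccvg_ext with (fun _ => PI * Ccot (PI * x)); [|apply Ccvg_const].
    intros t. symmetry. now apply pcot_sum.
Qed.

(** In the difference of the partial sums for psi at x and at 1 - x the logarithms cancel, and what
    remains is the cotangent series. *)
Lemma digamma_reflection_strip (x : C) : notZ x -> (0 <= Re x <= 1)%R ->
  digamma (1 - x) = digamma x + PI * Ccot (PI * x).
Proof.
  intros Hx Hre. pose proof (cot_series x Hx Hre) as Hc.
  pose proof (digamma_Cv x (notZ_np x Hx)) as H1.
  pose proof (digamma_Cv (1 - x) (notZ_np _ (notZ_one_minus x Hx))) as H2.
  assert (E : - digamma x - - digamma (1 - x) = PI * Ccot (PI * x)).
  { apply (Ccvg_unique (fun n => dig_partial x n - dig_partial (1 - x) n)); [now apply Ccvg_minus|].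
    refine (Ccvg_ext _ _ _ _ Hc). intros n. unfold dig_partial. rewrite csum_plus.
    replace (csum n (fun k => / (x - 1 - INR k))) with (- (1) * csum n (recip (1 - x))); [unfold recip; ring|].
    rewrite <- csum_scal. apply csum_ext. intros k _. unfold recip.
    assert (Hn : x - 1 - INR k <> 0).
    { intros E. apply (Hx (1 + Z.of_nat k)%Z). rewrite plus_IZR, <- INR_IZR_INZ, RtoC_plus.
      replace x with ((x - 1 - INR k) + (1 + INR k)) by ring. rewrite E. ring. }
    replace (1 - x + INR k) with (- (x - 1 - INR k)) by ring. field. auto. }
  rewrite <- E. ring.
Qed.

Lemma notZ_neq_0 (x : C) : notZ x -> x <> 0.
Proof. intros H ->. now apply (H 0%Z). Qed.

Lemma Ccot_period (x : C) : notZ x -> Ccot (PI * (x + 1)) = Ccot (PI * x).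
Proof.
  intros Hx. assert (EQ : Cexp2i (PI * (x + 1)) = Cexp2i (PI * x)).
  { replace (PI * (x + 1)) with ((PI * x + PI / 2) + PI / 2) by field.
    rewrite !Cexp2i_half_period. ring. }
  assert (HQ : Cexp2i (PI * x) <> 1).
  { apply (notZ_Qe PI x 1); auto. simpl. field. }
  rewrite !Ccot_Qe by (rewrite ?EQ; auto). now rewrite EQ.
Qed.

(** An equivalence, because the argument has to be carried to the strip 0 <= Re x <= 1 from either
    side. *)
Lemma digamma_reflection_step (x : C) : notZ x ->
  digamma (1 - x) = digamma x + PI * Ccot (PI * x) <->
  digamma (1 - (x + 1)) = digamma (x + 1) + PI * Ccot (PI * (x + 1)).
Proof.
  intros Hx. rewrite Ccot_period, (digamma_shift x) by auto using notZ_np.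
  assert (E : digamma (1 - x) = digamma (1 - (x + 1)) + / - x).
  { replace (1 - x) with ((1 - (x + 1)) + 1) by ring. rewrite digamma_shift.
    - f_equal. f_equal. ring.
    - replace (1 - (x + 1)) with (- x) by ring. apply notZ_np. now apply notZ_opp. }
  rewrite E. pose proof (notZ_neq_0 x Hx) as Hx0.
  assert (E2 : / - x = - / x) by (field; auto). rewrite E2. split; intros H.
  - replace (digamma (1 - (x + 1))) with (digamma (1 - (x + 1)) + - / x + / x) by ring. rewrite H. ring.
  - rewrite H. ring.
Qed.

Lemma digamma_reflection_steps (x : C) (n : nat) : notZ x ->
  digamma (1 - x) = digamma x + PI * Ccot (PI * x) <->
  digamma (1 - (x + INR n)) = digamma (x + INR n) + PI * Ccot (PI * (x + INR n)).
Proof.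
  intros Hx. induction n as [|n IH]; [simpl; rewrite Cplus_0_r; tauto|].
  rewrite IH. rewrite <- RtoC_INR_S, Cplus_assoc. apply digamma_reflection_step.
  now apply notZ_plus_INR.
Qed.

Lemma digamma_reflection (x : C) : notZ x -> digamma (1 - x) = digamma x + PI * Ccot (PI * x).
Proof.
  intros Hx. destruct (base_Int_part (Re x)) as [H1 H2]. set (k := Int_part (Re x)) in *.
  destruct (Z.le_gt_cases 0 k) as [Hk|Hk].
  - assert (Ek : IZR k = INR (Z.to_nat k)) by (rewrite INR_IZR_INZ, Z2Nat.id; auto).
    set (n := Z.to_nat k) in *. replace x with ((x - INR n) + INR n) by ring.
    apply digamma_reflection_steps; [now apply notZ_minus_INR|].
    apply digamma_reflection_strip; [now apply notZ_minus_INR|].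
    replace (Re (x - INR n)) with (Re x - INR n)%R by (unfold Re; simpl; ring). lra.
  - assert (Ek : IZR k = (- INR (Z.to_nat (- k)))%R).
    { rewrite INR_IZR_INZ, Z2Nat.id, opp_IZR by lia. ring. }
    set (n := Z.to_nat (- k)) in *. apply (digamma_reflection_steps x n Hx).
    apply digamma_reflection_strip; [now apply notZ_plus_INR|].
    replace (Re (x + INR n)) with (Re x + INR n)%R by (unfold Re; simpl; ring). lra.
Qed.

(** * The rational approximation *)

Fixpoint fam (pt : nat -> C) (n : nat) : list C :=
  match n with O => [] | S k => pt k :: fam pt k end.

Lemma In_fam (pt : nat -> C) (n : nat) (p : C) :
  In p (fam pt n) <-> exists j, (j < n)%nat /\ p = pt j.
Proof.
  induction n as [|n IH]; simpl.
  - split; [tauto|]. intros [j [Hj _]]. lia.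
  - rewrite IH. split.
    + intros [<-|[j [Hj ->]]]; [exists n|exists j]; auto.
    + intros [j [Hj ->]]. destruct (Nat.eq_dec j n) as [->|]; [now left|right; exists j; split; auto; lia].
Qed.

Lemma lsum_fam (B : C -> C) (pt : nat -> C) (n : nat) :
  lsum B (fam pt n) = csum n (fun j => B (pt j)).
Proof. induction n as [|n IH]; simpl; auto. rewrite IH. ring. Qed.

(** Each added pole costs at most [K] in the sum of the residues; this is the origin of the growth
    O(N). *)
Lemma pfrac_family (R : C -> C) (P : list C) (B : C -> C) (r K : Rdefinitions.R)
  (pt z w : nat -> C) (n : nat) :
  pfrac R P B r -> (forall i j, pt i = pt j -> i = j) -> (forall j, ~ In (pt j) P) ->
  (forall j, (j < n)%nat -> (Cmod (2 * pt j - z j - w j) <= K)%R) ->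
  exists B', pfrac (fun s => R s * cprod n (fun j => (s - z j) * (s - w j) / ((s - pt j) * (s - pt j))))
               (fam pt n ++ P) B' (r + INR n * K).
Proof.
  intros HPF Hinj HP. induction n as [|n IH]; intros HK.
  - exists B. simpl. rewrite Rmult_0_l, Rplus_0_r.
    apply pfrac_ext with (2 := HPF). intros; ring.
  - destruct IH as [B1 H1]; auto.
    assert (Hnin : ~ In (pt n) (fam pt n ++ P)).
    { rewrite in_app_iff. intros [H|H]; [|now apply (HP n)].
      apply In_fam in H. destruct H as [j [Hj E]]. apply Hinj in E. lia. }
    destruct (pfrac_step _ _ _ _ (pt n) (z n) (w n) H1 Hnin) as [B2 [Hnd [Hr HA]]].
    exists B2. simpl fam. simpl app.
    apply pfrac_ext with (fun s => R s * cprod n (fun j => (s - z j) * (s - w j) / ((s - pt j) * (s - pt j))) *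
      ((s - z n) * (s - w n) / ((s - pt n) * (s - pt n)))).
    { intros s _. simpl. ring. }
    split; auto. split; auto. eapply Rle_trans; [exact Hr|]. rewrite S_INR.
    specialize (HK n ltac:(lia)). lra.
Qed.

(** Finite substitute, up to normalization, for 1/Gamma(1 - x - s): it vanishes at the first N + 1
    zeros s = 1 - x + j. *)
Definition Fprod (x : C) (N : nat) (s : C) : C := cprod (S N) (fun j => s - 1 + x - INR j).

(** At s = e + k + h the first k factors, in reverse order, are the ascending product of x + e + h;
    the other N - k + 1 become ascending after a change of sign. *)
Lemma Fprod_split (x e h : C) (N k : nat) : (k <= N)%nat ->
  Fprod x N (e + INR k + h) =
  poch (x + e + h) k * ((- (1)) ^ S (N - k) * poch (1 - x - e - h) (S (N - k))).
Proof.
  intros Hk. unfold Fprod. replace (S N) with (k + S (N - k))%nat by lia.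
  rewrite cprod_app. f_equal.
  - rewrite cprod_rev. unfold poch. apply cprod_ext. intros j Hj.
    replace (INR (k - 1 - j)) with (INR k - 1 - INR j)%R.
    + rewrite !RtoC_minus. ring.
    + rewrite !minus_INR by lia. simpl. ring.
  - unfold poch. rewrite <- cprod_const, <- cprod_mult. apply cprod_ext. intros j _.
    rewrite plus_INR, RtoC_plus. ring.
Qed.

Lemma poch_0_S (h : C) (n : nat) : poch (- h) (S n) = - h * poch (1 - h) n.
Proof.
  unfold poch. rewrite cprod_S_l. simpl (INR 0). rewrite Cplus_0_r. f_equal.
  apply cprod_ext. intros j _. rewrite <- RtoC_INR_S. ring.
Qed.

Lemma Fprod_neq_0 (x s : C) (N : nat) :
  (forall j, (j <= N)%nat -> s <> 1 - x + INR j) -> Fprod x N s <> 0.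
Proof.
  intros H. apply cprod_neq_0. intros j Hj E. apply (H j); [lia|].
  replace s with ((s - 1 + x - INR j) + (1 - x + INR j)) by ring. rewrite E. ring.
Qed.

Fixpoint dpoles (d : list C) (N : nat) : list C :=
  match d with [] => [] | x :: d' => fam (fun j => 1 - x + INR j) (S N) ++ dpoles d' N end.

Lemma In_dpoles (d : list C) (N : nat) (p : C) :
  In p (dpoles d N) <-> exists x j, In x d /\ (j <= N)%nat /\ p = 1 - x + INR j.
Proof.
  induction d as [|x d IH].
  - simpl. split; [tauto|]. intros [x [j [[] _]]].
  - change (In p (fam (fun j => 1 - x + INR j) (S N) ++ dpoles d N) <->
            exists y j, In y (x :: d) /\ (j <= N)%nat /\ p = 1 - y + INR j).
    rewrite in_app_iff, IH, In_fam. split.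
    + intros [[j [Hj ->]]|[y [j [Hy [Hj ->]]]]].
      * exists x, j. simpl. repeat split; auto. lia.
      * exists y, j. simpl. auto.
    + intros [y [j [[->|Hy] [Hj ->]]]].
      * left. exists j. split; auto. lia.
      * right. exists y, j. auto.
Qed.

Lemma lsum_dpoles (B : C -> C) (d : list C) (N : nat) :
  lsum B (dpoles d N) = lsum (fun x => csum (S N) (fun n => B (1 - x + INR n))) d.
Proof.
  induction d as [|x d IH]; [reflexivity|].
  change (lsum B (fam (fun j => 1 - x + INR j) (S N) ++ dpoles d N) = 
    csum (S N) (fun n => B (1 - x + INR n)) + lsum (fun x => csum (S N) (fun n => B (1 - x + INR n))) d).
  rewrite lsum_app, lsum_fam, IH. reflexivity.
Qed.

Lemma RtoC_INR_inj (i j : nat) (e : C) : e + INR i = e + INR j -> i = j.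
Proof.
  intros H. apply INR_eq. apply RtoC_inj.
  replace (RtoC (INR i)) with (e + INR i - e) by ring. rewrite H. ring.
Qed.

(** Entries of equal rank are paired. Factor by factor the quotient moves a zero to a distance |y -
    x| from its pole, so [K] is the sum of these distances and does not depend on [N]. *)
Lemma pfrac_lists (c d : list C) : length c = length d ->
  (forall j k : nat, (j < length d)%nat -> (k < length d)%nat -> j <> k ->
          notZ (nth j d 0 - nth k d 0)) ->
  exists K, (0 <= K)%R /\ forall N R P B r, pfrac R P B r ->
    (forall x j, In x d -> ~ In (1 - x + INR j) P) ->
    exists B', pfrac (fun s => R s * (lprod (fun x => Fprod x N s) c / lprod (fun x => Fprod x N s) d))
               (dpoles d N ++ P) B' (r + (INR N + 1) * K).
Proof.
  revert c. induction d as [|x d IH]; intros c Hlen Hdd.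
  - destruct c; [|discriminate]. exists 0%R. split; [lra|]. intros N R P B r HPF _. exists B.
    rewrite Rmult_0_r, Rplus_0_r. apply pfrac_ext with (2 := HPF). intros s _. simpl. field. 
  - destruct c as [|y c]; [discriminate|]. injection Hlen as Hlen.
    destruct (IH c Hlen) as [K [HK H]].
    { intros j k Hj Hk Hjk. apply (Hdd (S j) (S k)); simpl; lia. }
    exists (K + Cmod (y - x))%R. split; [pose proof (Cmod_ge_0 (y - x)); lra|].
    intros N R P B r HPF Hdisj.
    destruct (H N R P B r HPF) as [B1 H1].
    { intros x' j Hx'. apply Hdisj. now right. }
    destruct (pfrac_family _ _ _ _ (Cmod (y - x)) (fun j => 1 - x + INR j) (fun j => 1 - y + INR j)
               (fun j => 1 - x + INR j) (S N) H1) as [B2 H2].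
    + intros i j. apply RtoC_INR_inj.
    + intros j. rewrite in_app_iff. intros [Hin|Hin]; [|apply (Hdisj x j); simpl; auto].
      apply In_dpoles in Hin. destruct Hin as [x' [j' [Hx' [_ E]]]].
      destruct (In_nth d x' 0 Hx') as [n [Hn <-]].
      (* A pole shared by two entries of [d] would make their difference an integer. *)
      apply (Hdd O (S n) ltac:(simpl; lia) ltac:(simpl; lia) ltac:(lia) (Z.of_nat j - Z.of_nat j')%Z). simpl.
      rewrite minus_IZR, <- !INR_IZR_INZ, RtoC_minus.
      replace x with (1 + INR j - (1 - x + INR j)) by ring. rewrite E. ring.
    + intros j _. apply Req_le. f_equal. ring.
    + exists B2.
      change (dpoles (x :: d) N ++ P) with ((fam (fun j => 1 - x + INR j) (S N) ++ dpoles d N) ++ P).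
      rewrite <- app_assoc. rewrite S_INR in H2.
      replace (r + (INR N + 1) * (K + Cmod (y - x)))%R with
        (r + (INR N + 1) * K + (INR N + 1) * Cmod (y - x))%R by ring.
      apply pfrac_ext with (2 := H2). intros s Hs.
      assert (Hx : Fprod x N s <> 0).
      { apply Fprod_neq_0. intros j Hj ->. apply Hs. rewrite in_app_iff. left. apply In_fam.
        exists j. split; auto. lia. }
      assert (Hd : lprod (fun x => Fprod x N s) d <> 0).
      { apply lprod_neq_0. intros x' Hx'. apply Fprod_neq_0. intros j Hj ->. apply Hs.
        rewrite !in_app_iff. right. left. apply In_dpoles. exists x', j. auto. }
      change (lprod (fun x => Fprod x N s) (y :: c)) with (Fprod y N s * lprod (fun x => Fprod x N s) c).
      change (lprod (fun x => Fprod x N s) (x :: d)) with (Fprod x N s * lprod (fun x => Fprod x N s) d).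
      assert (E : cprod (S N) (fun j => (s - (1 - y + INR j)) * (s - (1 - x + INR j)) /
                 ((s - (1 - x + INR j)) * (s - (1 - x + INR j)))) = Fprod y N s / Fprod x N s).
      { unfold Cdiv at 2. unfold Fprod. rewrite <- cprod_inv, <- cprod_mult.
        - apply cprod_ext. intros j Hj.
          assert (Hn : s - (1 - x + INR j) <> 0).
          { apply Cminus_eq_contra. intros ->. apply Hs. rewrite in_app_iff. left. apply In_fam. now exists j. }
          replace (s - 1 + x - INR j) with (s - (1 - x + INR j)) by ring.
          field. auto.
        - intros j Hj. replace (s - 1 + x - INR j) with (s - (1 - x + INR j)) by ring.
          apply Cminus_eq_contra. intros ->. apply Hs. rewrite in_app_iff. left. apply In_fam. now exists j. }
      rewrite E. field. auto.
Qed.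

(** The denominators come from Gamma(-m - s)/Gamma(-s) = (-1)^m / ((s + 1) ... (s + m)). *)
Definition Mprod (m N : nat) (s : C) : C :=
  cprod m (fun i => (s - INR N - INR (S i)) / (s + INR (S i))).

(* The zeros [N + 1, ..., N + m] are put in to balance the poles [-1, ..., -m]. *)
Definition ratfun (m : nat) (c d : list C) (N : nat) (s : C) : C :=
  Mprod m N s * lprod (fun x => Fprod x N s) c /
    (lprod (fun x => Fprod x N s) d * (Fprod 1 N s * Fprod 1 N s)).

Definition negp (i : nat) : C := - INR (S i).

Definition poles (m : nat) (d : list C) (N : nat) : list C :=
  dpoles d N ++ fam (fun j => RtoC (INR j)) (S N) ++ fam negp m.

(** The two surplus entries of [c] supply the zeros that face the double poles 0, ..., N; the others
    are paired with [d], and the zeros beyond N with the poles -1, ..., -m. *)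
Lemma pfrac_main (m : nat) (c d : list C) : length c = (length d + 2)%nat ->
  (forall x, In x d -> notZ x) ->
  (forall j k : nat, (j < length d)%nat -> (k < length d)%nat -> j <> k ->
          notZ (nth j d 0 - nth k d 0)) ->
  exists K, (0 <= K)%R /\ forall N, exists B, pfrac (ratfun m c d N) (poles m d N) B ((INR N + 1) * K).
Proof.
  intros Hlen Hd Hdd.
  destruct c as [|c1 [|c2 c]]; [simpl in Hlen; lia|simpl in Hlen; lia|].
  assert (Hlen' : length c = length d) by (simpl in Hlen; lia).
  destruct (pfrac_lists c d Hlen' Hdd) as [K [HK H]].
  (* Per unit of N + 1: the m negative poles are each at distance N + 2(i + 1) <= (N + 1)(2m + 1)
     from their zeros, each double pole contributes |c1 + c2 - 2|, and [K] stems from the pairs in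
     [c] and [d]. *)
  exists (INR m * (2 * INR m + 1) + Cmod (c1 + c2 - 2) + K)%R.
  pose proof (pos_INR m) as Hm0. pose proof (Cmod_ge_0 (c1 + c2 - 2)) as Hc0.
  split; [nra|]. intros N. pose proof (pos_INR N) as HN0.
  destruct (pfrac_family _ _ _ _ ((INR N + 1) * (2 * INR m + 1)) negp
    (fun i => INR N + INR (S i)) negp m pfrac_nil) as [B1 H1].
  { intros i j E. unfold negp in E. apply Nat.succ_inj. apply INR_eq. apply RtoC_inj.
    replace (RtoC (INR (S i))) with (- - INR (S i)) by ring. rewrite E. ring. }
  { simpl. auto. }
  { intros j Hj. unfold negp.
    replace (2 * - INR (S j) - (INR N + INR (S j)) - - INR (S j)) with (- (RtoC (INR N + 2 * INR (S j)))).
    2:{ rewrite RtoC_plus, RtoC_mult. ring. }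
    assert (HS : (INR (S j) <= INR m)%R) by (apply le_INR; lia). pose proof (pos_INR (S j)).
    rewrite Cmod_opp, Cmod_R, Rabs_pos_eq by lra. nra. }
  destruct (pfrac_family _ _ _ _ (Cmod (c1 + c2 - 2)) (fun j => RtoC (INR j)) (fun j => 1 - c1 + INR j)
              (fun j => 1 - c2 + INR j) (S N) H1) as [B2 H2].
  { intros i j E. apply INR_eq. now apply RtoC_inj. }
  { intros j. rewrite app_nil_r, In_fam. intros [i [_ E]]. unfold negp in E.
    rewrite <- RtoC_opp in E. apply RtoC_inj in E. pose proof (pos_INR j).
    pose proof (lt_0_INR (S i) ltac:(lia)). lra. }
  { intros j _. apply Req_le. f_equal. ring. }
  destruct (H N _ _ _ _ H2) as [B3 H3].
  { intros x j Hx. rewrite app_nil_r, in_app_iff, !In_fam. intros [[i [_ E]]|[i [_ E]]].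
    - apply (Hd x Hx (1 + Z.of_nat j - Z.of_nat i)%Z).
      rewrite minus_IZR, plus_IZR, <- !INR_IZR_INZ, RtoC_minus, RtoC_plus. rewrite <- E. ring.
    - apply (Hd x Hx (1 + Z.of_nat j + Z.of_nat (S i))%Z).
      rewrite !plus_IZR, <- !INR_IZR_INZ, !RtoC_plus.
      replace (RtoC (INR (S i))) with (- (1 - x + INR j)) by (rewrite E; unfold negp; ring). ring. }
  exists B3. rewrite app_nil_r in H3. unfold poles.
  destruct H3 as [Hnd [Hr HA]].
  assert (HPF : pfrac (ratfun m (c1 :: c2 :: c) d N) (dpoles d N ++ fam (fun j => RtoC (INR j)) (S N) ++ fam negp m) B3
           (0 + INR m * ((INR N + 1) * (2 * INR m + 1)) + INR (S N) * Cmod (c1 + c2 - 2) + (INR N + 1) * K)).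
  { apply pfrac_ext with (2 := conj Hnd (conj Hr HA)). intros s Hs. rewrite !in_app_iff in Hs.
    assert (Hi : forall j, (j < S N)%nat -> s - INR j <> 0).
    { intros j Hj. apply Cminus_eq_contra. intros ->. apply Hs. right. left. apply In_fam. now exists j. }
    assert (Hneg : forall i, (i < m)%nat -> s + INR (S i) <> 0).
    { intros i Hi' E. apply Hs. right. right. apply In_fam. exists i. split; auto. unfold negp.
      replace s with (s + INR (S i) - INR (S i)) by ring. rewrite E. ring. }
    assert (EM : cprod m (fun j => (s - (INR N + INR (S j))) * (s - negp j) / ((s - negp j) * (s - negp j)))
             = Mprod m N s).
    { apply cprod_ext. intros i Hi'. unfold negp.
      replace (s - - INR (S i)) with (s + INR (S i)) by ring. specialize (Hneg i Hi'). field. auto. }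
    assert (EF : cprod (S N) (fun j => (s - (1 - c1 + INR j)) * (s - (1 - c2 + INR j)) / ((s - INR j) * (s - INR j)))
             = Fprod c1 N s * Fprod c2 N s / (Fprod 1 N s * Fprod 1 N s)).
    { unfold Fprod. rewrite <- !cprod_mult. unfold Cdiv at 2. rewrite <- cprod_inv, <- cprod_mult.
      - apply cprod_ext. intros j Hj. specialize (Hi j Hj).
        replace (s - 1 + 1 - INR j) with (s - INR j) by ring. field. auto.
      - intros j Hj. replace (s - 1 + 1 - INR j) with (s - INR j) by ring. specialize (Hi j Hj).
        now apply Cmult_neq_0. }
    rewrite EM, EF. unfold ratfun.
    change (lprod (fun x => Fprod x N s) (c1 :: c2 :: c)) with
      (Fprod c1 N s * (Fprod c2 N s * lprod (fun x => Fprod x N s) c)).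
    assert (H1F : Fprod 1 N s <> 0).
    { apply cprod_neq_0. intros j Hj. replace (s - 1 + 1 - INR j) with (s - INR j) by ring. auto. }
    assert (HdF : lprod (fun x => Fprod x N s) d <> 0).
    { apply lprod_neq_0. intros x Hx. apply Fprod_neq_0. intros j Hj E. apply Hs. left.
      apply In_dpoles. exists x, j. auto. }
    field. auto. }
  rewrite S_INR in HPF.
  destruct HPF as [Hnd' [Hr' HA']]. split; auto. split; auto.
  eapply Rle_trans; [exact Hr'|]. apply Req_le. ring.
Qed.

(** * Local expansions and normalized residues of the rational approximation *)

Lemma log_jet_ext (f g : C -> C) (v l : C) : (forall h, f h = g h) -> log_jet f v l -> log_jet g v l.
Proof. intros H. apply jet_ext. exists 1%R. split; [lra|]. auto. Qed.

Lemma jet_val_ext (f g : C -> C) (v : C) : (forall h, f h = g h) -> jet_val f v -> jet_val g v.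
Proof. intros H [a Ha]. exists a. apply jet_ext with (2 := Ha). exists 1%R. split; [lra|]. auto. Qed.

Lemma log_jet_eq (f : C -> C) (v l v' l' : C) : v = v' -> l = l' -> log_jet f v l -> log_jet f v' l'.
Proof. now intros -> ->. Qed.

Lemma log_jet_poch (y s : C) (n : nat) : (forall j, (j < n)%nat -> y + INR j <> 0) ->
  log_jet (fun h => poch (y + s * h) n) (poch y n) (s * csum n (recip y)).
Proof.
  intros H. rewrite <- csum_scal. unfold poch.
  apply (log_jet_cprod n (fun j h => y + s * h + INR j)). intros j Hj.
  apply log_jet_ext with (fun h => (y + INR j) + s * h); [intros; ring|].
  now apply log_jet_shift, H.
Qed.

Lemma log_jet_poch_p (y : C) (n : nat) : (forall j, (j < n)%nat -> y + INR j <> 0) ->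
  log_jet (fun h => poch (y + h) n) (poch y n) (csum n (recip y)).
Proof.
  intros H. apply log_jet_eq with (poch y n) (1 * csum n (recip y)); [reflexivity|ring|].
  apply log_jet_ext with (fun h => poch (y + 1 * h) n); [intros; now rewrite Cmult_1_l|]. now apply log_jet_poch.
Qed.

Lemma log_jet_poch_m (y : C) (n : nat) : (forall j, (j < n)%nat -> y + INR j <> 0) ->
  log_jet (fun h => poch (y - h) n) (poch y n) (- csum n (recip y)).
Proof.
  intros H. apply log_jet_eq with (poch y n) (- (1) * csum n (recip y)); [reflexivity|ring|].
  apply log_jet_ext with (fun h => poch (y + - (1) * h) n); [intros; f_equal; ring|]. now apply log_jet_poch.
Qed.

Lemma jet_val_poch (y s : C) (n : nat) : jet_val (fun h => poch (y + s * h) n) (poch y n).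
Proof.
  unfold poch. apply (jet_val_cprod n (fun j h => y + s * h + INR j)). intros j _.
  apply jet_val_ext with (fun h => (y + INR j) + s * h); [intros; ring|]. apply jet_val_shift.
Qed.

Lemma jet_val_poch_p (y : C) (n : nat) : jet_val (fun h => poch (y + h) n) (poch y n).
Proof. apply jet_val_ext with (fun h => poch (y + 1 * h) n); [intros; f_equal; ring|]. apply jet_val_poch. Qed.

Lemma jet_val_poch_m (y : C) (n : nat) : jet_val (fun h => poch (y - h) n) (poch y n).
Proof. apply jet_val_ext with (fun h => poch (y + - (1) * h) n); [intros; f_equal; ring|]. apply jet_val_poch. Qed.

Lemma jet_val_div (f g : C -> C) (v w : C) : jet_val f v -> jet_val g w -> w <> 0 -> jet_val (fun h => f h / g h) (v / w).
Proof. intros. apply jet_val_mult; auto. now apply jet_val_inv. Qed.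

Lemma Cinv_0 : / RtoC 0 = 0.
Proof. unfold Cinv, RtoC. simpl. f_equal; unfold Rdiv; ring. Qed.

Lemma Cinv_mult (a b : C) : / (a * b) = / a * / b.
Proof.
  destruct (Ceq_dec a 0) as [->|Ha]; [rewrite Cmult_0_l, Cinv_0; ring|].
  destruct (Ceq_dec b 0) as [->|Hb]; [rewrite Cmult_0_r, Cinv_0; ring|].
  field. auto.
Qed.

Lemma lprod_cons (f : C -> C) (x : C) (l : list C) : lprod f (x :: l) = f x * lprod f l.
Proof. reflexivity. Qed.

Lemma Cpow_S_l (a : C) (n : nat) : a ^ S n = a * a ^ n.
Proof. reflexivity. Qed.

(** [gauss_quot] at index N - k + 1 carries the base N - k + 2, whence the shift by 2; it also keeps
    [tau] positive at k = N. *)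
Definition tau (N k : nat) : R := ((INR (N - k) + 2) / (INR N + 2))%R.

(* [poch (1 - x - e) (N - k + 1) / poch (1 - x) (N + 1) = ratio_scale e N k * rho x e N k], where the first factor
   does not depend on [x] and cancels because there are two more upper than lower parameters. *)
Definition rho (x e : C) (N k : nat) : C :=
  gauss_quot (1 - x - e) (S (N - k)) / gauss_quot (1 - x) (S N) * Rcpow (tau N k) (- x).

Definition ratio_scale (e : C) (N k : nat) : C :=
  INR (fact (S (N - k))) / INR (fact (S N)) * Rcpow (INR (N - k) + 2) (- e).

Lemma Rcpow_tau (N k : nat) (z : C) :
  Rcpow (tau N k) z = Rcpow (INR (N - k) + 2) z / Rcpow (INR N + 2) z.
Proof.
  unfold Rcpow, tau. pose proof (pos_INR (N - k)). pose proof (pos_INR N).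
  rewrite ln_div, RtoC_minus by lra. unfold Cdiv. rewrite <- Cexp_opp, <- Cexp_plus. f_equal. ring.
Qed.

Lemma Rcpow_opp (x : R) (z : C) : Rcpow x (- z) = / Rcpow x z.
Proof. unfold Rcpow. rewrite <- Cexp_opp. f_equal. ring. Qed.

Lemma poch_S_gq (z : C) (n : nat) :
  poch z (S n) = gauss_quot z (S n) * (INR (fact (S n)) * Rcpow (INR n + 2) (z - 1)).
Proof. rewrite poch_gq, S_INR. do 3 f_equal. ring. Qed.

Lemma poch_ratio (x e : C) (N k : nat) : not_pole (1 - x) ->
  poch (1 - x - e) (S (N - k)) = poch (1 - x) (S N) * (ratio_scale e N k * rho x e N k).
Proof.
  intros Hx. unfold ratio_scale, rho. rewrite Rcpow_tau, !poch_S_gq.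
  replace (1 - x - e - 1) with (- x + - e) by ring. replace (1 - x - 1) with (- x) by ring.
  rewrite Rcpow_plus. pose proof (gauss_quot_neq_0 (1 - x) (S N) Hx).
  field. repeat split; auto using Rcpow_neq_0, INR_fact_neq_0_C.
Qed.

Lemma ratio_scale_neq_0 (e : C) (N k : nat) : ratio_scale e N k <> 0.
Proof.
  unfold ratio_scale. apply Cmult_neq_0; [|apply Rcpow_neq_0]. apply Cmult_neq_0; [apply INR_fact_neq_0_C|].
  intros E. apply C1_nz. rewrite <- (Cinv_l _ (INR_fact_neq_0_C (S N))), E. ring.
Qed.

Lemma Cdiv_neq_0 (a b : C) : a <> 0 -> b <> 0 -> a / b <> 0.
Proof.
  intros Ha Hb. apply Cmult_neq_0; auto. intros E. apply C1_nz. rewrite <- (Cinv_l _ Hb), E. ring.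
Qed.

(** Contribution of one parameter to a normalized residue; as N grows it tends to (x + e)_k / k!
    times [rGamma (1 - x - e) / rGamma (1 - x)]. *)
Definition Aterm (x e : C) (N k : nat) : C := poch (x + e) k / INR (fact k) * rho x e N k.

Definition sign_pow (n : nat) : C := (- (1)) ^ n.

Lemma Cm1_neq_0 : - (1) <> RtoC 0.
Proof. intros E. apply C1_nz. replace (RtoC 1) with (- - (1)) by ring. rewrite E. ring. Qed.

Lemma sgn_neq_0 (n : nat) : sign_pow n <> 0.
Proof. apply Cpow_nz, Cm1_neq_0. Qed.

(** Isolates the factor common to all parameters. Between [c] and [d] exactly its square is left
    over, and this meets the two copies of [Fprod 1]. *)
Lemma list_ratio (l : list C) (e : C) (N k : nat) : (forall x, In x l -> not_pole (1 - x)) ->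
  lprod (fun x => poch (x + e) k * (sign_pow (S (N - k)) * poch (1 - x - e) (S (N - k)))) l =
  lprod (fun x => poch (1 - x) (S N)) l
    * (INR (fact k) * sign_pow (S (N - k)) * ratio_scale e N k) ^ length l * lprod (fun x => Aterm x e N k) l.
Proof.
  induction l as [|x l IH]; intros H; [simpl; ring|].
  rewrite !lprod_cons, IH by (intros; apply H; now right).
  rewrite (poch_ratio x e N k) by (apply H; now left).
  unfold Aterm at 2. simpl length. rewrite Cpow_S_l. field. apply INR_fact_neq_0_C.
Qed.

(* Normalization of [ratfun]; it contains the power of [N] of Gauss' product. *)
Definition scale (m : nat) (c d : list C) (N : nat) : C :=
  cprod m (fun i => - (1) / (INR N + INR (S i))) * (INR (fact N) * INR (fact N))
    * (lprod (fun x => poch (1 - x) (S N)) d / lprod (fun x => poch (1 - x) (S N)) c).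

Definition Mnorm (m N : nat) (s : C) : C :=
  cprod m (fun i => (INR N + INR (S i) - s) / ((INR N + INR (S i)) * (s + INR (S i)))).

Lemma N_plus_S_neq_0 (N i : nat) : INR N + INR (S i) <> 0.
Proof.
  rewrite <- RtoC_plus, <- plus_INR. intros E. apply RtoC_inj in E.
  pose proof (lt_0_INR (N + S i) ltac:(lia)). lra.
Qed.

Lemma Mnorm_Mprod (m N : nat) (s : C) : (forall i, (i < m)%nat -> s + INR (S i) <> 0) ->
  cprod m (fun i => - (1) / (INR N + INR (S i))) * Mprod m N s = Mnorm m N s.
Proof.
  intros H. unfold Mprod, Mnorm. rewrite <- cprod_mult. apply cprod_ext. intros i Hi.
  field. split; auto using N_plus_S_neq_0.
Qed.

(** Logarithmic derivative at s = k of [ratfun] freed from its double pole: negative poles, [c],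
    [d], and the two copies of [Fprod 1]. The last sum has N - k rather than N - k + 1 terms because
    the vanishing factor has been removed. *)
Definition logder (m : nat) (c d : list C) (N k : nat) : C :=
  - csum m (fun i => / (INR N + INR (S i) - INR k) + / (INR k + INR (S i)))
  + lsum (fun x => csum k (recip x) - csum (S (N - k)) (recip (1 - x))) c
  - lsum (fun x => csum k (recip x) - csum (S (N - k)) (recip (1 - x))) d
  - 2 * (csum k (recip 1) - csum (N - k) (recip 1)).

Lemma log_jet_Mprod (m N k : nat) : (k <= N)%nat ->
  log_jet (fun h => Mprod m N (INR k + h)) (Mprod m N (INR k))
     (- csum m (fun i => / (INR N + INR (S i) - INR k) + / (INR k + INR (S i)))).
Proof.
  intros Hk. unfold Mprod.
  apply log_jet_eq with (2 := eq_refl)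
     (v := cprod m (fun i => (INR k - INR N - INR (S i)) / (INR k + INR (S i)))); [reflexivity|].
  replace (- csum m (fun i => / (INR N + INR (S i) - INR k) + / (INR k + INR (S i)))) with
     (csum m (fun i => / (INR k - INR N - INR (S i)) - / (INR k + INR (S i)))).
  - apply (log_jet_cprod m (fun i h => (INR k + h - INR N - INR (S i)) / (INR k + h + INR (S i)))).
    intros i _. apply log_jet_div; [| |apply N_plus_S_neq_0].
    + assert (Hn : INR k - INR N - INR (S i) <> 0).
      { rewrite <- !RtoC_minus. intros E. apply RtoC_inj in E. apply le_INR in Hk.
        pose proof (lt_0_INR (S i) ltac:(lia)). lra. }
      apply log_jet_eq with (INR k - INR N - INR (S i)) (1 / (INR k - INR N - INR (S i))); [reflexivity|field; auto|].
      apply log_jet_ext with (fun h => (INR k - INR N - INR (S i)) + 1 * h); [intros; ring|].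
      now apply log_jet_shift.
    + pose proof (N_plus_S_neq_0 k i).
      apply log_jet_eq with (INR k + INR (S i)) (1 / (INR k + INR (S i))); [reflexivity|field; auto|].
      apply log_jet_ext with (fun h => (INR k + INR (S i)) + 1 * h); [intros; ring|].
      now apply log_jet_shift.
  - replace (- csum m (fun i => / (INR N + INR (S i) - INR k) + / (INR k + INR (S i)))) with
      (- (1) * csum m (fun i => / (INR N + INR (S i) - INR k) + / (INR k + INR (S i)))) by ring.
    rewrite <- csum_scal. apply csum_ext. intros i _. pose proof (N_plus_S_neq_0 k i).
    assert (Hn : INR N + INR (S i) - INR k <> 0).
    { rewrite <- RtoC_plus, <- RtoC_minus. intros E. apply RtoC_inj in E. apply le_INR in Hk.
      pose proof (lt_0_INR (S i) ltac:(lia)). lra. }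
    replace (INR k - INR N - INR (S i)) with (- (INR N + INR (S i) - INR k)) by ring. field. auto.
Qed.

Definition ffac (x e : C) (N k : nat) (h : C) : C :=
  poch (x + e + h) k * (sign_pow (S (N - k)) * poch (1 - x - e - h) (S (N - k))).

(** What is left of [Fprod] at one of its zeros after the factor [h] is divided out. *)
Definition ofac (N k : nat) (h : C) : C :=
  poch (1 + h) k * (sign_pow (S (N - k)) * (- (1) * poch (1 - h) (N - k))).

Lemma Fprod_ffac (x e h : C) (N k : nat) : (k <= N)%nat -> Fprod x N (e + INR k + h) = ffac x e N k h.
Proof. apply Fprod_split. Qed.

Lemma Fprod_ofac (e h : C) (N k : nat) : (k <= N)%nat ->
  Fprod (1 - e) N (e + INR k + h) = h * ofac N k h.
Proof.
  intros Hk. rewrite Fprod_split by auto. unfold ofac.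
  replace (1 - e + e + h) with (1 + h) by ring. replace (1 - (1 - e) - e - h) with (- h) by ring.
  rewrite poch_0_S. unfold sign_pow. ring.
Qed.

Lemma log_jet_ffac (x : C) (N k : nat) : notZ x ->
  log_jet (ffac x 0 N k) (ffac x 0 N k 0) (csum k (recip x) - csum (S (N - k)) (recip (1 - x))).
Proof.
  intros Hx. pose proof (notZ_np _ Hx) as H1. pose proof (notZ_np _ (notZ_one_minus _ Hx)) as H2.
  apply log_jet_eq with (poch x k * (sign_pow (S (N - k)) * poch (1 - x) (S (N - k))))
    (csum k (recip x) + (0 + - csum (S (N - k)) (recip (1 - x)))); [|ring|].
  - unfold ffac. f_equal; [|f_equal]; f_equal; ring.
  - apply log_jet_ext with (fun h => poch (x + h) k * (sign_pow (S (N - k)) * poch (1 - x - h) (S (N - k)))).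
    + intros h. unfold ffac. f_equal; [|f_equal]; f_equal; ring.
    + apply log_jet_mult; [apply log_jet_poch_p; auto|]. apply log_jet_mult; [apply log_jet_const|apply log_jet_poch_m; auto].
Qed.

Lemma log_jet_ofac (N k : nat) :
  log_jet (ofac N k) (INR (fact k) * (sign_pow (S (N - k)) * (- (1) * INR (fact (N - k)))))
     (csum k (recip 1) - csum (N - k) (recip 1)).
Proof.
  rewrite <- !poch_1.
  apply log_jet_eq with (poch 1 k * (sign_pow (S (N - k)) * (- (1) * poch 1 (N - k))))
    (csum k (recip 1) + (0 + (0 + - csum (N - k) (recip 1)))); [reflexivity|ring|].
  apply log_jet_mult; [apply log_jet_poch_p; intros; apply not_pole_1|].
  apply log_jet_mult; [apply log_jet_const|]. apply log_jet_mult; [apply log_jet_const|].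
  apply log_jet_poch_m. intros; apply not_pole_1.
Qed.

Lemma ffac_0 (x e : C) (N k : nat) :
  ffac x e N k 0 = poch (x + e) k * (sign_pow (S (N - k)) * poch (1 - x - e) (S (N - k))).
Proof. unfold ffac. rewrite Cplus_0_r. f_equal. f_equal. f_equal. ring. Qed.

Lemma lprod_ffac_neq_0 (l : list C) (e : C) (N k : nat) :
  (forall x, In x l -> not_pole (x + e)) -> (forall x, In x l -> not_pole (1 - x - e)) ->
  lprod (fun x => ffac x e N k 0) l <> 0.
Proof.
  intros H1 H2. apply lprod_neq_0. intros x Hx. rewrite ffac_0.
  apply Cmult_neq_0; [apply poch_neq_0; auto|].
  apply Cmult_neq_0; [apply sgn_neq_0|apply poch_neq_0; auto].
Qed.

Lemma fact_ratio (N k : nat) : 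
  INR (fact (N - k)) / INR (fact N) =
  ratio_scale 0 N k * ((INR N + 1) / (INR (N - k) + 1)).
Proof.
  unfold ratio_scale. rewrite Copp_0, Rcpow_0. rewrite !fact_simpl, !mult_INR, !RtoC_mult, <- !RtoC_INR_S.
  field. repeat split; auto using INR_S_neq_0, INR_fact_neq_0_C.
Qed.

(** Coefficient of the double pole itself; the residue has the additional factor [logder]. The
    squared ratio at the end accounts for the removed factor, which leaves (N - k)! where
    [ratio_scale] has (N - k + 1)!. *)
Definition res_double_coef (m : nat) (c d : list C) (N k : nat) : C :=
  Mnorm m N (INR k) * (lprod (fun x => Aterm x 0 N k) c / lprod (fun x => Aterm x 0 N k) d)
    * (((INR (N - k) + 1) / (INR N + 1)) * ((INR (N - k) + 1) / (INR N + 1))).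

(* Normalized residue of [ratfun] at the double pole [s = k]. *)
Definition res_double (m : nat) (c d : list C) (N k : nat) : C := res_double_coef m c d N k * logder m c d N k.

(** Only the two copies of [Fprod 1] vanish at s = k, as no entry of [d] is an integer. They cancel
    h^2, and the rest is a product of log-jets. *)
Lemma residue_U (m : nat) (c d : list C) (N k : nat) (B : C -> C) (r : Rdefinitions.R) :
  length c = (length d + 2)%nat ->
  (forall x, In x c -> notZ x) -> (forall x, In x d -> notZ x) ->
  pfrac (ratfun m c d N) (poles m d N) B r -> (k <= N)%nat ->
  scale m c d N * B (INR k) = res_double m c d N k.
Proof.
  intros Hlen Hc Hd HPF Hk.
  assert (Hdn : lprod (fun x => ffac x 0 N k 0) d <> 0).
  { apply lprod_ffac_neq_0; intros x Hx; [|unfold Cminus at 1; rewrite Copp_0]; rewrite Cplus_0_r; apply notZ_np; auto.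
    now apply notZ_one_minus, Hd. }
  assert (Ho : INR (fact k) * (sign_pow (S (N - k)) * (- (1) * INR (fact (N - k)))) <> 0).
  { apply Cmult_neq_0; [apply INR_fact_neq_0_C|]. apply Cmult_neq_0; [apply sgn_neq_0|].
    apply Cmult_neq_0; [|apply INR_fact_neq_0_C]. apply Cm1_neq_0. }
  assert (EB : B (INR k) =
    (Mprod m N (INR k) * lprod (fun x => ffac x 0 N k 0) c /
      (lprod (fun x => ffac x 0 N k 0) d *
        (INR (fact k) * (sign_pow (S (N - k)) * (- (1) * INR (fact (N - k)))) *
         (INR (fact k) * (sign_pow (S (N - k)) * (- (1) * INR (fact (N - k)))))))) * logder m c d N k).
  { apply (pfrac_residue_double (ratfun m c d N) (poles m d N) B r (INR k)
      (fun h => Mprod m N (INR k + h) * lprod (fun x => ffac x 0 N k h) c /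
        (lprod (fun x => ffac x 0 N k h) d * (ofac N k h * ofac N k h)))); auto.
    - unfold poles. rewrite !in_app_iff. right. left. apply In_fam. exists k. split; auto. lia.
    - eapply log_jet_eq; [reflexivity| |apply log_jet_div; [apply log_jet_mult; [apply (log_jet_Mprod m N k Hk)|]|apply log_jet_mult; [|apply log_jet_mult; apply log_jet_ofac]|]].
      2:{ apply (log_jet_lprod c (fun x h => ffac x 0 N k h)). intros x Hx. apply log_jet_ffac; auto. }
      2:{ apply (log_jet_lprod d (fun x h => ffac x 0 N k h)). intros x Hx. apply log_jet_ffac; auto. }
      2:{ apply Cmult_neq_0; auto. now apply Cmult_neq_0. }
      unfold logder. ring.
    - exists 1%R. split; [lra|]. intros h Hh _. unfold ratfun.
      assert (Es : INR k + h = 0 + INR k + h) by ring. rewrite !Es.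
      (* Brings [Fprod 1] to the form expected by [Fprod_ofac] with e = 0. *)
      replace (RtoC 1) with (1 - 0) at 1 2 by ring. rewrite Fprod_ofac by auto.
      rewrite (lprod_ext (fun x => Fprod x N (0 + INR k + h)) (fun x => ffac x 0 N k h) c),
              (lprod_ext (fun x => Fprod x N (0 + INR k + h)) (fun x => ffac x 0 N k h) d)
        by (intros; now apply Fprod_ffac).
      unfold Cdiv. rewrite !Cinv_mult.
      set (X := Mprod m N (0 + INR k + h) * lprod (fun x => ffac x 0 N k h) c).
      set (Y := / lprod (fun x => ffac x 0 N k h) d).
      transitivity (X * Y * / ofac N k h * / ofac N k h * (h * / h) * (h * / h)); [ring|].
      rewrite Cinv_r by auto. ring. }
  assert (EM : cprod m (fun i => - (1) / (INR N + INR (S i))) * Mprod m N (INR k) = Mnorm m N (INR k)).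
  { apply Mnorm_Mprod. intros i _. apply N_plus_S_neq_0. }
  assert (Hc1 : forall x, In x c -> not_pole (1 - x)) by (intros; apply notZ_np, notZ_one_minus; auto).
  assert (Hd1 : forall x, In x d -> not_pole (1 - x)) by (intros; apply notZ_np, notZ_one_minus; auto).
  rewrite EB. unfold res_double, res_double_coef, scale. rewrite <- EM.
  rewrite (lprod_ext (fun x => ffac x 0 N k 0) _ c (fun x _ => ffac_0 x 0 N k)) in *.
  rewrite (lprod_ext (fun x => ffac x 0 N k 0) _ d (fun x _ => ffac_0 x 0 N k)) in *.
  rewrite !list_ratio in * by auto. rewrite Hlen, Nat.add_comm. simpl Nat.add. rewrite !Cpow_S_l.
  pose proof (fact_ratio N k) as EF.
  assert (EF' : RtoC (INR (fact (N - k))) = INR (fact N) * (ratio_scale 0 N k * ((INR N + 1) / (INR (N - k) + 1)))).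
  { rewrite <- EF. field. apply INR_fact_neq_0_C. }
  rewrite EF'.
  assert (HPc : lprod (fun x => poch (1 - x) (S N)) c <> 0) by (apply lprod_neq_0; intros; apply poch_neq_0; auto).
  assert (HPd : lprod (fun x => poch (1 - x) (S N)) d <> 0) by (apply lprod_neq_0; intros; apply poch_neq_0; auto).
  assert (HAd : lprod (fun x => Aterm x 0 N k) d <> 0).
  { intros E. apply Hdn. rewrite E. ring. }
  assert (HT : (INR (fact k) * sign_pow (S (N - k)) * ratio_scale 0 N k) ^ length d <> 0).
  { apply Cpow_nz. apply Cmult_neq_0; [apply Cmult_neq_0|]; auto using INR_fact_neq_0_C, sgn_neq_0, ratio_scale_neq_0. }
  set (T := (INR (fact k) * sign_pow (S (N - k)) * ratio_scale 0 N k) ^ length d) in *.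
  field. repeat split; auto using INR_fact_neq_0_C, sgn_neq_0, ratio_scale_neq_0, INR_S_neq_0.
Qed.

(** Normalized [Mprod] at s = -(i + 1) without its singular factor; the second product is a Lagrange
    interpolation weight. *)
Definition Mrest (m i N : nat) : C :=
  cprod m (fun j => (INR N + INR (S j) + INR (S i)) / (INR N + INR (S j)))
    * cprod m (fun j => if Nat.eq_dec j i then 1 else / (INR (S j) - INR (S i))).

(* Normalized residue of [ratfun] at [s = - (i + 1)]. *)
Definition res_neg (m : nat) (c d : list C) (N i : nat) : C :=
  Mrest m i N * (lprod (fun x => rho x (negp i) N 0) c / lprod (fun x => rho x (negp i) N 0) d)
    * (((INR N + 2) / ((INR N + 1) * gauss_quot (INR (S i)) (S N))) *
       ((INR N + 2) / ((INR N + 1) * gauss_quot (INR (S i)) (S N)))).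

Lemma cprod_single (n i : nat) (a : C) : (i < n)%nat ->
  cprod n (fun j => if Nat.eq_dec j i then a else 1) = a.
Proof.
  induction n as [|n IH]; intros Hi; [lia|]. simpl. destruct (Nat.eq_dec n i) as [->|Hne].
  - rewrite (cprod_ext i _ (fun _ => 1)).
    + rewrite cprod_const, Cpow_1_l. ring.
    + intros j Hj. destruct (Nat.eq_dec j i); [lia|reflexivity].
  - rewrite IH by lia. ring.
Qed.

Lemma not_pole_S_INR (i : nat) : not_pole (INR (S i)).
Proof. intros j. rewrite <- RtoC_plus, <- plus_INR. intros E. apply RtoC_inj in E.
  pose proof (lt_0_INR (S i + j) ltac:(lia)). lra. Qed.

Lemma INR_N_2_neq_0 (N : nat) : RtoC (INR N) + 2 <> 0.
Proof. rewrite <- RtoC_plus. intros E. apply RtoC_inj in E. pose proof (pos_INR N). lra. Qed.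

Lemma poch_own (e : C) (N k : nat) :
  poch (- e) (S (N - k)) =
  gauss_quot (- e) (S (N - k)) * (INR (fact (S N)) * ratio_scale e N k) / (INR (N - k) + 2).
Proof.
  rewrite poch_S_gq. unfold ratio_scale. replace (- e - 1) with (- e + - (1)) by ring.
  pose proof (pos_INR (N - k)).
  rewrite Rcpow_plus, (Rcpow_opp _ 1), Rcpow_1 by lra. rewrite RtoC_plus.
  field. split; auto using INR_N_2_neq_0, INR_fact_neq_0_C.
Qed.

(** At s = -(i + 1) the only singular factor is the one of index i in [Mprod]. [D1] collects the
    numerators, [D2] the other reciprocal denominators. *)
Lemma residue_V (m : nat) (c d : list C) (N i : nat) (B : C -> C) (r : Rdefinitions.R) :
  length c = (length d + 2)%nat ->
  (forall x, In x c -> notZ x) -> (forall x, In x d -> notZ x) ->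
  pfrac (ratfun m c d N) (poles m d N) B r -> (i < m)%nat ->
  scale m c d N * B (negp i) = res_neg m c d N i.
Proof.
  intros Hlen Hc Hd HPF Hi. set (e := negp i).
  assert (HF : forall x h, Fprod x N (e + h) = ffac x e N 0 h).
  { intros x h. rewrite <- Fprod_ffac by lia. simpl. f_equal. ring. }
  assert (Hdn : lprod (fun x => ffac x e N 0 0) d <> 0).
  { apply lprod_ffac_neq_0; intros x Hx; apply notZ_np; unfold e, negp.
    - now apply notZ_minus_INR, Hd.
    - replace (1 - x - - INR (S i)) with (1 - x + INR (S i)) by ring.
      now apply notZ_plus_INR, notZ_one_minus, Hd. }
  assert (Ho : ffac 1 e N 0 0 <> 0).
  { rewrite ffac_0. apply Cmult_neq_0; [apply C1_nz|]. apply Cmult_neq_0; [apply sgn_neq_0|].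
    replace (1 - 1 - e) with (RtoC (INR (S i))) by (unfold e, negp; ring). apply poch_neq_0, not_pole_S_INR. }
  assert (JF : forall x, jet_val (ffac x e N 0) (ffac x e N 0 0)).
  { intros x. rewrite ffac_0. unfold ffac. apply jet_val_mult; [apply jet_val_poch_p|].
    apply jet_val_mult; [apply jet_val_const|apply jet_val_poch_m]. }
  set (D2 := fun h => cprod m (fun j => if Nat.eq_dec j i then 1 else / (INR (S j) - INR (S i) + 1 * h))).
  set (D1 := fun h => cprod m (fun j => - INR (S i) - INR N - INR (S j) + 1 * h)).
  assert (EB : B e = D1 0 * D2 0 * lprod (fun x => ffac x e N 0 0) c /
      (lprod (fun x => ffac x e N 0 0) d * (ffac 1 e N 0 0 * ffac 1 e N 0 0))).
  { apply (pfrac_residue_simple (ratfun m c d N) (poles m d N) B r e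
      (fun h => D1 h * D2 h * lprod (fun x => ffac x e N 0 h) c /
        (lprod (fun x => ffac x e N 0 h) d * (ffac 1 e N 0 h * ffac 1 e N 0 h)))); auto.
    - unfold poles. rewrite !in_app_iff. right. right. apply In_fam. exists i. auto.
    - apply jet_val_div.
      + apply jet_val_mult; [apply jet_val_mult|].
        * unfold D1. apply (jet_val_cprod m (fun j h => - INR (S i) - INR N - INR (S j) + 1 * h)).
          intros j _. rewrite Cmult_0_r, Cplus_0_r. apply jet_val_shift.
        * unfold D2. apply (jet_val_cprod m (fun j h => if Nat.eq_dec j i then 1 else / (INR (S j) - INR (S i) + 1 * h))).
          intros j _. destruct (Nat.eq_dec j i) as [|Hne]; [apply jet_val_const|].
          rewrite Cmult_0_r, Cplus_0_r. apply jet_val_inv; [apply jet_val_shift|].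
          apply Cminus_eq_contra. intros E. apply RtoC_inj in E. apply INR_eq in E. lia.
        * apply (jet_val_lprod c (fun x h => ffac x e N 0 h)). auto.
      + apply jet_val_mult; [|now apply jet_val_mult]. apply (jet_val_lprod d (fun x h => ffac x e N 0 h)). auto.
      + apply Cmult_neq_0; auto. now apply Cmult_neq_0.
    - exists 1%R. split; [lra|]. intros h Hh _. unfold ratfun.
      rewrite (lprod_ext (fun x => Fprod x N (e + h)) (fun x => ffac x e N 0 h) c),
              (lprod_ext (fun x => Fprod x N (e + h)) (fun x => ffac x e N 0 h) d), !HF
        by (intros; apply HF).
      assert (EM : h * Mprod m N (e + h) = D1 h * D2 h).
      (* [h] is written as a product concentrated at index i, so the cancellation happens inside a
         single factor. *)
      { unfold Mprod, D1, D2. rewrite <- (cprod_single m i h Hi) at 1. rewrite <- !cprod_mult.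
        apply cprod_ext. intros j _. unfold e, negp. destruct (Nat.eq_dec j i) as [->|Hne].
        - replace (- INR (S i) + h + INR (S i)) with h by ring. field. auto.
        - unfold Cdiv. replace (- INR (S i) + h + INR (S j)) with (INR (S j) - INR (S i) + 1 * h) by ring. ring. }
      unfold Cdiv. rewrite <- EM. ring. }
  assert (ED : cprod m (fun j => - (1) / (INR N + INR (S j))) * D1 0 * D2 0 = Mrest m i N).
  { unfold D1, D2, Mrest. rewrite <- !cprod_mult. apply cprod_ext. intros j _.
    rewrite !Cmult_0_r, !Cplus_0_r. pose proof (N_plus_S_neq_0 N j). destruct (Nat.eq_dec j i) as [|Hne].
    - field. auto.
    - assert (INR (S j) - INR (S i) <> 0).
      { apply Cminus_eq_contra. intros E. apply RtoC_inj in E. apply INR_eq in E. lia. }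
      field. auto. }
  assert (Hc1 : forall x, In x c -> not_pole (1 - x)) by (intros; apply notZ_np, notZ_one_minus; auto).
  assert (Hd1 : forall x, In x d -> not_pole (1 - x)) by (intros; apply notZ_np, notZ_one_minus; auto).
  assert (HA : forall l, lprod (fun x => Aterm x e N 0) l = lprod (fun x => rho x e N 0) l).
  { intros l. apply lprod_ext. intros x _. unfold Aterm. unfold poch. simpl. field. }
  fold e. rewrite EB. unfold res_neg, scale. rewrite <- ED.
  rewrite (lprod_ext (fun x => ffac x e N 0 0) _ c (fun x _ => ffac_0 x e N 0)) in *.
  rewrite (lprod_ext (fun x => ffac x e N 0 0) _ d (fun x _ => ffac_0 x e N 0)) in *.
  rewrite !list_ratio, !HA in * by auto. rewrite Hlen, Nat.add_comm. simpl Nat.add. rewrite !Cpow_S_l.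
  fold e.
  assert (EO : ffac 1 e N 0 0 = sign_pow (S (N - 0)) * (gauss_quot (INR (S i)) (S N) * (((INR N + 1) * INR (fact N)) * ratio_scale e N 0) / (INR N + 2))).
  { rewrite ffac_0. replace (1 - 1 - e) with (- e) by ring. rewrite poch_own.
    replace (- e) with (RtoC (INR (S i))) by (unfold e, negp; ring). rewrite Nat.sub_0_r.
    rewrite fact_simpl, mult_INR, RtoC_mult, <- (RtoC_INR_S N). unfold poch. simpl cprod. ring. }
  rewrite EO in *.
  assert (HPc : lprod (fun x => poch (1 - x) (S N)) c <> 0) by (apply lprod_neq_0; intros; apply poch_neq_0; auto).
  assert (HPd : lprod (fun x => poch (1 - x) (S N)) d <> 0) by (apply lprod_neq_0; intros; apply poch_neq_0; auto).
  assert (HAd : lprod (fun x => rho x e N 0) d <> 0).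
  { intros E. apply Hdn. rewrite E. ring. }
  assert (HT : (INR (fact 0) * sign_pow (S (N - 0)) * ratio_scale e N 0) ^ length d <> 0).
  { apply Cpow_nz. apply Cmult_neq_0; [apply Cmult_neq_0|]; auto using INR_fact_neq_0_C, sgn_neq_0, ratio_scale_neq_0. }
  set (T := (INR (fact 0) * sign_pow (S (N - 0)) * ratio_scale e N 0) ^ length d) in *.
  replace (RtoC (INR (fact 0))) with (RtoC 1) by reflexivity.
  pose proof (gauss_quot_neq_0 (INR (S i)) (S N) (not_pole_S_INR i)).
  field. repeat split; auto using INR_fact_neq_0_C, sgn_neq_0, ratio_scale_neq_0, INR_S_neq_0, INR_N_2_neq_0.
Qed.

Lemma nth_split_remove (l : list C) (j : nat) : (j < length l)%nat ->
  forall f, lprod f l = f (nth j l 0) * lprod f (remove_nth j l).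
Proof.
  revert j. induction l as [|x l IH]; intros j Hj f; [simpl in Hj; lia|].
  destruct j as [|j]; [reflexivity|]. simpl in Hj.
  change (remove_nth (S j) (x :: l)) with (x :: remove_nth j l).
  rewrite !lprod_cons, (IH j) by lia. simpl nth. ring.
Qed.

Lemma length_remove_nth (l : list C) (j : nat) : (j < length l)%nat ->
  length l = S (length (remove_nth j l)).
Proof.
  revert j. induction l as [|x l IH]; intros j Hj; [simpl in Hj; lia|].
  destruct j as [|j]; [reflexivity|]. simpl in Hj.
  change (remove_nth (S j) (x :: l)) with (x :: remove_nth j l). simpl. rewrite (IH j) by lia. reflexivity.
Qed.

Lemma In_remove_nth (l : list C) (j : nat) (x : C) : (j < length l)%nat -> In x (remove_nth j l) ->
  exists i, (i < length l)%nat /\ i <> j /\ x = nth i l 0.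
Proof.
  revert j. induction l as [|y l IH]; intros j Hj Hin; [simpl in Hj; lia|].
  destruct j as [|j].
  - change (remove_nth 0 (y :: l)) with l in Hin. destruct (In_nth l x 0 Hin) as [n [Hn <-]].
    exists (S n). simpl. repeat split; auto. lia.
  - simpl in Hj. change (remove_nth (S j) (y :: l)) with (y :: remove_nth j l) in Hin.
    destruct Hin as [<-|Hin].
    + exists O. simpl. repeat split; auto. lia.
    + destruct (IH j ltac:(lia) Hin) as [i [Hi [Hne ->]]]. exists (S i). simpl. repeat split; auto. lia.
Qed.

Lemma lsum_nth (f : C -> C) (l : list C) : lsum f l = csum (length l) (fun k => f (nth k l 0)).
Proof.
  induction l as [|x l IH]; [reflexivity|]. simpl length. rewrite csum_S_l, lsum_cons, IH. reflexivity.
Qed.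

(* Normalized residue of [ratfun] at [s = e + k], where [e = 1 - d_l] and [d'] is [d] without [d_l]. *)
Definition res_shift (m : nat) (c d' : list C) (e : C) (N k : nat) : C :=
  - (Mnorm m N (e + INR k) * (lprod (fun x => Aterm x e N k) c / lprod (fun x => Aterm x e N k) d')
      * (gauss_quot e (S N) * Rcpow (tau N k) (- e) * ((INR (N - k) + 1) / (INR N + 2)))
      * ((INR (fact k) / poch (1 + e) k) * (INR (fact k) / poch (1 + e) k))
      * (((INR (N - k) + 2) / ((INR N + 1) * gauss_quot (- e) (S (N - k)))) *
         ((INR (N - k) + 2) / ((INR N + 1) * gauss_quot (- e) (S (N - k)))))).

(** At s = 1 - y + k only the [Fprod] of [y] vanishes: a second vanishing factor would make [y], or
    its difference from another entry of [d], an integer. *)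
Lemma residue_W (m : nat) (c d : list C) (N k j : nat) (B : C -> C) (r : Rdefinitions.R) :
  length c = (length d + 2)%nat ->
  (forall x, In x c -> notZ x) -> (forall x, In x d -> notZ x) ->
  (forall j k : nat, (j < length d)%nat -> (k < length d)%nat -> j <> k ->
          notZ (nth j d 0 - nth k d 0)) ->
  pfrac (ratfun m c d N) (poles m d N) B r -> (k <= N)%nat -> (j < length d)%nat ->
  scale m c d N * B (1 - nth j d 0 + INR k) = res_shift m c (remove_nth j d) (1 - nth j d 0) N k.
Proof.
  intros Hlen Hc Hd Hdd HPF Hk Hj. set (y := nth j d 0). set (d' := remove_nth j d). set (e := 1 - y).
  assert (Hy : notZ y) by (apply Hd, nth_In; auto).
  assert (He : notZ e) by now apply notZ_one_minus.
  assert (Hd' : forall x, In x d' -> notZ x /\ notZ (x - y)).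
  { intros x Hx. destruct (In_remove_nth d j x Hj Hx) as [i [Hi [Hne ->]]]. split.
    - apply Hd, nth_In; auto.
    - apply Hdd; auto. }
  assert (Hxe : forall x, In x d' -> notZ (x + e) /\ notZ (1 - x - e)).
  { intros x Hx. destruct (Hd' x Hx) as [_ H]. unfold e. split.
    - replace (x + (1 - y)) with ((x - y) + IZR 1) by ring. now apply notZ_plus_Z.
    - replace (1 - x - (1 - y)) with (- (x - y)) by ring. now apply notZ_opp. }
  assert (Hdn : lprod (fun x => ffac x e N k 0) d' <> 0).
  { apply lprod_ffac_neq_0; intros x Hx; apply notZ_np; now apply Hxe. }
  assert (Ho : ffac 1 e N k 0 <> 0).
  { rewrite ffac_0. apply Cmult_neq_0; [apply poch_neq_0, notZ_np|].
    - rewrite Cplus_comm. replace (e + 1) with (e + IZR 1) by ring. now apply notZ_plus_Z.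
    - apply Cmult_neq_0; [apply sgn_neq_0|]. apply poch_neq_0, notZ_np.
      replace (1 - 1 - e) with (- e) by ring. now apply notZ_opp. }
  set (ov := INR (fact k) * (sign_pow (S (N - k)) * (- (1) * INR (fact (N - k))))).
  assert (Hov : ov <> 0).
  { apply Cmult_neq_0; [apply INR_fact_neq_0_C|]. apply Cmult_neq_0; [apply sgn_neq_0|].
    apply Cmult_neq_0; [|apply INR_fact_neq_0_C]. apply Cm1_neq_0. }
  assert (JF : forall x, jet_val (ffac x e N k) (ffac x e N k 0)).
  { intros x. rewrite ffac_0. unfold ffac. apply jet_val_mult; [apply jet_val_poch_p|].
    apply jet_val_mult; [apply jet_val_const|apply jet_val_poch_m]. }
  assert (Hsi : forall i, e + INR k + INR (S i) <> 0).
  { intros i. apply notZ_neq_0. now apply notZ_plus_INR, notZ_plus_INR. }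
  assert (EB : B (e + INR k) = Mprod m N (e + INR k) * lprod (fun x => ffac x e N k 0) c /
      (ov * lprod (fun x => ffac x e N k 0) d' * (ffac 1 e N k 0 * ffac 1 e N k 0))).
  { apply (pfrac_residue_simple (ratfun m c d N) (poles m d N) B r (e + INR k)
      (fun h => Mprod m N (e + INR k + h) * lprod (fun x => ffac x e N k h) c /
        (ofac N k h * lprod (fun x => ffac x e N k h) d' * (ffac 1 e N k h * ffac 1 e N k h)))); auto.
    - unfold poles. rewrite !in_app_iff. left. apply In_dpoles. exists y, k. repeat split; auto.
      apply nth_In; auto.
    - apply jet_val_div.
      + apply jet_val_mult.
        * unfold Mprod. apply (jet_val_cprod m (fun j h => (e + INR k + h - INR N - INR (S j)) / (e + INR k + h + INR (S j)))).
          intros i _. apply jet_val_div; auto.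
          { apply jet_val_ext with (fun h => (e + INR k - INR N - INR (S i)) + 1 * h); [intros; ring|]. apply jet_val_shift. }
          { apply jet_val_ext with (fun h => (e + INR k + INR (S i)) + 1 * h); [intros; ring|]. apply jet_val_shift. }
        * apply (jet_val_lprod c (fun x h => ffac x e N k h)). auto.
      + apply jet_val_mult; [apply jet_val_mult|now apply jet_val_mult].
        * eexists. apply log_jet_ofac.
        * apply (jet_val_lprod d' (fun x h => ffac x e N k h)). auto.
      + apply Cmult_neq_0; [apply Cmult_neq_0; auto|]. now apply Cmult_neq_0.
    - exists 1%R. split; [lra|]. intros h Hh _. unfold ratfun.
      rewrite (nth_split_remove d j Hj (fun x => Fprod x N (e + INR k + h))). fold y d'.
      replace y with (1 - e) by (unfold e; ring). rewrite Fprod_ofac by auto.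
      rewrite (lprod_ext (fun x => Fprod x N (e + INR k + h)) (fun x => ffac x e N k h) c),
              (lprod_ext (fun x => Fprod x N (e + INR k + h)) (fun x => ffac x e N k h) d')
        by (intros; now apply Fprod_ffac).
      rewrite Fprod_ffac by auto.
      unfold Cdiv. rewrite !Cinv_mult.
      set (X := Mprod m N (e + INR k + h) * lprod (fun x => ffac x e N k h) c).
      transitivity (X * (h * / h) * (/ ofac N k h * / lprod (fun x => ffac x e N k h) d' *
          (/ ffac 1 e N k h * / ffac 1 e N k h))); [ring|].
      rewrite Cinv_r by auto. ring. }
  assert (EM : cprod m (fun i => - (1) / (INR N + INR (S i))) * Mprod m N (e + INR k) = Mnorm m N (e + INR k)).
  { apply Mnorm_Mprod. auto. }
  assert (Hc1 : forall x, In x c -> not_pole (1 - x)) by (intros; apply notZ_np, notZ_one_minus; auto).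
  assert (Hd1 : forall x, In x d' -> not_pole (1 - x)).
  { intros x Hx. apply notZ_np, notZ_one_minus. now apply Hd'. }
  rewrite EB. unfold res_shift, scale. rewrite <- EM.
  rewrite (nth_split_remove d j Hj (fun x => poch (1 - x) (S N))). fold y d' e.
  rewrite (lprod_ext (fun x => ffac x e N k 0) _ c (fun x _ => ffac_0 x e N k)) in *.
  rewrite (lprod_ext (fun x => ffac x e N k 0) _ d' (fun x _ => ffac_0 x e N k)) in *.
  rewrite !list_ratio in * by auto. 
  rewrite Hlen, (length_remove_nth d j Hj), Nat.add_comm. fold d'. simpl Nat.add. rewrite !Cpow_S_l.
  assert (EO : ffac 1 e N k 0 = poch (1 + e) k * (sign_pow (S (N - k)) *
      (gauss_quot (- e) (S (N - k)) * (((INR N + 1) * INR (fact N)) * ratio_scale e N k) / (INR (N - k) + 2)))).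
  { rewrite ffac_0. replace (1 - 1 - e) with (- e) by ring. rewrite poch_own.
    rewrite fact_simpl, mult_INR, RtoC_mult, <- RtoC_INR_S. reflexivity. }
  rewrite EO in *.
  (* [scale] still contains the product belonging to [y], while [ofac] has left a bare (N - k)!;
     this formula brings both to the common normalization. *)
  assert (EP : poch e (S N) = gauss_quot e (S N) * Rcpow (tau N k) (- e) * ((INR (N - k) + 1) / (INR N + 2))
                * INR (fact (N - k)) / ratio_scale e N k).
  { rewrite poch_S_gq. unfold ratio_scale. rewrite Rcpow_tau, !Rcpow_opp.
    replace (e - 1) with (e + - (1)) by ring. pose proof (pos_INR N).
    rewrite Rcpow_plus, (Rcpow_opp _ 1), Rcpow_1 by lra. rewrite RtoC_plus.
    rewrite (fact_simpl (N - k)), mult_INR, RtoC_mult, <- RtoC_INR_S.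
    field. repeat split; auto using Rcpow_neq_0, INR_N_2_neq_0, INR_S_neq_0, INR_fact_neq_0_C. }
  rewrite EP.
  assert (HPc : lprod (fun x => poch (1 - x) (S N)) c <> 0) by (apply lprod_neq_0; intros; apply poch_neq_0; auto).
  assert (HPd : lprod (fun x => poch (1 - x) (S N)) d' <> 0) by (apply lprod_neq_0; intros; apply poch_neq_0; auto).
  assert (HAd : lprod (fun x => Aterm x e N k) d' <> 0).
  { intros E. apply Hdn. rewrite E. ring. }
  assert (HT : (INR (fact k) * sign_pow (S (N - k)) * ratio_scale e N k) ^ length d' <> 0).
  { apply Cpow_nz. apply Cmult_neq_0; [apply Cmult_neq_0|]; auto using INR_fact_neq_0_C, sgn_neq_0, ratio_scale_neq_0. }
  set (T := (INR (fact k) * sign_pow (S (N - k)) * ratio_scale e N k) ^ length d') in *.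
  assert (Hg : gauss_quot (- e) (S (N - k)) <> 0) by now apply gauss_quot_neq_0, notZ_np, notZ_opp.
  assert (Hp1 : poch (1 + e) k <> 0).
  { intros E. apply Ho. rewrite E. ring. }
  unfold ov.
  field. repeat split; auto using INR_fact_neq_0_C, sgn_neq_0, ratio_scale_neq_0, INR_S_neq_0, INR_N_2_neq_0.
Qed.

(** * Domination and termwise limits *)

Lemma tau_pos (N k : nat) : (0 < tau N k)%R.
Proof. unfold tau. pose proof (pos_INR N). pose proof (pos_INR (N - k)). apply Rdiv_lt_0_compat; lra. Qed.

Lemma tau_le_1 (N k : nat) : (tau N k <= 1)%R.
Proof.
  unfold tau. pose proof (pos_INR N). assert (INR (N - k) <= INR N)%R by (apply le_INR; lia).
  apply Rmult_le_reg_r with (INR N + 2)%R; [lra|]. unfold Rdiv. rewrite Rmult_assoc, Rinv_l by lra. lra.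
Qed.

(** [al] is the order of growth in k, [be] the order of decay as k approaches N. Exponents add under
    products, so the order of a residue is found by [ring] without tracking constants. *)
Definition dominated (f : nat -> nat -> C) (al be : R) : Prop :=
  exists K, (0 <= K)%R /\ forall N k, (k <= N)%nat ->
    (Cmod (f N k) <= K * (Rpower (INR k + 1) al * Rpower (tau N k) be))%R.

Lemma Rpower_pos (x y : R) : (0 < Rpower x y)%R.
Proof. apply exp_pos. Qed.

Lemma Rpower_0 (x : R) : Rpower x 0 = 1%R.
Proof. unfold Rpower. rewrite Rmult_0_l. apply exp_0. Qed.

Lemma dominated_eq (f : nat -> nat -> C) (a b a' b' : R) : a = a' -> b = b' -> dominated f a b -> dominated f a' b'.
Proof. now intros -> ->. Qed.

Lemma dominated_ext (f g : nat -> nat -> C) (a b : R) : (forall N k, (k <= N)%nat -> f N k = g N k) ->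
  dominated f a b -> dominated g a b.
Proof.
  intros E [K [HK H]]. exists K. split; auto. intros N k Hk. rewrite <- E; auto.
Qed.

Lemma dominated_mult (f g : nat -> nat -> C) (a b a' b' : R) :
  dominated f a b -> dominated g a' b' -> dominated (fun N k => f N k * g N k) (a + a') (b + b').
Proof.
  intros [K [HK H]] [K' [HK' H']]. exists (K * K')%R. split; [now apply Rmult_le_pos|].
  intros N k Hk. rewrite Cmod_mult, !Rpower_plus.
  eapply Rle_trans; [apply Rmult_le_compat; [apply Cmod_ge_0|apply Cmod_ge_0|now apply H|now apply H']|].
  apply Req_le. ring.
Qed.

Lemma dominated_plus (f g : nat -> nat -> C) (a b : R) :
  dominated f a b -> dominated g a b -> dominated (fun N k => f N k + g N k) a b.
Proof.
  intros [K [HK H]] [K' [HK' H']]. exists (K + K')%R. split; [lra|].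
  intros N k Hk. eapply Rle_trans; [apply Cmod_triangle|].
  specialize (H N k Hk). specialize (H' N k Hk). lra.
Qed.

Lemma dominated_opp (f : nat -> nat -> C) (a b : R) : dominated f a b -> dominated (fun N k => - f N k) a b.
Proof. intros [K [HK H]]. exists K. split; auto. intros N k Hk. rewrite Cmod_opp. auto. Qed.

Lemma dominated_bounded (f : nat -> nat -> C) (K : R) :
  (forall N k, (k <= N)%nat -> (Cmod (f N k) <= K)%R) -> dominated f 0 0.
Proof.
  intros H. exists (Rabs K). split; [apply Rabs_pos|]. intros N k Hk. rewrite !Rpower_0, !Rmult_1_r.
  eapply Rle_trans; [now apply H|apply Rle_abs].
Qed.

Lemma dominated_const (a : C) : dominated (fun _ _ => a) 0 0.
Proof. apply dominated_bounded with (Cmod a). intros. lra. Qed.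

Lemma dominated_cprod (m : nat) (f : nat -> nat -> nat -> C) (a b : R) :
  (forall i, (i < m)%nat -> dominated (f i) a b) ->
  dominated (fun N k => cprod m (fun i => f i N k)) (INR m * a) (INR m * b).
Proof.
  induction m as [|m IH]; intros H.
  - simpl. apply dominated_eq with 0%R 0%R; [ring|ring|]. apply dominated_const.
  - rewrite S_INR. simpl. apply dominated_eq with (INR m * a + a)%R (INR m * b + b)%R; [ring|ring|].
    apply dominated_mult; auto.
Qed.

Lemma dominated_csum (m : nat) (f : nat -> nat -> nat -> C) :
  (forall i, (i < m)%nat -> dominated (f i) 0 0) -> dominated (fun N k => csum m (fun i => f i N k)) 0 0.
Proof.
  induction m as [|m IH]; intros H; simpl; [apply dominated_const|]. apply dominated_plus; auto.
Qed.

Definition rlsum (f : C -> R) (l : list C) : R := fold_right (fun x acc => (f x + acc)%R) 0%R l.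

Lemma dominated_lprod (l : list C) (f : C -> nat -> nat -> C) (a b : C -> R) :
  (forall x, In x l -> dominated (f x) (a x) (b x)) ->
  dominated (fun N k => lprod (fun x => f x N k) l) (rlsum a l) (rlsum b l).
Proof.
  induction l as [|x l IH]; intros H; simpl; [apply dominated_const|].
  apply dominated_mult; [apply H|apply IH; intros; apply H]; simpl; auto.
Qed.

Lemma dominated_lsum (l : list C) (f : C -> nat -> nat -> C) :
  (forall x, In x l -> dominated (f x) 0 0) -> dominated (fun N k => lsum (fun x => f x N k) l) 0 0.
Proof.
  induction l as [|x l IH]; intros H; simpl; [apply dominated_const|].
  apply dominated_plus; [apply H|apply IH; intros; apply H]; simpl; auto.
Qed.

Lemma rlsum_affine (u v : R) (l : list C) :
  rlsum (fun x => u * Re x + v)%R l = (u * rlsum Re l + INR (length l) * v)%R.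
Proof.
  induction l as [|x l IH]; [simpl; ring|].
  change (u * Re x + v + rlsum (fun x => u * Re x + v)%R l = u * (Re x + rlsum Re l) + INR (S (length l)) * v)%R.
  rewrite IH, S_INR. ring.
Qed.

Lemma rlsum_Re (l : list C) : Re (lsum (fun x => x) l) = rlsum Re l.
Proof.
  induction l as [|x l IH]; [reflexivity|]. rewrite lsum_cons.
  change (Re (x + lsum (fun x => x) l) = Re x + rlsum Re l)%R. rewrite <- IH. reflexivity.
Qed.

Lemma rlsum_split (l : list C) (j : nat) : (j < length l)%nat ->
  rlsum Re l = (Re (nth j l 0) + rlsum Re (remove_nth j l))%R.
Proof.
  revert j. induction l as [|x l IH]; intros j Hj; [simpl in Hj; lia|].
  destruct j as [|j]; [reflexivity|]. simpl in Hj.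
  change (remove_nth (S j) (x :: l)) with (x :: remove_nth j l).
  change (Re x + rlsum Re l = Re (nth j l 0) + (Re x + rlsum Re (remove_nth j l)))%R.
  rewrite (IH j) by lia. ring.
Qed.

Lemma lprod_inv (f : C -> C) (l : list C) : lprod (fun x => / f x) l = / lprod f l.
Proof.
  induction l as [|x l IH]; [simpl; field; apply C1_nz|]. rewrite !lprod_cons, IH, Cinv_mult. reflexivity.
Qed.

Lemma gauss_quot_bound (z : C) : exists K, (0 < K)%R /\ forall n, (Cmod (gauss_quot z n) <= K)%R.
Proof. apply Ccvg_bounded with (1 := gauss_quot_Cv z). Qed.

Lemma gauss_quot_inv_bound (z : C) : not_pole z -> exists K, (0 < K)%R /\ forall n, (Cmod (/ gauss_quot z n) <= K)%R.
Proof. intros Hz. exact (Ccvg_bounded _ _ (Ccvg_inv _ _ (gauss_quot_Cv z) (rGamma_neq_0 z Hz))). Qed.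

Lemma dominated_poch (x : C) : dominated (fun N k => poch x k / INR (fact k)) (Re x - 1) 0.
Proof.
  destruct (gauss_quot_bound x) as [K [HK H]]. exists K. split; [lra|]. intros N k _.
  rewrite Rpower_0, Rmult_1_r, poch_gq.
  replace (gauss_quot x k * (INR (fact k) * Rcpow (INR k + 1) (x - 1)) / INR (fact k)) with
    (gauss_quot x k * Rcpow (INR k + 1) (x - 1)) by (field; apply INR_fact_neq_0_C).
  rewrite Cmod_mult, Cmod_Rcpow. replace (Re (x - 1)) with (Re x - 1)%R by (unfold Re; simpl; ring).
  apply Rmult_le_compat_r; auto. left. apply Rpower_pos.
Qed.

Lemma dominated_poch_inv (x : C) : not_pole x -> dominated (fun N k => / (poch x k / INR (fact k))) (1 - Re x) 0.
Proof.
  intros Hx. destruct (gauss_quot_inv_bound x Hx) as [K [HK H]]. exists K. split; [lra|]. intros N k _.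
  rewrite Rpower_0, Rmult_1_r, poch_gq. pose proof (gauss_quot_neq_0 x k Hx).
  replace (/ (gauss_quot x k * (INR (fact k) * Rcpow (INR k + 1) (x - 1)) / INR (fact k))) with
    (/ gauss_quot x k * Rcpow (INR k + 1) (- (x - 1))).
  - rewrite Cmod_mult, Cmod_Rcpow. replace (Re (- (x - 1))) with (1 - Re x)%R by (unfold Re; simpl; ring).
    apply Rmult_le_compat_r; auto. left. apply Rpower_pos.
  - rewrite Rcpow_opp. field. repeat split; auto using Rcpow_neq_0, INR_fact_neq_0_C.
Qed.

Lemma dominated_gq (z : C) (phi : nat -> nat -> nat) : dominated (fun N k => gauss_quot z (phi N k)) 0 0.
Proof. destruct (gauss_quot_bound z) as [K [HK H]]. apply dominated_bounded with K. auto. Qed.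

Lemma dominated_gq_inv (z : C) (phi : nat -> nat -> nat) : not_pole z -> dominated (fun N k => / gauss_quot z (phi N k)) 0 0.
Proof. intros Hz. destruct (gauss_quot_inv_bound z Hz) as [K [HK H]]. apply dominated_bounded with K. auto. Qed.

Lemma dominated_tau (z : C) : dominated (fun N k => Rcpow (tau N k) z) 0 (Re z).
Proof.
  exists 1%R. split; [lra|]. intros N k _. rewrite Rpower_0, Cmod_Rcpow. lra.
Qed.

Lemma dominated_real (f : nat -> nat -> R) (K : R) : (0 <= K)%R ->
  (forall N k, (k <= N)%nat -> (Rabs (f N k) <= K * tau N k)%R) ->
  dominated (fun N k => RtoC (f N k)) 0 1.
Proof.
  intros HK H. exists K. split; auto. intros N k Hk.
  rewrite Rpower_0, Rmult_1_l, Rpower_1, Cmod_R by apply tau_pos. auto.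
Qed.

Lemma Rdiv_le_intro (a b c : R) : (0 < b)%R -> (a <= c * b)%R -> (a / b <= c)%R.
Proof.
  intros Hb H. apply Rmult_le_reg_r with b; auto. unfold Rdiv. rewrite Rmult_assoc, Rinv_l by lra. lra.
Qed.

Lemma dominated_lin (u v : R) : (0 <= u <= 2)%R -> (1 <= v)%R ->
  dominated (fun N k => (INR (N - k) + u) / (INR N + v)) 0 1.
Proof.
  intros Hu Hv. apply dominated_ext with (fun N k => RtoC ((INR (N - k) + u) / (INR N + v))).
  { intros N k _. pose proof (pos_INR N). rewrite RtoC_div, !RtoC_plus by lra. reflexivity. }
  apply dominated_real with 2%R; [lra|]. intros N k Hk. pose proof (pos_INR N). pose proof (pos_INR (N - k)).
  rewrite Rabs_pos_eq by (apply Rmult_le_pos; [lra|left; apply Rinv_0_lt_compat; lra]).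
  apply Rdiv_le_intro; [lra|]. unfold tau.
  replace (2 * ((INR (N - k) + 2) / (INR N + 2)) * (INR N + v))%R with
    ((INR (N - k) + 2) * (2 * (INR N + v) / (INR N + 2)))%R by (field; lra).
  assert (1 <= 2 * (INR N + v) / (INR N + 2))%R.
  { apply Rmult_le_reg_r with (INR N + 2)%R; [lra|]. unfold Rdiv. rewrite Rmult_assoc, Rinv_l by lra. lra. }
  nra.
Qed.

Lemma dominated_recip (z : C) : not_pole z -> dominated (fun N k => / (z + INR k)) (- (1)) 0.
Proof.
  intros Hz. destruct (not_pole_inv_bound z Hz) as [K [HK [H _]]]. exists K. split; auto. intros N k _.
  pose proof (pos_INR k). rewrite Rpower_0, Rmult_1_r, Rpower_Ropp, Rpower_1 by lra. apply H.
Qed.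

(** Each factor has a numerator comparable to N - k over N, one power of [tau], and a denominator
    comparable to k + 1. *)
Lemma dominated_MV (m : nat) (e : C) : not_pole (e + 1) -> dominated (fun N k => Mnorm m N (e + INR k)) (- INR m) (INR m).
Proof.
  intros He. unfold Mnorm. apply dominated_eq with (INR m * (- (1)))%R (INR m * 1)%R; [ring|ring|].
  apply (dominated_cprod m (fun i N k => (INR N + INR (S i) - (e + INR k)) / ((INR N + INR (S i)) * (e + INR k + INR (S i))))).
  intros i _.
  assert (Hei : not_pole (e + INR (S i))).
  { rewrite <- RtoC_INR_S. replace (e + (INR i + 1)) with (e + 1 + INR i) by ring. now apply not_pole_plus. }
  apply dominated_ext with (fun N k => ((INR N + INR (S i) - (e + INR k)) / (INR N + INR (S i))) * / (e + INR (S i) + INR k)).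
  { intros N k _. unfold Cdiv. rewrite Cinv_mult.
    replace (e + INR k + INR (S i)) with (e + INR (S i) + INR k) by ring. ring. }
  apply dominated_eq with (0 + - (1))%R (1 + 0)%R; [ring|ring|]. apply dominated_mult; [|now apply dominated_recip].
  pose proof (Cmod_ge_0 (INR (S i) - e)) as H0.
  exists (2 * (1 + Cmod (INR (S i) - e)))%R. split; [lra|]. intros N k Hk.
  rewrite Rpower_0, Rmult_1_l, Rpower_1 by apply tau_pos.
  rewrite Cmod_div by apply N_plus_S_neq_0. rewrite <- RtoC_plus, Cmod_R.
  pose proof (pos_INR N). pose proof (pos_INR i). rewrite Rabs_pos_eq by (rewrite S_INR; lra).
  assert (Hn : (Cmod (RtoC (INR N + INR (S i)) - (e + INR k)) <= (INR (N - k) + 2) * (1 + Cmod (INR (S i) - e)))%R).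
  { replace (RtoC (INR N + INR (S i)) - (e + INR k)) with (RtoC (INR (N - k)) + (INR (S i) - e))
      by (rewrite minus_INR, RtoC_plus, RtoC_minus by auto; ring).
    eapply Rle_trans; [apply Cmod_triangle|]. pose proof (pos_INR (N - k)).
    rewrite Cmod_R, Rabs_pos_eq by auto. nra. }
  set (D := Cmod (INR (S i) - e)) in *. apply Rdiv_le_intro; [rewrite S_INR; lra|].
  eapply Rle_trans; [exact Hn|]. rewrite S_INR. unfold tau. pose proof (pos_INR (N - k)).
  replace (2 * (1 + D) * ((INR (N - k) + 2) / (INR N + 2)) * (INR N + (INR i + 1)))%R
    with ((INR (N - k) + 2) * (1 + D) * (2 * (INR N + (INR i + 1)) / (INR N + 2)))%R by (field; lra).
  rewrite <- (Rmult_1_r ((INR (N - k) + 2) * (1 + D))) at 1. apply Rmult_le_compat_l.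
  - apply Rmult_le_pos; lra.
  - apply Rmult_le_reg_r with (INR N + 2)%R; [lra|]. unfold Rdiv. rewrite Rmult_assoc, Rinv_l by lra. lra.
Qed.

Lemma dominated_rho (x e : C) : not_pole (1 - x) -> dominated (rho x e) 0 (- Re x).
Proof.
  intros Hx. unfold rho, Cdiv.
  apply dominated_eq with (0 + 0 + 0)%R (0 + 0 + Re (- x))%R; [ring|unfold Re; simpl; ring|].
  apply dominated_mult; [|apply dominated_tau]. apply dominated_mult.
  - apply (dominated_gq _ (fun N k => S (N - k))).
  - now apply (dominated_gq_inv _ (fun N k => S N)).
Qed.

Lemma dominated_rho_inv (x e : C) : not_pole (1 - x) -> not_pole (1 - x - e) -> dominated (fun N k => / rho x e N k) 0 (Re x).
Proof.
  intros Hx Hxe.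
  apply dominated_ext with (fun N k => gauss_quot (1 - x) (S N) * / gauss_quot (1 - x - e) (S (N - k)) * Rcpow (tau N k) x).
  { intros N k _. unfold rho. rewrite Rcpow_opp.
    pose proof (gauss_quot_neq_0 _ (S N) Hx). pose proof (gauss_quot_neq_0 _ (S (N - k)) Hxe).
    field. repeat split; auto using Rcpow_neq_0. }
  apply dominated_eq with (0 + 0 + 0)%R (0 + 0 + Re x)%R; [ring|ring|].
  apply dominated_mult; [|apply dominated_tau]. apply dominated_mult.
  - apply (dominated_gq _ (fun N k => S N)).
  - now apply (dominated_gq_inv _ (fun N k => S (N - k))).
Qed.

Lemma dominated_Aterm_list (l : list C) (e : C) : (forall x, In x l -> not_pole (1 - x)) ->
  dominated (fun N k => lprod (fun x => Aterm x e N k) l)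
     (rlsum Re l + INR (length l) * (Re e - 1)) (- rlsum Re l).
Proof.
  intros H. apply dominated_eq with (rlsum (fun x => 1 * Re x + (Re e - 1))%R l) (rlsum (fun x => (- (1)) * Re x + 0)%R l).
  - rewrite rlsum_affine. ring.
  - rewrite rlsum_affine. ring.
  - apply (dominated_lprod l (fun x => Aterm x e)). intros x Hx. unfold Aterm.
    apply dominated_eq with (Re (x + e) - 1 + 0)%R (0 + - Re x)%R; [unfold Re; simpl; ring|ring|].
    apply dominated_mult; [apply dominated_poch|]. apply dominated_rho; auto.
Qed.

Lemma dominated_Aterm_list_inv (l : list C) (e : C) : (forall x, In x l -> not_pole (1 - x)) ->
  (forall x, In x l -> not_pole (x + e)) -> (forall x, In x l -> not_pole (1 - x - e)) ->
  dominated (fun N k => / lprod (fun x => Aterm x e N k) l)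
     (- (rlsum Re l + INR (length l) * (Re e - 1))) (rlsum Re l).
Proof.
  intros H0 H1 H2.
  apply dominated_ext with (fun N k => lprod (fun x => / Aterm x e N k) l).
  { intros N k _. apply lprod_inv. }
  apply dominated_eq with (rlsum (fun x => (- (1)) * Re x + (1 - Re e))%R l) (rlsum (fun x => 1 * Re x + 0)%R l).
  - rewrite rlsum_affine. ring.
  - rewrite rlsum_affine. ring.
  - apply (dominated_lprod l (fun x N k => / Aterm x e N k)). intros x Hx. unfold Aterm.
    apply dominated_ext with (fun N k => / (poch (x + e) k / INR (fact k)) * / rho x e N k).
    { intros N k _. now rewrite Cinv_mult. }
    apply dominated_eq with (1 - Re (x + e) + 0)%R (0 + Re x)%R; [unfold Re; simpl; ring|ring|].
    apply dominated_mult; [apply dominated_poch_inv; auto|]. apply dominated_rho_inv; auto.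
Qed.

Definition dig_diff (x : C) (N k : nat) : C := dig_partial x k - dig_partial (1 - x) (S (N - k)).

Lemma lsum_const (a : C) (l : list C) : lsum (fun _ => a) l = INR (length l) * a.
Proof.
  induction l as [|x l IH]; [simpl; ring|]. rewrite lsum_cons, IH. simpl length. rewrite <- RtoC_INR_S. ring.
Qed.

(** The harmonic sums grow logarithmically, but in terms of [dig_partial] every piece is bounded and
    convergent. The logarithms cancel since the two surplus entries of [c] match the factor 2. The
    term [recip 1 (N - k)] completes the sum that stops one step early. *)
Lemma logder_alt (m : nat) (c d : list C) (N k : nat) : length c = (length d + 2)%nat ->
  logder m c d N k =
  - csum m (fun i => / (INR N + INR (S i) - INR k) + / (INR k + INR (S i)))
  + lsum (fun x => dig_diff x N k) c - lsum (fun x => dig_diff x N k) d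
  - 2 * (dig_partial 1 k - dig_partial 1 (S (N - k)) + recip 1 (N - k)).
Proof.
  intros Hlen. unfold logder.
  set (w := RtoC (ln (INR k + 1)) - RtoC (ln (INR (S (N - k)) + 1))).
  assert (E : forall l, lsum (fun x => csum k (recip x) - csum (S (N - k)) (recip (1 - x))) l =
     lsum (fun x => dig_diff x N k) l + INR (length l) * w).
  { intros l. rewrite <- lsum_const, <- lsum_plus. apply lsum_ext. intros x _.
    unfold dig_diff, dig_partial, w. ring. }
  rewrite !E, Hlen, plus_INR, RtoC_plus. simpl (INR 2).
  unfold dig_partial. simpl (csum (S (N - k)) _). rewrite RtoC_plus. unfold w. ring.
Qed.

Lemma dig_partial_bound (z : C) : not_pole z -> exists K, (0 < K)%R /\ forall n, (Cmod (dig_partial z n) <= K)%R.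
Proof. intros Hz. exact (Ccvg_bounded _ _ (digamma_Cv z Hz)). Qed.

Lemma dominated_dig_partial (z : C) (phi : nat -> nat -> nat) : not_pole z -> dominated (fun N k => dig_partial z (phi N k)) 0 0.
Proof. intros Hz. destruct (dig_partial_bound z Hz) as [K [HK H]]. apply dominated_bounded with K. auto. Qed.

Lemma dominated_dig_diff (x : C) : notZ x -> dominated (dig_diff x) 0 0.
Proof.
  intros Hx. unfold dig_diff, Cminus. apply dominated_plus.
  - apply (dominated_dig_partial x (fun N k => k)). now apply notZ_np.
  - apply dominated_opp. apply (dominated_dig_partial (1 - x) (fun N k => S (N - k))). now apply notZ_np, notZ_one_minus.
Qed.

Lemma Cmod_inv_nat_le (a : R) : (1 <= a)%R -> (Cmod (/ RtoC a) <= 1)%R.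
Proof.
  intros Ha. rewrite <- RtoC_inv, Cmod_R by lra.
  assert (0 < / a)%R by (apply Rinv_0_lt_compat; lra). rewrite Rabs_pos_eq by lra.
  rewrite <- Rinv_1. apply Rinv_le_contravar; lra.
Qed.

Lemma dominated_Llog (m : nat) (c d : list C) : length c = (length d + 2)%nat ->
  (forall x, In x c -> notZ x) -> (forall x, In x d -> notZ x) -> dominated (logder m c d) 0 0.
Proof.
  intros Hlen Hc Hd.
  apply dominated_ext with (fun N k => - csum m (fun i => / (INR N + INR (S i) - INR k) + / (INR k + INR (S i)))
    + lsum (fun x => dig_diff x N k) c + - lsum (fun x => dig_diff x N k) d
    + - (2 * (dig_partial 1 k - dig_partial 1 (S (N - k)) + recip 1 (N - k)))).
  { intros N k _. now rewrite logder_alt. }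
  apply dominated_plus; [apply dominated_plus; [apply dominated_plus|]|].
  - apply dominated_opp. apply (dominated_csum m (fun i N k => / (INR N + INR (S i) - INR k) + / (INR k + INR (S i)))).
    intros i _. apply dominated_bounded with 2%R. intros N k Hk. apply le_INR in Hk.
    pose proof (pos_INR k). pose proof (pos_INR i).
    eapply Rle_trans; [apply Cmod_triangle|].
    rewrite <- !RtoC_plus, <- RtoC_minus, S_INR.
    pose proof (Cmod_inv_nat_le (INR N + (INR i + 1) - INR k) ltac:(lra)).
    pose proof (Cmod_inv_nat_le (INR k + (INR i + 1)) ltac:(lra)). lra.
  - apply (dominated_lsum c dig_diff). intros; apply dominated_dig_diff; auto.
  - apply dominated_opp. apply (dominated_lsum d dig_diff). intros; apply dominated_dig_diff; auto.
  - apply dominated_opp. apply dominated_eq with (0 + 0)%R (0 + 0)%R; [ring|ring|].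
    apply dominated_mult; [apply dominated_const|]. apply dominated_plus; [apply dominated_plus|].
    + apply (dominated_dig_partial 1 (fun N k => k)), not_pole_1.
    + apply dominated_opp. apply (dominated_dig_partial 1 (fun N k => S (N - k))), not_pole_1.
    + apply dominated_bounded with 1%R. intros N k _. unfold recip. rewrite <- RtoC_plus.
      apply Cmod_inv_nat_le. pose proof (pos_INR (N - k)). lra.
Qed.

Lemma not_pole_0_plus (x : C) : not_pole x -> not_pole (x + 0).
Proof. now rewrite Cplus_0_r. Qed.

Lemma Re_0 : Re 0 = 0%R.
Proof. reflexivity. Qed.

(** Count of exponents: an entry x of [c] gives k^(Re x - 1) and tau^(-Re x), an entry of [d] the
    inverse, each of the m negative poles 1/k and [tau], and the two linear factors [tau] each. *)
Lemma dominated_Ucf (m : nat) (c d : list C) : length c = (length d + 2)%nat ->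
  (forall x, In x c -> notZ x) -> (forall x, In x d -> notZ x) ->
  dominated (res_double_coef m c d) (- (INR m + 2 + rlsum Re d - rlsum Re c)) (INR m + 2 + rlsum Re d - rlsum Re c).
Proof.
  intros Hlen Hc Hd. unfold res_double_coef, Cdiv at 1.
  apply dominated_eq with
    (- INR m + ((rlsum Re c + INR (length c) * (Re 0 - 1)) + - (rlsum Re d + INR (length d) * (Re 0 - 1))) + (0 + 0))%R
    (INR m + (- rlsum Re c + rlsum Re d) + (1 + 1))%R.
  - rewrite Hlen, plus_INR, Re_0. simpl (INR 2). ring.
  - ring.
  - apply dominated_mult; [apply dominated_mult|].
    + apply dominated_ext with (fun N k => Mnorm m N (0 + INR k)); [intros; now rewrite Cplus_0_l|].
      apply dominated_MV. rewrite Cplus_0_l. apply not_pole_1.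
    + apply dominated_mult.
      * apply dominated_Aterm_list. intros; apply notZ_np, notZ_one_minus; auto.
      * apply dominated_Aterm_list_inv.
        -- intros; apply notZ_np, notZ_one_minus; auto.
        -- intros; apply not_pole_0_plus, notZ_np; auto.
        -- intros x Hx. unfold Cminus at 1. rewrite Copp_0. apply not_pole_0_plus, notZ_np, notZ_one_minus; auto.
    + apply dominated_mult; apply dominated_lin; lra.
Qed.

Lemma dominated_U (m : nat) (c d : list C) : length c = (length d + 2)%nat ->
  (forall x, In x c -> notZ x) -> (forall x, In x d -> notZ x) ->
  dominated (res_double m c d) (- (INR m + 2 + rlsum Re d - rlsum Re c)) (INR m + 2 + rlsum Re d - rlsum Re c).
Proof.
  intros Hlen Hc Hd. eapply dominated_eq; [apply Rplus_0_r|apply Rplus_0_r|].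
  apply dominated_mult; [now apply dominated_Ucf|now apply dominated_Llog].
Qed.

(** The same exponent as at the double poles. The entry whose pole is taken has real part Re(1 - e)
    and acts through tau^(-e) and linear factors instead of through an [Aterm]. *)
Lemma dominated_W (m : nat) (c d' : list C) (e : C) : length c = (length d' + 3)%nat -> notZ e ->
  (forall x, In x c -> notZ x) ->
  (forall x, In x d' -> notZ x /\ notZ (x + e) /\ notZ (1 - x - e)) ->
  dominated (res_shift m c d' e) (- (INR m + 2 + (rlsum Re d' + Re (1 - e)) - rlsum Re c))
     (INR m + 2 + (rlsum Re d' + Re (1 - e)) - rlsum Re c).
Proof.
  intros Hlen He Hc Hd. unfold res_shift. apply dominated_opp.
  apply dominated_ext with (fun N k =>
    Mnorm m N (e + INR k) * (lprod (fun x => Aterm x e N k) c * / lprod (fun x => Aterm x e N k) d') *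
    (gauss_quot e (S N) * Rcpow (tau N k) (- e) * ((INR (N - k) + 1) / (INR N + 2))) *
    (/ (poch (1 + e) k / INR (fact k)) * / (poch (1 + e) k / INR (fact k))) *
    (((INR (N - k) + 2) / (INR N + 1) * / gauss_quot (- e) (S (N - k))) *
     ((INR (N - k) + 2) / (INR N + 1) * / gauss_quot (- e) (S (N - k))))).
  { intros N k _. assert (H1 : not_pole (1 + e)).
    { rewrite Cplus_comm. apply notZ_np. replace (e + 1) with (e + IZR 1) by ring. now apply notZ_plus_Z. }
    unfold Cdiv. rewrite !Cinv_mult.
    replace (/ / RtoC (INR (fact k))) with (RtoC (INR (fact k))) by (field; apply INR_fact_neq_0_C). ring. }
  apply dominated_eq with
    (- INR m + ((rlsum Re c + INR (length c) * (Re e - 1)) + - (rlsum Re d' + INR (length d') * (Re e - 1)))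
       + (0 + 0 + 0) + ((1 - Re (1 + e)) + (1 - Re (1 + e))) + ((0 + 0) + (0 + 0)))%R
    (INR m + (- rlsum Re c + rlsum Re d') + (0 + Re (- e) + 1) + (0 + 0) + ((1 + 0) + (1 + 0)))%R.
  - rewrite Hlen, plus_INR. replace (INR 3) with 3%R by (simpl; ring). unfold Re; simpl; ring.
  - unfold Re; simpl; ring.
  - apply dominated_mult; [apply dominated_mult; [apply dominated_mult; [apply dominated_mult|]|]|].
    + apply dominated_MV. apply notZ_np. replace (e + 1) with (e + IZR 1) by ring. now apply notZ_plus_Z.
    + apply dominated_mult.
      * apply dominated_Aterm_list. intros; apply notZ_np, notZ_one_minus; auto.
      * apply dominated_Aterm_list_inv; intros x Hx; destruct (Hd x Hx) as [H1 [H2 H3]]; apply notZ_np; auto.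
        now apply notZ_one_minus.
    + apply dominated_mult; [apply dominated_mult|].
      * apply (dominated_gq e (fun N k => S N)).
      * apply dominated_tau.
      * apply dominated_lin; lra.
    + assert (H1 : not_pole (1 + e)).
      { rewrite Cplus_comm. apply notZ_np. replace (e + 1) with (e + IZR 1) by ring. now apply notZ_plus_Z. }
      apply dominated_mult; now apply dominated_poch_inv.
    + assert (H1 : not_pole (- e)) by now apply notZ_np, notZ_opp.
      apply dominated_mult; (apply dominated_mult; [apply dominated_lin; lra|now apply (dominated_gq_inv (- e) (fun N k => S (N - k)))]).
Qed.

Lemma dominated_poch_S (x : C) : dominated (fun N k => poch x (S k) / INR (fact (S k))) (Re x - 1) 0.
Proof.
  apply dominated_ext with (fun N k => poch x k / INR (fact k) * ((x + INR k) / (INR k + 1))).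
  { intros N k _. rewrite poch_S, fact_simpl, mult_INR, RtoC_mult, <- RtoC_INR_S.
    field. split; auto using INR_S_neq_0, INR_fact_neq_0_C. }
  apply dominated_eq with (Re x - 1 + 0)%R (0 + 0)%R; [ring|ring|]. apply dominated_mult; [apply dominated_poch|].
  destruct (Ccvg_bounded _ _ (Ccvg_linear_ratio x)) as [K [HK H]]. apply dominated_bounded with K. auto.
Qed.

Lemma dominated_poch_S_inv (x : C) : not_pole x -> dominated (fun N k => / (poch x (S k) / INR (fact (S k)))) (1 - Re x) 0.
Proof.
  intros Hx. apply dominated_ext with (fun N k => / (poch x k / INR (fact k)) * / ((x + INR k) / (INR k + 1))).
  { intros N k _. rewrite <- Cinv_mult. f_equal. rewrite poch_S, fact_simpl, mult_INR, RtoC_mult, <- RtoC_INR_S.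
    field. split; auto using INR_S_neq_0, INR_fact_neq_0_C. }
  apply dominated_eq with (1 - Re x + 0)%R (0 + 0)%R; [ring|ring|]. apply dominated_mult; [now apply dominated_poch_inv|].
  destruct (Ccvg_bounded _ _ (Ccvg_inv _ _ (Ccvg_linear_ratio x) C1_nz)) as [K [HK H]]. apply dominated_bounded with K. auto.
Qed.

Lemma lprod_scal (a : C) (f : C -> C) (l : list C) :
  lprod (fun x => a * f x) l = a ^ length l * lprod f l.
Proof.
  induction l as [|x l IH]; [simpl; ring|]. rewrite !lprod_cons, IH. simpl length. rewrite Cpow_S_l. ring.
Qed.

(** The normalization is measured in its own index, called [k], so that the same calculus yields its
    size k^(-b). Dividing each Pochhammer product by (k + 1)! leaves (k!/(k + 1)!)^2, thanks to the
    two surplus entries of [c]. *)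
Lemma dominated_Qs (m : nat) (c d : list C) : length c = (length d + 2)%nat ->
  (forall x, In x c -> notZ x) -> (forall x, In x d -> notZ x) ->
  dominated (fun N k => scale m c d k) (- (INR m + 2 + rlsum Re d - rlsum Re c)) 0.
Proof.
  intros Hlen Hc Hd.
  apply dominated_ext with (fun N k => cprod m (fun i => - (1) * / (INR (S i) + INR k)) *
    (/ (1 + INR k) * / (1 + INR k)) *
    (lprod (fun x => poch (1 - x) (S k) / INR (fact (S k))) d *
     lprod (fun x => / (poch (1 - x) (S k) / INR (fact (S k)))) c)).
  { intros N k _. unfold scale.
    rewrite (cprod_ext m (fun i => - (1) * / (INR (S i) + INR k)) (fun i => - (1) / (INR k + INR (S i))))
      by (intros; unfold Cdiv; f_equal; f_equal; ring).
    rewrite lprod_inv.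
    rewrite (lprod_ext (fun x => poch (1 - x) (S k) / INR (fact (S k))) (fun x => / INR (fact (S k)) * poch (1 - x) (S k)) d),
      (lprod_ext (fun x => poch (1 - x) (S k) / INR (fact (S k))) (fun x => / INR (fact (S k)) * poch (1 - x) (S k)) c)
      by (intros; unfold Cdiv; ring).
    rewrite !lprod_scal, Hlen, Nat.add_comm. simpl Nat.add. rewrite !Cpow_S_l.
    assert (HPc : lprod (fun x => poch (1 - x) (S k)) c <> 0).
    { apply lprod_neq_0; intros; apply poch_neq_0, notZ_np, notZ_one_minus; auto. }
    assert (Hf : / RtoC (INR (fact (S k))) <> 0).
    { replace (/ RtoC (INR (fact (S k)))) with (1 / RtoC (INR (fact (S k)))) by (unfold Cdiv; ring).
      apply Cdiv_neq_0; auto using C1_nz, INR_fact_neq_0_C. }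
    assert (HT : (/ RtoC (INR (fact (S k)))) ^ length d <> 0) by now apply Cpow_nz.
    set (T := (/ RtoC (INR (fact (S k)))) ^ length d) in *.
    rewrite fact_simpl, mult_INR, RtoC_mult, <- RtoC_INR_S.
    field. repeat split; auto using INR_fact_neq_0_C, INR_S_neq_0. }
  apply dominated_eq with (INR m * (- (1)) + (- (1) + - (1)) +
     (rlsum (fun x => (- (1)) * Re x + 0)%R d + rlsum (fun x => 1 * Re x + 0)%R c))%R
     (INR m * 0 + (0 + 0) + (rlsum (fun x => 0 * Re x + 0)%R d + rlsum (fun x => 0 * Re x + 0)%R c))%R.
  - rewrite !rlsum_affine. ring.
  - rewrite !rlsum_affine. ring.
  - apply dominated_mult; [apply dominated_mult|].
    + apply (dominated_cprod m (fun i N k => - (1) * / (INR (S i) + INR k))). intros i _.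
      apply dominated_eq with (0 + - (1))%R (0 + 0)%R; [ring|ring|].
      apply dominated_mult; [apply dominated_const|apply dominated_recip, not_pole_S_INR].
    + apply dominated_mult; apply dominated_recip, not_pole_1.
    + apply dominated_mult.
      * apply (dominated_lprod d (fun x N k => poch (1 - x) (S k) / INR (fact (S k)))). intros x _.
        apply dominated_eq with (Re (1 - x) - 1)%R 0%R; [unfold Re; simpl; ring|ring|]. apply dominated_poch_S.
      * apply (dominated_lprod c (fun x N k => / (poch (1 - x) (S k) / INR (fact (S k))))). intros x Hx.
        apply dominated_eq with (1 - Re (1 - x))%R 0%R; [unfold Re; simpl; ring|ring|].
        apply dominated_poch_S_inv, notZ_np, notZ_one_minus; auto.
Qed.

(** * Limits of the normalized residues *)

Lemma filterlim_minus (k : nat) : filterlim (fun N => (N - k)%nat) eventually eventually.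
Proof. intros P [N HN]. exists (N + k)%nat. intros n Hn. apply HN. lia. Qed.

Lemma Ccvg_lprod (l : list C) (u : C -> nat -> C) (v : C -> C) :
  (forall x, In x l -> Ccvg (u x) (v x)) -> Ccvg (fun n => lprod (fun x => u x n) l) (lprod v l).
Proof.
  induction l as [|x l IH]; intros H; simpl; [apply Ccvg_const|].
  apply Ccvg_mult; [apply H|apply IH; intros; apply H]; simpl; auto.
Qed.

Lemma Ccvg_lsum (l : list C) (u : C -> nat -> C) (v : C -> C) :
  (forall x, In x l -> Ccvg (u x) (v x)) -> Ccvg (fun n => lsum (fun x => u x n) l) (lsum v l).
Proof.
  induction l as [|x l IH]; intros H; simpl; [apply Ccvg_const|].
  apply Ccvg_plus; [apply H|apply IH; intros; apply H]; simpl; auto.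
Qed.

Lemma lim_inv_INR_plus (v : R) : (1 <= v)%R -> is_lim_seq (fun n => / (INR n + v))%R 0.
Proof.
  intros Hv. apply lim0_le with (fun n => / (INR n + 1))%R; [|apply is_lim_seq_inv_INR].
  intros n. pose proof (pos_INR n). split; [left; apply Rinv_0_lt_compat; lra|].
  apply Rinv_le_contravar; lra.
Qed.

Lemma lim_lin (u v : R) (k : nat) : (1 <= v)%R ->
  is_lim_seq (fun N => (INR (N - k) + u) / (INR N + v))%R 1.
Proof.
  intros Hv. apply is_lim_seq_ext_loc with (fun N => 1 + (u - INR k - v) * / (INR N + v))%R.
  - exists k. intros N HN. rewrite minus_INR by auto. pose proof (pos_INR N). field. lra.
  - replace (Finite 1) with (Finite (1 + (u - INR k - v) * 0)) by (f_equal; ring).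
    apply is_lim_seq_plus'; [apply is_lim_seq_const|].
    apply is_lim_seq_mult'; [apply is_lim_seq_const|]. now apply lim_inv_INR_plus.
Qed.

Lemma Ccvg_lin (u v : R) (k : nat) : (1 <= v)%R ->
  Ccvg (fun N => (INR (N - k) + u) / (INR N + v)) 1.
Proof.
  intros Hv. apply Ccvg_ext with (fun N => RtoC ((INR (N - k) + u) / (INR N + v))).
  - intros N. pose proof (pos_INR N). rewrite RtoC_div, !RtoC_plus by lra. reflexivity.
  - apply Ccvg_RtoC. now apply lim_lin.
Qed.

Lemma Ccvg_Cexp_0 (w : nat -> C) : Ccvg w 0 -> Ccvg (fun n => Cexp (w n)) 1.
Proof.
  intros Hw. apply lim0_le_loc with (fun n => (1 + 4 * exp 1) * Cmod (w n - 0))%R.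
  - destruct (Ccvg_eps _ _ Hw 1 ltac:(lra)) as [N HN]. exists N. intros n Hge. specialize (HN n Hge).
    split; [apply Cmod_ge_0|]. replace (w n - 0) with (w n) in * by ring.
    eapply Rle_trans; [apply (Cmod_le_add _ (w n))|]. pose proof (Cexp_expansion (w n)) as HE.
    pose proof (Cmod_ge_0 (w n)).
    assert (exp (Cmod (w n)) <= exp 1)%R by (left; now apply exp_increasing).
    assert (4 * (Cmod (w n) * Cmod (w n)) * exp (Cmod (w n)) <= 4 * Cmod (w n) * exp 1)%R.
    { apply Rmult_le_compat; try (left; apply exp_pos); auto; nra. }
    lra.
  - replace (Finite 0) with (Finite ((1 + 4 * exp 1) * 0)) by (f_equal; ring).
    apply is_lim_seq_mult'; [apply is_lim_seq_const|exact Hw].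
Qed.

Lemma Ccvg_Rcpow_tau (z : C) (k : nat) : Ccvg (fun N => Rcpow (tau N k) z) 1.
Proof.
  unfold Rcpow. apply Ccvg_Cexp_0. apply Ccvg_eq with (z * RtoC 0); [ring|].
  apply Ccvg_mult; [apply Ccvg_const|]. apply Ccvg_RtoC.
  (* Squeeze 1 - 1/tau <= ln tau <= 0, from ln t <= t - 1 at [tau] and at its inverse. *)
  apply is_lim_seq_le_le with (u := fun N => (1 - / tau N k)%R) (w := fun _ => 0%R).
  - intros N. pose proof (tau_pos N k) as Hp. pose proof (tau_le_1 N k) as H1.
    assert (Hln : forall t, (0 < t)%R -> (ln t <= t - 1)%R).
    { intros t Ht. pose proof (exp_ineq1_le (ln t)) as H. rewrite exp_ln in H by auto. lra. }
    pose proof (Hln _ Hp). pose proof (Hln _ (Rinv_0_lt_compat _ Hp)) as H2.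
    rewrite ln_Rinv in H2 by auto. lra.
  - replace (Finite 0) with (Finite (1 - / 1)) by (f_equal; field).
    apply is_lim_seq_minus'; [apply is_lim_seq_const|].
    apply (is_lim_seq_inv _ 1%R); [|intros E; injection E; lra].
    apply lim_lin. lra.
  - apply is_lim_seq_const.
Qed.

Lemma Ccvg_gq_S (z : C) (k : nat) : Ccvg (fun N => gauss_quot z (S (N - k))) (rGamma z).
Proof.
  apply (Ccvg_subseq (fun n => gauss_quot z (S n)) _ (fun N => (N - k)%nat) (filterlim_minus k)).
  apply Ccvg_ext with (fun n => gauss_quot z (n + 1)%nat); [intros n; f_equal; lia|]. apply Ccvg_incr_n, gauss_quot_Cv.
Qed.

Lemma Ccvg_gq_N (z : C) : Ccvg (fun N => gauss_quot z (S N)) (rGamma z).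
Proof.
  apply Ccvg_ext with (fun n => gauss_quot z (n + 1)%nat); [intros n; f_equal; lia|]. apply Ccvg_incr_n, gauss_quot_Cv.
Qed.

Lemma Ccvg_rho (x e : C) (k : nat) : not_pole (1 - x) ->
  Ccvg (fun N => rho x e N k) (rGamma (1 - x - e) / rGamma (1 - x)).
Proof.
  intros Hx. apply Ccvg_eq with (rGamma (1 - x - e) / rGamma (1 - x) * 1); [ring|].
  apply Ccvg_mult; [|apply Ccvg_Rcpow_tau]. apply Ccvg_div; [apply Ccvg_gq_S|apply Ccvg_gq_N|now apply rGamma_neq_0].
Qed.

Lemma Ccvg_Aterm (x e : C) (k : nat) : not_pole (1 - x) ->
  Ccvg (fun N => Aterm x e N k) (poch (x + e) k / INR (fact k) * (rGamma (1 - x - e) / rGamma (1 - x))).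
Proof. intros Hx. apply Ccvg_mult; [apply Ccvg_const|now apply Ccvg_rho]. Qed.

Lemma Ccvg_MV (m : nat) (s : C) : (forall i, s + INR (S i) <> 0) ->
  Ccvg (fun N => Mnorm m N s) (cprod m (fun i => / (s + INR (S i)))).
Proof.
  intros H. apply (Ccvg_cprod m (fun N i => (INR N + INR (S i) - s) / ((INR N + INR (S i)) * (s + INR (S i))))).
  intros i _. apply Ccvg_ext with (fun N => (1 - s * RtoC (/ (INR N + INR (S i)))) * / (s + INR (S i))).
  - intros N. pose proof (N_plus_S_neq_0 N i) as Hn. rewrite RtoC_inv, RtoC_plus.
    + field. auto.
    + intros E. apply Hn. rewrite <- RtoC_plus. now rewrite E.
  - apply Ccvg_eq with ((1 - s * 0) * / (s + INR (S i))); [ring|]. apply Ccvg_mult; [|apply Ccvg_const].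
    apply Ccvg_minus; [apply Ccvg_const|]. apply Ccvg_mult; [apply Ccvg_const|]. apply Ccvg_RtoC.
    apply lim_inv_INR_plus. apply (le_INR 1). lia.
Qed.

(** The sums up to k stay, those of length about N - k have become digamma values. *)
Definition logder_lim (m : nat) (c d : list C) (k : nat) : C :=
  - csum m (fun i => / (INR k + INR (S i)))
  + lsum (fun x => dig_partial x k + digamma (1 - x)) c
  - lsum (fun x => dig_partial x k + digamma (1 - x)) d
  - 2 * (dig_partial 1 k + digamma 1).

Lemma Ccvg_dig_diff (x : C) (k : nat) : not_pole (1 - x) ->
  Ccvg (fun N => dig_diff x N k) (dig_partial x k + digamma (1 - x)).
Proof.
  intros Hx. apply Ccvg_eq with (dig_partial x k - - digamma (1 - x)); [ring|].
  apply Ccvg_minus; [apply Ccvg_const|].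
  apply (Ccvg_subseq (fun n => dig_partial (1 - x) (S n)) _ (fun N => (N - k)%nat) (filterlim_minus k)).
  apply Ccvg_ext with (fun n => dig_partial (1 - x) (n + 1)%nat); [intros n; f_equal; lia|].
  now apply Ccvg_incr_n, digamma_Cv.
Qed.

Lemma Ccvg_Llog (m : nat) (c d : list C) (k : nat) : length c = (length d + 2)%nat ->
  (forall x, In x c -> notZ x) -> (forall x, In x d -> notZ x) ->
  Ccvg (fun N => logder m c d N k) (logder_lim m c d k).
Proof.
  intros Hlen Hc Hd.
  refine (Ccvg_ext _ _ _ (fun N => eq_sym (logder_alt m c d N k Hlen)) _). unfold logder_lim.
  apply Ccvg_minus; [apply Ccvg_minus; [apply Ccvg_plus|]|].
  - apply Ccvg_opp. apply (Ccvg_csum m (fun N i => / (INR N + INR (S i) - INR k) + / (INR k + INR (S i)))).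
    intros i _. apply Ccvg_eq with (0 + / (INR k + INR (S i))); [ring|]. apply Ccvg_plus; [|apply Ccvg_const].
    apply Ccvg_ext_loc with (fun N => RtoC (/ (INR (N - k) + INR (S i)))).
    + exists k. intros N HN. rewrite RtoC_inv, RtoC_plus, minus_INR, RtoC_minus by
        (auto; pose proof (pos_INR (N - k)); pose proof (lt_0_INR (S i) ltac:(lia)); lra).
      f_equal. ring.
    + apply Ccvg_RtoC. apply (is_lim_seq_subseq (fun n => / (INR n + INR (S i)))%R 0 (fun N => (N - k)%nat) (filterlim_minus k)).
      apply lim_inv_INR_plus. apply (le_INR 1). lia.
  - apply (Ccvg_lsum c (fun x N => dig_diff x N k)). intros x Hx. apply Ccvg_dig_diff, notZ_np, notZ_one_minus; auto.
  - apply (Ccvg_lsum d (fun x N => dig_diff x N k)). intros x Hx. apply Ccvg_dig_diff, notZ_np, notZ_one_minus; auto.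
  - apply Ccvg_mult; [apply Ccvg_const|].
    apply Ccvg_eq with (dig_partial 1 k - - digamma 1 + 0); [ring|].
    apply Ccvg_plus; [apply Ccvg_minus; [apply Ccvg_const|]|].
    + apply (Ccvg_subseq (fun n => dig_partial 1 (S n)) _ (fun N => (N - k)%nat) (filterlim_minus k)).
      apply Ccvg_ext with (fun n => dig_partial 1 (n + 1)%nat); [intros n; f_equal; lia|].
      apply Ccvg_incr_n, digamma_Cv, not_pole_1.
    + apply Ccvg_ext with (fun N => RtoC (/ (INR (N - k) + 1))).
      * intros N. unfold recip. rewrite RtoC_inv, RtoC_plus by (pose proof (pos_INR (N - k)); lra).
        f_equal. ring.
      * apply Ccvg_RtoC. apply (is_lim_seq_subseq (fun n => / (INR n + 1))%R 0 (fun N => (N - k)%nat) (filterlim_minus k)).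
        apply is_lim_seq_inv_INR.
Qed.

Lemma cprod_inv_shift (m : nat) (z : C) : cprod m (fun i => / (z + INR (S i))) = / poch (z + 1) m.
Proof.
  induction m as [|m IH]; [unfold poch; simpl; field|]. rewrite poch_S.
  transitivity (cprod m (fun i => / (z + INR (S i))) * / (z + INR (S m))); [reflexivity|].
  rewrite IH, Cinv_mult. f_equal. f_equal. rewrite <- RtoC_INR_S. ring.
Qed.

Lemma poch_plus (z : C) (n k : nat) : poch z (n + k) = poch z n * poch (z + INR n) k.
Proof.
  unfold poch. rewrite cprod_app. f_equal. apply cprod_ext. intros j _. rewrite plus_INR, RtoC_plus. ring.
Qed.

Lemma fact_plus (m k : nat) : RtoC (INR (fact (m + k))) = INR (fact k) * poch (INR k + 1) m.
Proof.
  rewrite <- !poch_1, Nat.add_comm, poch_plus. f_equal. f_equal. ring.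
Qed.

Lemma not_pole_INR_S (k : nat) : not_pole (INR k + 1).
Proof. rewrite RtoC_INR_S. apply not_pole_S_INR. Qed.

Definition coef (m : nat) (c d : list C) (k : nat) : C :=
  lprod (fun x => poch x k) c / (lprod (fun x => poch x k) d * INR (fact (m + k)) * INR (fact k)).

Lemma Ccvg_Ucf (m : nat) (c d : list C) (k : nat) : length c = (length d + 2)%nat ->
  (forall x, In x c -> notZ x) -> (forall x, In x d -> notZ x) ->
  Ccvg (fun N => res_double_coef m c d N k) (coef m c d k).
Proof.
  intros Hlen Hc Hd.
  assert (HA : forall l, (forall x, In x l -> notZ x) ->
    Ccvg (fun N => lprod (fun x => Aterm x 0 N k) l) ((/ INR (fact k)) ^ length l * lprod (fun x => poch x k) l)).
  { intros l Hl. rewrite <- lprod_scal. apply (Ccvg_lprod l (fun x N => Aterm x 0 N k)). intros x Hx.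
    assert (Hx1 : not_pole (1 - x)) by (apply notZ_np, notZ_one_minus; auto).
    refine (Ccvg_eq _ _ _ _ (Ccvg_Aterm x 0 k Hx1)).
    replace (1 - x - 0) with (1 - x) by ring. rewrite Cplus_0_r. field. split; auto using rGamma_neq_0, INR_fact_neq_0_C. }
  assert (Hi : / RtoC (INR (fact k)) <> 0).
  { replace (/ RtoC (INR (fact k))) with (1 / RtoC (INR (fact k))) by (unfold Cdiv; ring).
    apply Cdiv_neq_0; auto using C1_nz, INR_fact_neq_0_C. }
  assert (HPd : lprod (fun x => poch x k) d <> 0) by (apply lprod_neq_0; intros; apply poch_neq_0, notZ_np; auto).
  assert (HT : (/ RtoC (INR (fact k))) ^ length d <> 0) by now apply Cpow_nz.
  apply Ccvg_eq with (cprod m (fun i => / (INR k + INR (S i))) *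
    (((/ INR (fact k)) ^ length c * lprod (fun x => poch x k) c) / ((/ INR (fact k)) ^ length d * lprod (fun x => poch x k) d))
    * (1 * 1)).
  - rewrite cprod_inv_shift. unfold coef. rewrite fact_plus, Hlen, Nat.add_comm. simpl Nat.add. rewrite !Cpow_S_l.
    set (T := (/ RtoC (INR (fact k))) ^ length d) in *.
    pose proof (poch_neq_0 _ m (not_pole_INR_S k)).
    field. repeat split; auto using INR_fact_neq_0_C.
  - unfold res_double_coef. apply Ccvg_mult; [apply Ccvg_mult|].
    + apply Ccvg_MV. intros i. apply N_plus_S_neq_0.
    + apply Ccvg_div; auto. now apply Cmult_neq_0.
    + apply Ccvg_mult; apply Ccvg_lin; lra.
Qed.

Lemma rGamma_poch (z : C) (n : nat) : rGamma z = poch z n * rGamma (z + INR n).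
Proof.
  induction n as [|n IH]; [simpl; unfold poch; simpl; rewrite Cplus_0_r; ring|].
  rewrite IH, poch_S, <- RtoC_INR_S, (rGamma_shift (z + INR n)), Cplus_assoc. ring.
Qed.

Lemma rGamma_1 : rGamma 1 = 1.
Proof.
  apply (Ccvg_unique (gauss_quot 1)); [apply gauss_quot_Cv|]. apply Ccvg_ext with (fun _ => 1); [|apply Ccvg_const].
  intros n. symmetry. apply gauss_quot_1.
Qed.

Lemma rGamma_INR_S (i : nat) : rGamma (INR (S i)) = / INR (fact i).
Proof.
  pose proof (rGamma_poch 1 i) as H. rewrite rGamma_1, poch_1 in H.
  rewrite <- RtoC_INR_S, Cplus_comm.
  replace (rGamma (1 + INR i)) with (/ INR (fact i) * (INR (fact i) * rGamma (1 + INR i)))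
    by (field; apply INR_fact_neq_0_C).
  rewrite <- H. ring.
Qed.

(** The factors below i give (-1)^i / i!, those above i give 1/(m - 1 - i)!. *)
Lemma cprod_skip (m i : nat) : (i < m)%nat ->
  cprod m (fun j => if Nat.eq_dec j i then 1 else / (INR (S j) - INR (S i))) =
  (- (1)) ^ i / (INR (fact i) * INR (fact (m - 1 - i))).
Proof.
  intros Hi. replace m with (i + (1 + (m - 1 - i)))%nat at 1 by lia.
  rewrite cprod_app. change (1 + (m - 1 - i))%nat with (S (m - 1 - i)). rewrite cprod_S_l.
  rewrite Nat.add_0_r. destruct (Nat.eq_dec i i) as [_|]; [|congruence].
  rewrite (cprod_ext (m - 1 - i) _ (fun t => / (1 + INR t))).
  2:{ intros t _. destruct (Nat.eq_dec (i + S t) i); [lia|].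
      replace (INR (S (i + S t)) - INR (S i)) with (1 + INR t); [reflexivity|].
      rewrite !S_INR, plus_INR, S_INR, !RtoC_plus. ring. }
  rewrite (cprod_rev i), (cprod_ext i _ (fun t => - (1) * / (1 + INR t))).
  2:{ intros t Ht. destruct (Nat.eq_dec (i - 1 - t) i); [lia|].
      replace (INR (S (i - 1 - t)) - INR (S i)) with (- (1 + INR t)).
      - field. apply not_pole_1.
      - rewrite !S_INR, !minus_INR by lia. rewrite !RtoC_plus, !RtoC_minus. simpl (INR 1). ring. }
  rewrite cprod_mult, cprod_const, !cprod_inv by (intros; apply not_pole_1).
  change (cprod i (fun t => 1 + INR t)) with (poch 1 i).
  change (cprod (m - 1 - i) (fun t => 1 + INR t)) with (poch 1 (m - 1 - i)).
  rewrite !poch_1. field. split; apply INR_fact_neq_0_C.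
Qed.

Definition res_neg_lim (m : nat) (c d : list C) (i : nat) : C :=
  lprod (fun x => 1 - x) d / lprod (fun x => 1 - x) c *
  ((- (1)) ^ i * lprod (fun x => poch (2 - x) i) d * INR (fact i)
    / (lprod (fun x => poch (2 - x) i) c * INR (fact (m - 1 - i)))).

(** The functional equation turns the limit of [rho] into 1/(1 - x)_(i+1), and splitting off the
    first factor 1 - x produces the prefactor of the finite sum. *)
Lemma Ccvg_V (m : nat) (c d : list C) (i : nat) : (i < m)%nat ->
  (forall x, In x c -> notZ x) -> (forall x, In x d -> notZ x) ->
  Ccvg (fun N => res_neg m c d N i) (res_neg_lim m c d i).
Proof.
  intros Hi Hc Hd.
  assert (HR : forall l, (forall x, In x l -> notZ x) ->
    Ccvg (fun N => lprod (fun x => rho x (negp i) N 0) l)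
       (/ (lprod (fun x => 1 - x) l * lprod (fun x => poch (2 - x) i) l))).
  { intros l Hl. rewrite <- lprod_mult, <- lprod_inv. apply (Ccvg_lprod l (fun x N => rho x (negp i) N 0)).
    intros x Hx. assert (Hx1 : not_pole (1 - x)) by (apply notZ_np, notZ_one_minus; auto).
    refine (Ccvg_eq _ _ _ _ (Ccvg_rho x (negp i) 0 Hx1)).
    rewrite (rGamma_poch (1 - x) (S i)).
    replace (1 - x - negp i) with (1 - x + INR (S i)) by (unfold negp; ring).
    replace ((1 - x) * poch (2 - x) i) with (poch (1 - x) (S i)).
    - field. split; auto using rGamma_neq_0, not_pole_plus, poch_neq_0.
    - change (S i) with (1 + i)%nat. rewrite poch_plus. unfold poch at 1. simpl. rewrite Cplus_0_r.
      replace (1 - x + 1) with (2 - x) by ring. ring. }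
  assert (H1 : forall l, (forall x, In x l -> notZ x) -> lprod (fun x => 1 - x) l <> 0).
  { intros l Hl. apply lprod_neq_0. intros x Hx. apply notZ_neq_0, notZ_one_minus. auto. }
  assert (H2 : forall l, (forall x, In x l -> notZ x) -> lprod (fun x => poch (2 - x) i) l <> 0).
  { intros l Hl. apply lprod_neq_0. intros x Hx. apply poch_neq_0, notZ_np.
    replace (2 - x) with ((1 - x) + IZR 1) by ring. apply notZ_plus_Z, notZ_one_minus. auto. }
  pose proof (rGamma_neq_0 _ (not_pole_S_INR i)) as Hr.
  assert (Hlin : Ccvg (fun N => (INR N + 2) / ((INR N + 1) * gauss_quot (INR (S i)) (S N))) (/ rGamma (INR (S i)))).
  { apply Ccvg_ext with (fun N => (INR (N - 0) + 2) / (INR N + 1) * / gauss_quot (INR (S i)) (S N)).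
    - intros N. rewrite Nat.sub_0_r. unfold Cdiv. rewrite Cinv_mult. ring.
    - apply Ccvg_eq with (1 * / rGamma (INR (S i))); [ring|]. apply Ccvg_mult; [apply Ccvg_lin; lra|].
      apply Ccvg_inv; auto. apply Ccvg_gq_N. }
  unfold res_neg.
  apply Ccvg_eq with (cprod m (fun _ => 1) * ((- (1)) ^ i / (INR (fact i) * INR (fact (m - 1 - i)))) *
     (/ (lprod (fun x => 1 - x) c * lprod (fun x => poch (2 - x) i) c) /
       / (lprod (fun x => 1 - x) d * lprod (fun x => poch (2 - x) i) d)) *
     (/ rGamma (INR (S i)) * / rGamma (INR (S i)))).
  (* The two values 1/[rGamma (i + 1)] give i! squared; one i! cancels against the Lagrange
     weight. *)
  - rewrite cprod_const, Cpow_1_l, rGamma_INR_S. unfold res_neg_lim.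
    field. repeat split; auto using INR_fact_neq_0_C.
  - apply Ccvg_mult; [apply Ccvg_mult|now apply Ccvg_mult].
    + rewrite <- (cprod_skip m i Hi). unfold Mrest. apply Ccvg_mult; [|apply Ccvg_const].
      apply (Ccvg_cprod m (fun N j => (INR N + INR (S j) + INR (S i)) / (INR N + INR (S j)))).
      intros j _. apply Ccvg_ext with (fun N => (INR (N - 0) + RtoC (INR (S j) + INR (S i))) / (INR N + INR (S j))).
      * intros N. rewrite Nat.sub_0_r, RtoC_plus. f_equal. ring.
      * apply Ccvg_lin. apply (le_INR 1). lia.
    + apply Ccvg_div; auto. intros E. apply C1_nz.
      rewrite <- (Cinv_l (lprod (fun x => 1 - x) d * lprod (fun x => poch (2 - x) i) d)), E; [ring|].
      apply Cmult_neq_0; auto.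
Qed.

Definition hterm (a b : list C) (n : nat) : C :=
  lprod (fun x => poch x n) a / (lprod (fun x => poch x n) b * INR (fact n)).

Lemma hyp1_Cv (a b : list C) (l : C) : Ccvg (fun n => csum n (hterm a b)) l -> hyp1 a b = l.
Proof.
  intros H. apply Ccvg_Clim. apply Ccvg_ext with (fun n => csum (n + 1) (hterm a b)).
  - intros n. rewrite Nat.add_1_r. reflexivity.
  - now apply (Ccvg_incr_n (fun n => csum n (hterm a b))).
Qed.

Lemma Gamma_poch (z : C) (n : nat) : not_pole z -> Gamma (z + INR n) = poch z n * Gamma z.
Proof.
  intros Hz. rewrite !Gamma_rGamma by auto using not_pole_plus. rewrite (rGamma_poch z n). field.
  split; auto using rGamma_neq_0, not_pole_plus, poch_neq_0.
Qed.

Lemma poch_reflect (z : C) (m : nat) : poch (- z - INR m + 1) m = (- (1)) ^ m * poch z m.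
Proof.
  unfold poch. rewrite cprod_rev, <- cprod_const, <- cprod_mult. apply cprod_ext. intros j Hj.
  rewrite !minus_INR, !RtoC_minus by lia. simpl (INR 1). ring.
Qed.

(** 1/Gamma(y - c) is written with [rGamma], because [y - c] may be a pole of Gamma. *)
Definition res_shift_const (m : nat) (d' : list C) (c : list C) (y : C) : C :=
  (- (1)) ^ m * Gamma (y - INR m) * Gamma y
    * lprod (fun x => Gamma (y - x)) d' * lprod (fun x => rGamma (y - x)) c
    / ((y - INR m - 1) * (y - 1)).

Lemma lprod_map (f g : C -> C) (l : list C) : lprod f (map g l) = lprod (fun x => f (g x)) l.
Proof. induction l as [|x l IH]; [reflexivity|]. simpl map. rewrite !lprod_cons, IH. reflexivity. Qed.

Lemma lsum_map (f g : C -> C) (l : list C) : lsum f (map g l) = lsum (fun x => f (g x)) l.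
Proof. induction l as [|x l IH]; [reflexivity|]. simpl map. rewrite !lsum_cons, IH. reflexivity. Qed.

(** The factors y - m - 1 and y - 1 are absorbed by the functional equation, leaving (-1)^m Gamma(y
    - m - 1) Gamma(y - 1); the sign is the one from reflecting (y - m - 1)_m into (2 - y)_m. *)
Lemma Gamma_Wfactor (m : nat) (y : C) : notZ y ->
  (- (1)) ^ m * Gamma (y - INR m) * Gamma y / ((y - INR m - 1) * (y - 1)) =
  / (rGamma (y - 1) * rGamma (y - 1) * poch (2 - y) m).
Proof.
  intros Hy. set (z := y - INR m - 1).
  assert (Hz : notZ z).
  { unfold z. replace (y - INR m - 1) with (y - INR m - INR 1) by reflexivity. now apply notZ_minus_INR, notZ_minus_INR. }
  assert (Hy1 : notZ (y - 1)) by (replace (y - 1) with (y - INR 1) by reflexivity; now apply notZ_minus_INR).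
  assert (H2y : notZ (2 - y)) by (replace (2 - y) with (1 - y + IZR 1) by ring; now apply notZ_plus_Z, notZ_one_minus).
  assert (E1 : Gamma (y - INR m) = z * Gamma z).
  { rewrite <- Gamma_shift by now apply notZ_np. f_equal. unfold z. ring. }
  assert (E2 : Gamma y = (y - 1) * Gamma (y - 1)).
  { rewrite <- Gamma_shift by now apply notZ_np. f_equal. ring. }
  assert (E3 : Gamma (y - 1) = poch z m * Gamma z).
  { rewrite <- Gamma_poch by now apply notZ_np. f_equal. unfold z. ring. }
  assert (E4 : poch z m = (- (1)) ^ m * poch (2 - y) m).
  { rewrite <- poch_reflect. f_equal. unfold z. ring. }
  assert (Hs : (- (1)) ^ m <> RtoC 0) by (apply Cpow_nz, Cm1_neq_0).
  assert (Hp : poch (2 - y) m <> 0) by now apply poch_neq_0, notZ_np.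
  assert (E5 : (- (1)) ^ m * Gamma z = Gamma (y - 1) / poch (2 - y) m).
  { rewrite E3, E4. field. auto. }
  rewrite E1, E2. pose proof (notZ_neq_0 _ Hz). pose proof (notZ_neq_0 _ Hy1).
  transitivity (((- (1)) ^ m * Gamma z) * Gamma (y - 1)); [field; auto|].
  rewrite E5, Gamma_rGamma by now apply notZ_np.
  pose proof (rGamma_neq_0 _ (notZ_np _ Hy1)). field. auto.
Qed.

Lemma Ccvg_W (m : nat) (c d' : list C) (y : C) (k : nat) : length c = (length d' + 3)%nat -> notZ y ->
  (forall x, In x c -> notZ x) ->
  (forall x, In x d' -> notZ x /\ notZ (x - y)) ->
  Ccvg (fun N => res_shift m c d' (1 - y) N k)
    (- (lprod (fun x => Gamma (1 - x)) c * (rGamma (1 - y) * lprod (fun x => rGamma (1 - x)) d') * res_shift_const m d' c y)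
      * hterm (map (fun x => 1 + x - y) c)
              ((2 - y) :: (2 - y + INR m) :: map (fun x => 1 + x - y) d') k).
Proof.
  intros Hlen Hy Hc Hd. set (e := 1 - y).
  assert (He : notZ e) by now apply notZ_one_minus.
  assert (Hc1 : forall x, In x c -> not_pole (1 - x)) by (intros; apply notZ_np, notZ_one_minus; auto).
  assert (Hd1 : forall x, In x d' -> not_pole (1 - x)).
  { intros x Hx. apply notZ_np, notZ_one_minus. now apply Hd. }
  assert (Hdx : forall x, In x d' -> not_pole (1 + x - y) /\ not_pole (y - x)).
  { intros x Hx. destruct (Hd x Hx) as [_ H]. split; apply notZ_np.
    - replace (1 + x - y) with ((x - y) + IZR 1) by ring. now apply notZ_plus_Z.
    - replace (y - x) with (- (x - y)) by ring. now apply notZ_opp. }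
  assert (H2y : notZ (2 - y)) by (replace (2 - y) with (1 - y + IZR 1) by ring; now apply notZ_plus_Z, notZ_one_minus).
  assert (Hy1 : notZ (y - 1)) by (replace (y - 1) with (y - INR 1) by reflexivity; now apply notZ_minus_INR).
  set (p := fun x => poch (1 + x - y) k).
  assert (HA : forall l, (forall x, In x l -> not_pole (1 - x)) ->
    Ccvg (fun N => lprod (fun x => Aterm x e N k) l)
      ((/ INR (fact k)) ^ length l * (lprod p l * (lprod (fun x => rGamma (y - x)) l / lprod (fun x => rGamma (1 - x)) l)))).
  { intros l Hl. unfold Cdiv. rewrite <- lprod_inv, <- !lprod_mult, <- lprod_scal.
    apply (Ccvg_lprod l (fun x N => Aterm x e N k)). intros x Hx.
    refine (Ccvg_eq _ _ _ _ (Ccvg_Aterm x e k (Hl x Hx))). unfold p, e.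
    replace (1 - x - (1 - y)) with (y - x) by ring. replace (x + (1 - y)) with (1 + x - y) by ring.
    unfold Cdiv. ring. }
  assert (Hpd : lprod p d' <> 0) by (apply lprod_neq_0; intros; apply poch_neq_0; now apply Hdx).
  assert (Hrd : lprod (fun x => rGamma (y - x)) d' <> 0) by (apply lprod_neq_0; intros; apply rGamma_neq_0; now apply Hdx).
  assert (Hr1 : forall l, (forall x, In x l -> not_pole (1 - x)) -> lprod (fun x => rGamma (1 - x)) l <> 0)
    by (intros; apply lprod_neq_0; intros; apply rGamma_neq_0; auto).
  assert (Hi : / RtoC (INR (fact k)) <> 0).
  { replace (/ RtoC (INR (fact k))) with (1 / RtoC (INR (fact k))) by (unfold Cdiv; ring).
    apply Cdiv_neq_0; auto using C1_nz, INR_fact_neq_0_C. }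
  assert (HT : (/ RtoC (INR (fact k))) ^ length d' <> 0) by now apply Cpow_nz.
  assert (Hp2 : forall n, poch (2 - y) n <> 0) by (intros; now apply poch_neq_0, notZ_np).
  assert (Hp3 : poch (2 - y + INR m) k <> 0) by now apply poch_neq_0, notZ_np, notZ_plus_INR.
  pose proof (rGamma_neq_0 _ (notZ_np _ Hy1)) as HrY.
  assert (Hlin : Ccvg (fun N => (INR (N - k) + 2) / ((INR N + 1) * gauss_quot (- e) (S (N - k)))) (/ rGamma (y - 1))).
  { apply Ccvg_ext with (fun N => (INR (N - k) + 2) / (INR N + 1) * / gauss_quot (- e) (S (N - k))).
    - intros N. unfold Cdiv. rewrite Cinv_mult. ring.
    - apply Ccvg_eq with (1 * / rGamma (y - 1)); [ring|]. apply Ccvg_mult; [apply Ccvg_lin; lra|].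
      apply Ccvg_inv; auto. replace (- e) with (y - 1) by (unfold e; ring). apply Ccvg_gq_S. }
  unfold res_shift.
  apply Ccvg_eq with (- (cprod m (fun i => / (e + INR k + INR (S i))) *
    (((/ INR (fact k)) ^ length c * (lprod p c * (lprod (fun x => rGamma (y - x)) c / lprod (fun x => rGamma (1 - x)) c))) /
     ((/ INR (fact k)) ^ length d' * (lprod p d' * (lprod (fun x => rGamma (y - x)) d' / lprod (fun x => rGamma (1 - x)) d')))) *
    (rGamma e * 1 * 1) *
    ((INR (fact k) / poch (1 + e) k) * (INR (fact k) / poch (1 + e) k)) *
    (/ rGamma (y - 1) * / rGamma (y - 1)))).
  - rewrite cprod_inv_shift. unfold hterm. rewrite !lprod_cons, !lprod_map. fold p.
    replace (1 + e) with (2 - y) by (unfold e; ring).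
    replace (e + INR k + 1) with (2 - y + INR k) by (unfold e; ring).
    assert (EW : res_shift_const m d' c y = / (rGamma (y - 1) * rGamma (y - 1) * poch (2 - y) m) *
       (/ lprod (fun x => rGamma (y - x)) d' * lprod (fun x => rGamma (y - x)) c)).
    { rewrite <- Gamma_Wfactor by auto. unfold res_shift_const.
      rewrite (lprod_ext (fun x => Gamma (y - x)) (fun x => / rGamma (y - x)) d').
      - rewrite lprod_inv. unfold Cdiv. ring.
      - intros x Hx. apply Gamma_rGamma. now apply Hdx. }
    rewrite EW.
    rewrite (lprod_ext (fun x => Gamma (1 - x)) (fun x => / rGamma (1 - x)) c), lprod_inv
      by (intros; apply Gamma_rGamma; auto).
    (* (2 - y)_(m+k) is split in two ways; this creates the lower parameter 2 - y + m and cancels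
       one of the two copies of (2 - y)_k. *)
    assert (EP : poch (2 - y + INR k) m = poch (2 - y) m * poch (2 - y + INR m) k / poch (2 - y) k).
    { rewrite <- poch_plus, Nat.add_comm, poch_plus. field. auto. }
    rewrite EP. fold e. rewrite Hlen, Nat.add_comm. simpl Nat.add. rewrite !Cpow_S_l.
    set (T := (/ RtoC (INR (fact k))) ^ length d') in *.
    pose proof (Hr1 c Hc1). pose proof (Hr1 d' Hd1). pose proof (Hp2 m). pose proof (Hp2 k).
    field. repeat split; auto using INR_fact_neq_0_C.
  - apply Ccvg_opp. apply Ccvg_mult; [apply Ccvg_mult; [apply Ccvg_mult; [apply Ccvg_mult|]|]|].
    + apply Ccvg_MV. intros i. apply notZ_neq_0. now apply notZ_plus_INR, notZ_plus_INR.
    + apply Ccvg_div; auto. apply Cmult_neq_0; auto. apply Cmult_neq_0; auto. apply Cdiv_neq_0; auto.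
    + apply Ccvg_mult; [apply Ccvg_mult|].
      * apply Ccvg_gq_N.
      * apply Ccvg_Rcpow_tau.
      * apply Ccvg_lin. lra.
    + apply Ccvg_const.
    + now apply Ccvg_mult.
Qed.

(** * Passage to the limit and conclusion *)

Lemma dominated_tannery (f : nat -> nat -> C) (g : nat -> C) (b : R) : (1 < b)%R -> dominated f (- b) b ->
  (forall k, Ccvg (fun N => f N k) (g k)) ->
  exists L, Ccvg (fun n => csum n g) L /\ Ccvg (fun N => csum (S N) (f N)) L.
Proof.
  intros Hb [K [HK H]] Hg. destruct (rsum_Rpower_bounded b Hb) as [S0 HS].
  (* The argument [S] is the successor function: row [N] consists of the N + 1 terms k = 0, ...,
     N. *)
  apply (tannery f g (fun k => K * Rpower (INR k + 1) (- b))%R S (K * S0)%R); auto.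
  - intros N k Hk. eapply Rle_trans; [apply H; lia|].
    rewrite <- Rmult_assoc. rewrite <- (Rmult_1_r (K * Rpower (INR k + 1) (- b))) at 2.
    apply Rmult_le_compat_l; [apply Rmult_le_pos; auto; left; apply Rpower_pos|].
    unfold Rpower at 1. apply Rle_trans with (exp 0); [|rewrite exp_0; lra].
    (* The power of [tau] is at most 1, because 0 < [tau] <= 1 and [b] is positive. *)
    assert (Hl : (b * ln (tau N k) <= 0)%R).
    { pose proof (tau_pos N k). pose proof (tau_le_1 N k).
      assert (ln (tau N k) <= 0)%R by (rewrite <- ln_1; destruct H1 as [?| ->]; [left; now apply ln_increasing|lra]).
      nra. }
    destruct Hl as [?| ->]; [left; now apply exp_increasing|lra].
  - intros r. exists r. intros N HN. lia.
  - intros n. rewrite rsum_scal. apply Rmult_le_compat_l; auto.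
Qed.

Lemma scale_small (m : nat) (c d : list C) (K : R) (T : nat -> C) : length c = (length d + 2)%nat ->
  (forall x, In x c -> notZ x) -> (forall x, In x d -> notZ x) ->
  (1 < INR m + 2 + rlsum Re d - rlsum Re c)%R ->
  (forall N, exists u, T N = scale m c d N * u /\ (Cmod u <= (INR N + 1) * K)%R) -> Ccvg T 0.
Proof.
  intros Hlen Hc Hd Hb Hu. set (b := (INR m + 2 + rlsum Re d - rlsum Re c)%R) in *.
  destruct (dominated_Qs m c d Hlen Hc Hd) as [K' [HK' H]]. fold b in H.
  apply Ccvg_0_le with (fun N => K' * Rabs K * Rpower (INR N + 1) (- (b - 1)))%R.
  - intros N. destruct (Hu N) as [u [-> HuN]]. specialize (H N N (le_n N)). rewrite Rpower_0, Rmult_1_r in H.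
    rewrite Cmod_mult. pose proof (pos_INR N).
    replace (Rpower (INR N + 1) (- (b - 1))) with (Rpower (INR N + 1) (- b) * (INR N + 1))%R.
    2:{ rewrite <- (Rpower_1 (INR N + 1)) at 2 by lra. rewrite <- Rpower_plus. f_equal. ring. }
    apply Rle_trans with ((K' * Rpower (INR N + 1) (- b)) * ((INR N + 1) * Rabs K))%R; [|apply Req_le; ring].
    apply Rmult_le_compat; auto using Cmod_ge_0.
    eapply Rle_trans; [exact HuN|]. apply Rmult_le_compat_l; [lra|apply Rle_abs].
  - replace (Finite 0) with (Finite (K' * Rabs K * 0)) by (f_equal; ring).
    apply is_lim_seq_mult'; [apply is_lim_seq_const|].
    assert (He : (0 < b - 1)%R) by lra.
    apply (is_lim_comp_seq exp (fun N => - (b - 1) * ln (INR N + 1))%R m_infty 0).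
    + apply is_lim_exp_m.
    + exists O. intros n _. discriminate.
    + replace m_infty with (Rbar_mult (- (b - 1))%R p_infty).
      * apply is_lim_seq_scal_l. apply (is_lim_comp_seq ln (fun N => INR N + 1)%R p_infty p_infty).
        -- apply is_lim_ln_p.
        -- exists O. intros n _. discriminate.
        -- apply is_lim_seq_ext with (fun n => INR (S n)); [intros; apply S_INR|].
           apply (is_lim_seq_incr_1 INR). apply is_lim_seq_INR.
      * simpl. destruct (Rle_dec 0 (- (b - 1))) as [Hle|Hle]; [exfalso; lra|reflexivity].
Qed.

Lemma W_limit (m : nat) (c d : list C) (j : nat) : length c = (length d + 2)%nat ->
  (forall x, In x c -> notZ x) -> (forall x, In x d -> notZ x) ->
  (forall j k : nat, (j < length d)%nat -> (k < length d)%nat -> j <> k ->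
          notZ (nth j d 0 - nth k d 0)) ->
  (1 < INR m + 2 + rlsum Re d - rlsum Re c)%R -> (j < length d)%nat ->
  let y := nth j d 0 in
  let d' := remove_nth j d in
  Ccvg (fun N => csum (S N) (res_shift m c d' (1 - y) N))
    (- (lprod (fun x => Gamma (1 - x)) c * lprod (fun x => rGamma (1 - x)) d * res_shift_const m d' c y)
      * hyp1 (map (fun x => 1 + x - y) c)
             ((2 - y) :: (2 - y + INR m) :: map (fun x => 1 + x - y) d')).
Proof.
  intros Hlen Hc Hd Hdd Hb Hj y d'.
  assert (Hy : notZ y) by (apply Hd, nth_In; auto).
  assert (Hlen' : length c = (length d' + 3)%nat) by (pose proof (length_remove_nth d j Hj); unfold d'; lia).
  assert (Hd' : forall x, In x d' -> notZ x /\ notZ (x - y)).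
  { intros x Hx. destruct (In_remove_nth d j x Hj Hx) as [i [Hi [Hne ->]]]. split.
    - apply Hd, nth_In; auto.
    - apply Hdd; auto. }
  set (G := lprod (fun x => Gamma (1 - x)) c * lprod (fun x => rGamma (1 - x)) d * res_shift_const m d' c y).
  set (h := hterm (map (fun x => 1 + x - y) c) ((2 - y) :: (2 - y + INR m) :: map (fun x => 1 + x - y) d')).
  destruct (dominated_tannery (res_shift m c d' (1 - y)) (fun k => - G * h k) (INR m + 2 + rlsum Re d - rlsum Re c) Hb) as [L [HL1 HL2]].
  - rewrite (rlsum_split d j Hj). fold y d'.
    replace (Re y + rlsum Re d')%R with (rlsum Re d' + Re (1 - (1 - y)))%R by (unfold Re; simpl; ring).
    apply dominated_W; auto; [now apply notZ_one_minus|].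
    intros x Hx. destruct (Hd' x Hx) as [H1 H2]. repeat split; auto.
    + replace (x + (1 - y)) with ((x - y) + IZR 1) by ring. now apply notZ_plus_Z.
    + replace (1 - x - (1 - y)) with (- (x - y)) by ring. now apply notZ_opp.
  - intros k. refine (Ccvg_eq _ _ _ _ (Ccvg_W m c d' y k Hlen' Hy Hc Hd')). unfold G.
    rewrite (nth_split_remove d j Hj (fun x => rGamma (1 - x))). reflexivity.
  - apply Ccvg_eq with L; auto.
    (* [G] can vanish, for instance when [y - x] is a pole of Gamma for some x in [c]. Convergence
       of the hypergeometric series then does not follow from that of its multiple, but both sides
       are 0 whatever [hyp1] returns. *)
    destruct (Ceq_dec G 0) as [E|HG].
    + rewrite E. apply (Ccvg_unique (fun n => csum n (fun k => - G * h k))); auto.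
      apply Ccvg_ext with (fun _ => RtoC 0); [|apply Ccvg_eq with (RtoC 0); [ring|apply Ccvg_const]].
      intros n. rewrite csum_scal, E. ring.
    + assert (HH : Ccvg (fun n => csum n h) (- / G * L)).
      { apply Ccvg_ext with (fun n => - / G * csum n (fun k => - G * h k)).
        - intros n. rewrite csum_scal. field. auto.
        - apply Ccvg_mult; [apply Ccvg_const|exact HL1]. }
      rewrite (hyp1_Cv _ _ _ HH). field. auto.
Qed.

(** Reflection replaces psi(1 - x) by psi(x) + pi cot(pi x), and the partial sums shift psi(x) to
    psi(x + k); likewise the m reciprocals shift psi(k + 1) to psi(1 + m + k). The logarithms cancel
    by the count of parameters. *)
Lemma logder_lim_eq (m : nat) (c d : list C) (k : nat) : length c = (length d + 2)%nat ->
  (forall x, In x c -> notZ x) -> (forall x, In x d -> notZ x) ->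
  logder_lim m c d k =
  PI * (lsum (fun x => Ccot (PI * x)) c - lsum (fun x => Ccot (PI * x)) d)
  - (lsum (fun x => digamma (x + INR k)) d + digamma (INR k + 1) + digamma (1 + INR m + INR k)
       - lsum (fun x => digamma (x + INR k)) c).
Proof.
  intros Hlen Hc Hd. unfold logder_lim.
  assert (E : forall l, (forall x, In x l -> notZ x) ->
    lsum (fun x => dig_partial x k + digamma (1 - x)) l =
    lsum (fun x => digamma (x + INR k)) l + PI * lsum (fun x => Ccot (PI * x)) l - INR (length l) * ln (INR k + 1)).
  { intros l Hl.
    transitivity (lsum (fun x => digamma (x + INR k) + (PI * Ccot (PI * x) + - ln (INR k + 1))) l).
    - apply lsum_ext. intros x Hx. pose proof (Hl x Hx) as Hx1. rewrite digamma_reflection by auto.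
      rewrite digamma_plus by now apply notZ_np. unfold dig_partial. ring.
    - rewrite !lsum_plus, lsum_scal, lsum_const. ring. }
  rewrite !E by auto. rewrite Hlen, plus_INR, RtoC_plus. simpl (INR 2).
  assert (E1 : digamma (INR k + 1) = digamma 1 + csum k (recip 1)).
  { rewrite Cplus_comm, digamma_plus by apply not_pole_1. reflexivity. }
  assert (E2 : digamma (1 + INR m + INR k) = digamma (INR k + 1) + csum m (fun i => / (INR k + INR (S i)))).
  { replace (1 + INR m + INR k) with ((INR k + 1) + INR m) by ring. rewrite digamma_plus by apply not_pole_INR_S.
    f_equal. apply csum_ext. intros i _. unfold recip. rewrite <- RtoC_INR_S. f_equal. ring. }
  rewrite E2, E1. unfold dig_partial. rewrite RtoC_plus. ring.
Qed.

Lemma Ccvg_is_series (a : nat -> C) (l : C) : Ccvg (fun n => csum n a) l -> is_series a l.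
Proof.
  intros H. assert (H' : Ccvg (fun n => csum (S n) a) l).
  { apply Ccvg_ext with (fun n => csum (n + 1) a); [intros n; f_equal; lia|].
    now apply (Ccvg_incr_n (fun n => csum n a)). }
  (* [sum_n a n] has n + 1 terms, [csum n a] has n. *)
  assert (E : forall n, sum_n a n = csum (S n) a).
  { induction n as [|n IH].
    - rewrite sum_O. simpl. ring.
    - rewrite sum_Sn, IH. reflexivity. }
  apply filterlim_locally. intros eps. destruct (Ccvg_eps _ _ H' eps (cond_pos eps)) as [N HN].
  exists N. intros n Hn. rewrite E. apply C_NormedModule_mixin_compat1. exact (HN n Hn).
Qed.

Lemma Re_minus (a b : C) : Re (a - b) = (Re a - Re b)%R.
Proof. reflexivity. Qed.

Theorem mainTheorem1 (p m : nat) (c d : list C)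
  (hp : (1 <= p)%nat)
  (hc_len : length c = (p + 1)%nat) (hd_len : length d = (p - 1)%nat)
  (hc : forall x, In x c -> notZ x)
  (hd : forall x, In x d -> notZ x)
  (hdd : forall j k : nat, (j < p - 1)%nat -> (k < p - 1)%nat -> j <> k ->
          notZ (nth j d 0 - nth k d 0))
  (hre : (Re (lsum (fun x => x) d - lsum (fun x => x) c) > - INR m - 1)%R) :
  is_series
    (fun k : nat =>
       lprod (fun x => poch x k) c
         / (lprod (fun x => poch x k) d * INR (fact (m + k)) * INR (fact k))
       * (lsum (fun x => digamma (x + INR k)) d + digamma (INR k + 1)
          + digamma (1 + INR m + INR k) - lsum (fun x => digamma (x + INR k)) c))
    (RtoC PI / INR (fact m)
       * (lsum Ccot (map (fun x => RtoC PI * x) c) - lsum Ccot (map (fun x => RtoC PI * x) d))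
       * hyp1 c (RtoC (1 + INR m) :: d)
     + lprod (fun x => 1 - x) d / lprod (fun x => 1 - x) c
       * csum m (fun j => (-1) ^ j * lprod (fun x => poch (2 - x) j) d * INR (fact j)
                          / (lprod (fun x => poch (2 - x) j) c * INR (fact (m - 1 - j))))
     - lprod (fun x => Gamma (1 - x)) c * lprod (fun x => rGamma (1 - x)) d
       * csum (p - 1) (fun k =>
           let dk := nth k d 0 in
           (-1) ^ m * Gamma (dk - INR m) * Gamma dk
             * lprod (fun x => Gamma (dk - x)) (remove_nth k d)
             * lprod (fun x => rGamma (dk - x)) c
             / ((dk - INR m - 1) * (dk - 1))
             * hyp1 (map (fun x => 1 + x - dk) c)
                    ((2 - dk) :: (2 - dk + INR m) :: map (fun x => 1 + x - dk) (remove_nth k d)))).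
Proof.
  rewrite <- hd_len in *.
  assert (Hlen : length c = (length d + 2)%nat) by lia.
  assert (Hb : (1 < INR m + 2 + rlsum Re d - rlsum Re c)%R).
  { rewrite Re_minus, !rlsum_Re in hre. lra. }
  clear hp hc_len hd_len hre.
  assert (Hm1 : RtoC (-1) = - (1)) by (rewrite <- RtoC_opp; reflexivity).
  (* Separate convergence of the coefficient series is what allows the cotangents to be split off
     the residues at the double poles. *)
  destruct (dominated_tannery (res_double_coef m c d) (coef m c d) _ Hb (dominated_Ucf m c d Hlen hc hd)) as [LS [HLS _]].
  { intros k. now apply Ccvg_Ucf. }
  destruct (dominated_tannery (res_double m c d) (fun k => coef m c d k * logder_lim m c d k) _ Hb (dominated_U m c d Hlen hc hd)) as [LU [HLU1 HLU2]].
  { intros k. apply Ccvg_mult; [now apply Ccvg_Ucf|now apply Ccvg_Llog]. }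
  (* Total of the normalized residues. It tends to 0 by the bound on the residue sum and also
     converges group by group; equating the two limits gives the identity. *)
  set (T := fun N => csum (length d) (fun j => csum (S N) (res_shift m c (remove_nth j d) (1 - nth j d 0) N))
     + (csum (S N) (res_double m c d N) + csum m (res_neg m c d N))).
  assert (HT0 : Ccvg T 0).
  { destruct (pfrac_main m c d Hlen hd hdd) as [K [HK HPF]].
    apply (scale_small m c d K T); auto. intros N. destruct (HPF N) as [B HB].
    exists (lsum B (poles m d N)). split; [|apply HB].
    unfold poles. rewrite !lsum_app, lsum_dpoles, !lsum_fam, lsum_nth. unfold T.
    rewrite !Cmult_plus_distr_l, <- !csum_scal. f_equal; [|f_equal].
    - apply csum_ext. intros j Hj. rewrite <- csum_scal. apply csum_ext. intros k Hk. symmetry.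
      apply (residue_W m c d N k j B _ Hlen hc hd hdd HB); auto. lia.
    - apply csum_ext. intros k Hk. symmetry. apply (residue_U m c d N k B _ Hlen hc hd HB). lia.
    - apply csum_ext. intros i Hi. symmetry. apply (residue_V m c d N i B _ Hlen hc hd HB). auto. }
  set (W := fun j => - (lprod (fun x => Gamma (1 - x)) c * lprod (fun x => rGamma (1 - x)) d *
        res_shift_const m (remove_nth j d) c (nth j d 0))
      * hyp1 (map (fun x => 1 + x - nth j d 0) c)
             ((2 - nth j d 0) :: (2 - nth j d 0 + INR m) :: map (fun x => 1 + x - nth j d 0) (remove_nth j d))).
  assert (HT1 : Ccvg T (csum (length d) W + (LU + csum m (res_neg_lim m c d)))).
  { apply Ccvg_plus; [|apply Ccvg_plus; auto].
    - apply (Ccvg_csum (length d) (fun N j => csum (S N) (res_shift m c (remove_nth j d) (1 - nth j d 0) N))).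
      intros j Hj. apply (W_limit m c d j Hlen hc hd hdd Hb Hj).
    - apply (Ccvg_csum m (fun N i => res_neg m c d N i)). intros i Hi. now apply Ccvg_V. }
  pose proof (Ccvg_unique _ _ _ HT1 HT0) as Hsum.
  (* The factor m! comes from (m + k)! = m! (1 + m)_k. *)
  assert (Hhyp : hyp1 c (RtoC (1 + INR m) :: d) = INR (fact m) * LS).
  { apply hyp1_Cv. apply Ccvg_ext with (fun n => INR (fact m) * csum n (coef m c d)).
    - intros n. rewrite <- csum_scal. apply csum_ext. intros k _. unfold hterm, coef.
      rewrite lprod_cons. rewrite (Nat.add_comm m k), fact_plus.
      assert (HPd : lprod (fun x => poch x k) d <> 0) by (apply lprod_neq_0; intros; apply poch_neq_0, notZ_np; auto).
      pose proof (poch_neq_0 _ k (not_pole_INR_S m)).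
      replace (RtoC (1 + INR m)) with (INR m + 1) by (rewrite RtoC_plus; ring).
      field. repeat split; auto using INR_fact_neq_0_C.
    - apply Ccvg_mult; [apply Ccvg_const|exact HLS]. }
  set (cots := lsum (fun x => Ccot (PI * x)) c - lsum (fun x => Ccot (PI * x)) d).
  apply Ccvg_is_series. rewrite !lsum_map. fold cots.
  (* By [logder_lim_eq] the braces of the series equal pi [cots] minus [logder_lim]; [LU] is then
     eliminated through the vanishing total. *)
  apply Ccvg_eq with (PI * cots * LS - LU).
  - rewrite Hhyp.
    replace LU with (- csum (length d) W - csum m (res_neg_lim m c d)).
    2:{ replace LU with ((csum (length d) W + (LU + csum m (res_neg_lim m c d))) - csum (length d) W - csum m (res_neg_lim m c d)) by ring.
        rewrite Hsum. ring. }
    rewrite <- !csum_scal.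
    rewrite Hm1.
    replace (csum (length d) W) with (- (1) * csum (length d) (fun j => - (1) * W j)) by (rewrite csum_scal; ring).
    rewrite (csum_ext (length d) (fun j => - (1) * W j)
      (fun k => lprod (fun x => Gamma (1 - x)) c * lprod (fun x => rGamma (1 - x)) d *
         (res_shift_const m (remove_nth k d) c (nth k d 0)
          * hyp1 (map (fun x => 1 + x - nth k d 0) c)
             ((2 - nth k d 0) :: (2 - nth k d 0 + INR m) :: map (fun x => 1 + x - nth k d 0) (remove_nth k d)))))
      by (intros j _; unfold W; ring).
    unfold res_shift_const, res_neg_lim. cbv zeta. field. apply INR_fact_neq_0_C.
  - apply Ccvg_ext with (fun n => PI * cots * csum n (coef m c d) - csum n (fun k => coef m c d k * logder_lim m c d k)).
    + intros n. unfold Cminus.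
      replace (- csum n (fun k => coef m c d k * logder_lim m c d k)) with
        (- (1) * csum n (fun k => coef m c d k * logder_lim m c d k)) by ring.
      rewrite <- !csum_scal, <- csum_plus. apply csum_ext. intros k _.
      rewrite logder_lim_eq by auto. fold cots. unfold coef. ring.
    + apply Ccvg_minus; auto. apply Ccvg_mult; [apply Ccvg_const|exact HLS].
Qed.
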